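(* Consider a Branching Random Walk in Random Environment on $\mathbb Z^d$ with bounded jumps, whose environment has law $\Theta$ with one-dimensional marginal $Q\times\widetilde Q$ satisfying the standing assumptions. If $$(m^* )^{-1}<\sup_{p\in\hat{\mathcal K}}\ \inf_{\theta\in\mathbb R^d}\Big(\sum_{s\in S}e^{\langle\theta,s\rangle}p(s)\Big),$$ then for $\Theta$-almost all realizations $(\omega,\mu)$ the Branching Markov Chain $(\mathbb Z^d,P_\omega,\mu)$ is strongly recurrent. Otherwise it is transient for $\Theta$-almost all realizations $(\omega,\mu)$.
   Context: Setting. $d\ge1$, $S$ is a finite symmetric set of generators of $\mathbb Z^d$, $\mathcal M$ is the set of probability measures on $S$, and $\mathcal B$ is the set of sequences $\mu=(\mu_k)_{k\ge1}$ of non-negative numbers with $\sum_k\mu_k=1$ and $m(\mu):=\sum_k k\mu_k<\infty$. $Q$ is a probability distribution on $\mathcal M$, with support $\mathcal K$; $\hat{\mathcal K}$ is the convex hull of $\mathcal K$. $\widetilde Q$ is a probability distribution on $\mathcal B$. The environment is $(\omega,\mu)=(\omega_x,\mu_x)_{x\in\mathbb Z^d}$, where $(\omega_x)$ are iid with law $Q$, $(\mu_x)$ are iid with law $\widetilde Q$, and the two families are independent; $\Theta$ is the resulting product measure. Given $\omega$, $P_\omega$ is the transition kernel on $\mathbb Z^d$ with $p_\omega(x,x+s)=\omega_x(s)$ for $s\in S$ and all other transition probabilities $0$. Standing assumptions. (a) There are $\gamma>0$ and a minimal set of generators $S'\subseteq S$ (generating $\mathbb Z^d$ as a semigroup, so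 that the walks considered are irreducible) with $Q\{\omega:\omega(s)>\gamma\ \forall s\in S'\}=1$. (b) $m^*>1$, where $m^*:=\sup\{m(\mu):\mu\in\mathrm{supp}(\widetilde Q)\}\in(1,\infty]$ (with $(m^* )^{-1}=0$ if $m^*=\infty$). Branching Markov Chain $(\mathbb Z^d,P_\omega,\mu)$, for fixed $(\omega,\mu)$: at time $0$ there is one particle at a starting position. At each time step, every particle, located at $x$ say, is replaced by $k$ offspring at $x$ with probability $(\mu_x)_k$, and then each offspring makes one step according to $P_\omega$; all particles branch and move independently of each other and of the past. $\eta(n)$ is the number of particles at time $n$, $x_i(n)$ the position of the $i$th one, and $\mathbb P_{\omega,\mu,x}$ the law of the process started at $x$. With $\alpha(x):=\mathbb P_{\omega,\mu,x}\big(\sum_{n\ge1}\sum_{i=1}^{\eta(n)}\mathbf 1\{x_i(n)=x\}=\infty\big)$, the chain is transient if $\alpha(x)=0$ for all $x$ and strongly recurrent if $\alpha(x)=1$ for all $x$ (each holds for all $x$ as soon as it holds for one $x$). *)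

(* Defs.v *)
From HB Require Import structures.
From mathcomp Require Import all_boot all_order all_algebra finmap.
From mathcomp Require Import all_classical all_reals all_analysis.

Set Implicit Arguments.
Unset Strict Implicit.
Unset Printing Implicit Defensive.

Import Order.TTheory GRing.Theory Num.Theory.
Import numFieldNormedType.Exports.

Local Open Scope classical_set_scope.
Local Open Scope ring_scope.

Definition borel (T : ptopologicalType) := g_sigma_algebraType (@open T).

Definition support (R : realType) (T : ptopologicalType)
    (P : probability (borel T) R) : set T :=
  [set x | forall U : set T, open U -> U x -> (0 < P U)%E].

Definition convex_hull (R : realType) (I : Type) (A : set (I -> R)) : set (I -> R) :=
  [set p | exists n (w : 'I_n -> R) (q : 'I_n -> I -> R),
    [/\ forall i, 0 <= w i, \sum_i w i = 1, forall i, A (q i)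
      & forall z, p z = \sum_i w i * q i z]].

Notation site d := 'rV[int]_d.

(* Every site is a non-empty finite sum of elements of [A], i.e. [A] generates
   the lattice as a semigroup.  For a symmetric [A] this is the same as
   generating it as a group. *)
Definition generates d (A : {fset site d}) : Prop :=
  forall z : site d, exists2 s : seq (site d),
    s != [::] /\ {subset s <= A} & z = \sum_(y <- s) y.

Definition minimal_generating d (A : {fset site d}) : Prop :=
  generates A /\ forall A' : {fset site d}, (A' `<` A)%fset -> ~ generates A'.

Record stepset d := Stepset {
  steps :> {fset site d};
  steps_sym : forall s, s \in steps -> - s \in steps;
  steps_gen : generates steps }.

Lemma steps_neq0 d (S : stepset d) : exists s, s \in (S : {fset site d}).
Proof.
by have [[|y s] [// _ sS] _] := steps_gen S 0; exists y; apply: sS; exact: mem_head.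
Qed.

Section environment.
Variables (R : realType) (d : nat) (S : stepset d).

(* The measure p on S is extended by 0 to the whole lattice. *)
Definition step_laws : set {ptws site d -> R} :=
  [set p | [/\ forall z, 0 <= p z, forall z, z \notin (S : {fset site d}) -> p z = 0
             & \sum_(s <- (S : {fset site d})) p s = 1]].

Definition step_law : Type := step_laws.

(* The space carries the topology of pointwise convergence, which on probability
   sequences is also that of the l^1 distance.
   Offspring distributions charge only k >= 1; the sequence (mu_k)_(k >= 1) is
   extended by mu 0 = 0. *)
Definition mean_offspring (mu : nat -> R) : \bar R :=
  (\sum_(1 <= k <oo) (k%:R * mu k)%:E)%E.

Definition offspring_laws : set {ptws nat -> R} :=
  [set mu | [/\ mu 0%N = 0, forall k, 0 <= mu k,
                (\sum_(1 <= k <oo) (mu k)%:E)%E = 1%E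
              & (mean_offspring mu < +oo)%E]].

Definition offspring_law : Type := offspring_laws.

Fact dirac_step_law : step_laws (fun z => (z == projT1 (cid (steps_neq0 S)))%:R).
Proof.
case: cid => s sS /=; split=> [z|z zS|]; first by rewrite ler0n.
  by case: eqP zS => // ->; rewrite sS.
rewrite (big_fsetD1 s) //= eqxx big1_fset ?addr0 // => z.
by rewrite !inE => /andP[/negbTE->].
Qed.

Fact dirac_offspring_law : offspring_laws (fun k => (k == 1%N)%:R).
Proof.
have E (u : nat -> R) : (forall k, k != 1%N -> u k = 0) ->
    (\sum_(1 <= k <oo) (u k)%:E)%E = (u 1%N)%:E.
  move=> u0; apply/cvg_lim => //; apply: cvg_near_cst.
  exists 2%N => // n /= n2; rewrite big_ltn // big_nat_cond big1 ?adde0 //.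
  by move=> k /andP[/andP[k2 _] _]; rewrite u0 // neq_ltn k2 orbT.
split=> [//|k||]; first by rewrite ler0n.
  by rewrite E // => k /negbTE->.
by rewrite /mean_offspring E ?ltry // => k /negbTE->; rewrite mulr0.
Qed.

HB.instance Definition _ := Topological.copy step_law (set_type step_laws).
HB.instance Definition _ :=
  isPointed.Build step_law (exist (fun p => p \in step_laws) _ (mem_set dirac_step_law)).

HB.instance Definition _ :=
  Topological.copy offspring_law (set_type offspring_laws).
HB.instance Definition _ :=
  isPointed.Build offspring_law (exist (fun mu => mu \in offspring_laws) _ (mem_set dirac_offspring_law)).


Definition one_step_support (Q : probability (borel step_law) R) :
    set (site d -> R) :=
  [set val p | p in support Q].

Definition max_mean_offspring (Qt : probability (borel offspring_law) R) : \bar R :=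
  ereal_sup [set mean_offspring (val mu) | mu in support Qt].

Definition pairing (theta : 'rV[R]_d) (s : site d) : R :=
  \sum_i theta 0 i * (s 0 i)%:~R.

Definition exp_moment (p : site d -> R) (theta : 'rV[R]_d) : R :=
  \sum_(s <- (S : {fset site d})) expR (pairing theta s) * p s.

Definition rectangles : set (set (site d -> step_law * offspring_law)) :=
  [set E | exists x (U : set (borel step_law)) (V : set (borel offspring_law)),
    [/\ measurable U, measurable V & E = [set e | U (e x).1 /\ V (e x).2]]].

Definition env := g_sigma_algebraType rectangles.

Definition is_product_law (Q : probability (borel step_law) R)
    (Qt : probability (borel offspring_law) R) (Theta : probability env R) : Prop :=
  forall (F : {fset site d}) (U : site d -> set (borel step_law))
    (V : site d -> set (borel offspring_law)),
    (forall x, measurable (U x)) -> (forall x, measurable (V x)) ->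
    Theta [set e : env | forall x, x \in F -> U x (e x).1 /\ V x (e x).2] =
      (\big[mule/1]_(x <- F) (Q (U x) * Qt (V x)))%E.

Definition elliptic (Q : probability (borel step_law) R) : Prop :=
  exists gamma : R, exists S' : {fset site d},
    [/\ 0 < gamma, (S' `<=` (S : {fset site d}))%fset, minimal_generating S'
      & Q [set w : step_law | forall s, s \in S' -> gamma < val w s] = 1%E].

Definition transition (e : env) (x y : site d) : R := val (e x).1 (y - x).

Definition offspring (e : env) (x : site d) (k : nat) : R := val (e x).2 k.

(* The particles present at one time are listed as the sequence of their
   positions, siblings being adjacent and in the order of their parents.
   [generation e c c'] is the probability that [c] is followed by [c']: the
   first particle of [c], at [x], has k offspring, which occupy the positions
   [take k c'], and the remaining particles independently produce [drop k c']. *)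
Fixpoint generation (e : env) (c c' : seq (site d)) : R :=
  if c is x :: c0 then
    \sum_(k < (size c').+1)
      offspring e x k * (\prod_(y <- take k c') transition e x y)
        * generation e c0 (drop k c')
  else (c' == [::])%:R.

End environment.

Definition trajectory d := nat -> seq (site d).

HB.instance Definition _ d := gen_eqMixin (trajectory d).
HB.instance Definition _ d := gen_choiceMixin (trajectory d).
HB.instance Definition _ d := isPointed.Build (trajectory d) (fun=> [::]).

Definition trajectory_space d := g_sigma_algebraType
  [set E : set (trajectory d) | exists n c, E = [set X | X n = c]].

Section branching_Markov_chain.
Variables (R : realType) (d : nat) (S : stepset d).

(* P is the law of the branching Markov chain in the environment e started from
   one particle at x, X n being the list x_1(n), ..., x_eta(n)(n). *)
Definition is_bmc_law (e : env R S) (x : site d)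
    (P : probability (trajectory_space d) R) : Prop :=
  forall (n : nat) (c : nat -> seq (site d)),
    P [set X : trajectory_space d | forall k, (k <= n)%N -> X k = c k] =
      ((c 0%N == [:: x])%:R * \prod_(k < n) generation e (c k) (c k.+1))%:E.

Variable PP : env R S -> site d -> probability (trajectory_space d) R.

Definition visits (x : site d) (X : trajectory_space d) : \bar R :=
  (\sum_(1 <= n <oo) (\sum_(i < size (X n)) (nth 0 (X n) i == x)%:R)%:E)%E.

Definition alpha (e : env R S) (x : site d) : \bar R :=
  PP e x [set X | visits x X = +oo%E].

Definition transient (e : env R S) : Prop := forall x, alpha e x = 0%E.

Definition strongly_recurrent (e : env R S) : Prop := forall x, alpha e x = 1%E.

End branching_Markov_chain.

(* Main.v *)
(* For a fixed environment, let G_x be the generating function of mu_x and P the transition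
   operator.  The probability v(x) that the process started at x visits o finitely often is
   a fixed point of phi |-> G_x(P phi(x)), obtained as a monotone limit of iterates; so both
   transience (v(o) = 1) and strong recurrence (v = 0) are questions about this operator.

   Transience.  If sup_p inf_theta <= 1/m* =: r, a minimax argument produces one theta with
   sum_s e^<theta,s> q(s) <= r for all q in K, so f(x) = e^<theta,x> satisfies
   m(x) P f(x) <= f(x).  Let h <= f/f(o) be the expected number of first hits of o.  Then
   1 - v <= (1 - v(o)) h, and if v(o) < 1 the strong maximum principle forces equality
   everywhere, which is impossible at a site where mu_x is not the point mass at 1.

   Recurrence.  Take a mixture p of elements of K with inf_theta > 1/m*.  Tilting by the
   minimizer theta0 makes the walk with step law p centered, so that
   psi(x) = e^<theta0,x> (M - |x|^2)_+ satisfies P_p psi >= lam psi with lam m* > 1; at each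
   site of the ball some component q of the mixture does at least as well as p.  Hence with
   positive probability the environment in a ball is such that psi is a strict subsolution,
   which gives v <= 1 - c on this ball, with c the same for all such balls.  As the random
   walk almost surely meets the union of these balls, v <= 1 - c everywhere, and the
   branching on the balls improves this to v = 0. *)

Require Import Defs.
From mathcomp Require Import all_boot all_order all_algebra finmap.
From mathcomp Require Import all_classical all_reals all_analysis.
From mathcomp Require Import ring lra zify.

Set Implicit Arguments.
Unset Strict Implicit.
Unset Printing Implicit Defensive.

Import Order.TTheory GRing.Theory Num.Theory.
Import numFieldNormedType.Exports.

Local Open Scope classical_set_scope.
Local Open Scope ring_scope.

(** * Offspring generating functions *)

(** Two uniformity problems shape the recurrence half. The chance of reaching [o] from a good ball
    depends on the environment and on the distance, so irreducibility only gives a bound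
    [1 - s * psi] with an uncontrolled s. One application of the branching operator multiplies a
    small amplitude by a factor above 1, so s can be raised to a threshold read off from the pattern
    alone; this is the origin of the uniform constant c. The second problem is to make the walk meet
    the good balls, using ellipticity only. A good ball at distance of order L is reached with a
    probability exponentially small in L, so boxes of radius A^L with A large must be controlled.
    Near each site there are L^d disjoint candidate balls, all bad with probability q^(L^d). For d
    >= 2 this beats the number of sites, of order A^(dL). For d = 1 it does not, and geometry
    replaces the estimate: good intervals on both sides, at least as long as a step, trap the
    walk. *)

Lemma cvg_series_le (R : realType) (u v : nat -> R) (a b : R) :
  (forall k, u k <= v k) -> series u @ \oo --> a -> series v @ \oo --> b -> a <= b.
Proof.
move=> uv ua vb; apply: (ler_cvg_to ua vb); apply: nearW => n.
by rewrite /series /=; apply: ler_sum.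
Qed.

Lemma cvg_seriesD (R : realType) (u v : nat -> R) (a b : R) :
  series u @ \oo --> a -> series v @ \oo --> b ->
  series (fun k => u k + v k) @ \oo --> a + b.
Proof. by move=> ua vb; rewrite (_ : series _ = series u + series v) ?seriesD //; exact: cvgD. Qed.

Lemma cvg_seriesMl (R : realType) (c : R) (u : nat -> R) (a : R) :
  series u @ \oo --> a -> series (fun k => c * u k) @ \oo --> c * a.
Proof.
move=> ua; rewrite (_ : series _ = fun n => c * series u n); first exact: cvgMr.
by apply/funext => n; rewrite /series /= mulr_sumr.
Qed.

Lemma cvg_series_at1 (R : realType) (c : R) :
  series (fun k => c * (k == 1)%:R) @ \oo --> c.
Proof.
apply: cvg_near_cst; exists 2%N => // n /= n2; rewrite /series /=.
rewrite big_ltn; last exact: (leq_trans _ n2).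
rewrite big_ltn // mulr0 add0r mulr1 big_nat_cond big1 ?addr0 //.
by move=> k /andP[/andP[k2 _] _]; rewrite gtn_eqF // mulr0.
Qed.

Lemma cvg_series_nneseries1 (R : realType) (u : nat -> R) (l : R) :
  u 0%N = 0 -> (forall k, 0 <= u k) -> (\sum_(1 <= k <oo) (u k)%:E)%E = l%:E ->
  series u @ \oo --> l.
Proof.
move=> u0 up ul.
have E : \sum_(1 <= k < n) (u k)%:E @[n --> \oo] --> l%:E.
  by rewrite -ul; apply: is_cvg_nneseries => k _ _; rewrite lee_fin.
have {}E : (EFin \o series u) @ \oo --> l%:E.
  apply: cvg_trans E; apply: near_eq_cvg; exists 1%N => // n /= n1.
  by rewrite /series /= (big_ltn n1) u0 add0r sumEFin.
by move/fine_cvgP: E => [].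
Qed.

Definition pgf (R : realType) (mu : nat -> R) (t : R) : R :=
  limn (series (fun k => mu k * t ^+ k)).

Section pgf.
Variables (R : realType) (mu : nat -> R).
Hypothesis mu_law : offspring_laws mu.

Let mu0 : mu 0%N = 0. Proof. by have [] := mu_law. Qed.
Let mu_ge0 k : 0 <= mu k. Proof. by have [] := mu_law. Qed.

Definition real_mean : R := fine (mean_offspring mu).

Lemma mean_offspringE : mean_offspring mu = real_mean%:E.
Proof.
have [_ _ _ mfin] := mu_law; rewrite fineK // ge0_fin_numE //.
by apply: nneseries_ge0 => k _ _; rewrite lee_fin mulr_ge0.
Qed.

Lemma cvg_offspring : series mu @ \oo --> (1 : R).
Proof. by have [_ _ mu1 _] := mu_law; exact: cvg_series_nneseries1. Qed.

Lemma cvg_offspring_mean : series (fun k => k%:R * mu k) @ \oo --> real_mean.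
Proof.
apply: cvg_series_nneseries1; [by rewrite mul0r| |exact: mean_offspringE].
by move=> k; rewrite mulr_ge0.
Qed.

Lemma offspring_sum_le1 n : \sum_(0 <= k < n) mu k <= 1.
Proof.
rewrite -(cvg_lim _ cvg_offspring) //; apply: nondecreasing_cvgn_le; last first.
  by apply: cvgP; exact: cvg_offspring.
by apply: nondecreasing_series => k _ _.
Qed.

Lemma mean_partial_le n : \sum_(0 <= k < n) k%:R * mu k <= real_mean.
Proof.
rewrite -(cvg_lim _ cvg_offspring_mean) //; apply: nondecreasing_cvgn_le; last first.
  by apply: cvgP; exact: cvg_offspring_mean.
by apply: nondecreasing_series => k _ _; rewrite mulr_ge0.
Qed.

Lemma cvg_pgf t : 0 <= t <= 1 -> series (fun k => mu k * t ^+ k) @ \oo --> pgf mu t.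
Proof.
move=> /andP[t0 t1]; apply: (@series_le_cvg _ _ mu).
- by move=> k; rewrite mulr_ge0 ?exprn_ge0.
- by [].
- by move=> k; rewrite ler_piMr // exprn_ile1.
- by apply: cvgP; exact: cvg_offspring.
Qed.

Lemma pgf_ge0 t : 0 <= t <= 1 -> 0 <= pgf mu t.
Proof.
move=> t01; apply: (@cvg_series_le _ (fun=> 0) _ _ _ _ _ (cvg_pgf t01)).
  by move=> k; rewrite mulr_ge0 ?exprn_ge0 //; case/andP: t01.
rewrite (_ : series _ = cst 0); first exact: cvg_cst.
by apply/funext => n; rewrite /series /= big1.
Qed.

Lemma pgf_mono s t : 0 <= s -> s <= t -> t <= 1 -> pgf mu s <= pgf mu t.
Proof.
move=> s0 st t1; have t0 := le_trans s0 st.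
apply: (@cvg_series_le _ _ _ _ _ _ (cvg_pgf _) (cvg_pgf _)) => [k||].
- by rewrite ler_wpM2l // lerXn2r.
- by rewrite s0 (le_trans st).
- by rewrite t0.
Qed.

(** Term by term, [t ^+ k - s ^+ k <= k%:R * (t - s)] on the unit interval. The finite mean thus
    makes the branching operator continuous, so that fixed-point equations pass to limits. *)
Lemma pgf_lipschitz s t : 0 <= s -> s <= t -> t <= 1 ->
  pgf mu t - pgf mu s <= real_mean * (t - s).
Proof.
move=> s0 st t1; have t0 := le_trans s0 st.
have s1 := le_trans st t1.
have Gt := @cvg_pgf t ltac:(by rewrite t0).
have Gs := @cvg_pgf s ltac:(by rewrite s0).
have H := cvg_seriesD Gt (cvg_seriesMl (c := -1) Gs).
have M := cvg_seriesMl (c := t - s) cvg_offspring_mean.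
rewrite mulrC -[X in _ - X]mul1r -mulNr.
apply: cvg_series_le H M => k /=.
suff : t ^+ k - s ^+ k <= k%:R * (t - s).
  by move=> /(ler_wpM2l (mu_ge0 k)); lra.
elim: k => [|k IH]; first by rewrite !expr0 subrr mul0r.
rewrite !exprS -natr1 mulrDl mul1r.
have -> : t * t ^+ k - s * s ^+ k = t * (t ^+ k - s ^+ k) + s ^+ k * (t - s) by ring.
apply: lerD.
  by rewrite (le_trans _ IH) // ler_piMl // subr_ge0 lerXn2r.
by rewrite ler_piMl ?subr_ge0 // exprn_ile1.
Qed.

(** Replacing [t ^+ k] by [t ^+ 2] for all k >= 2 leaves a law on {1, 2}. The gain over [t] when
    [mu 1 < 1] later drives the decay in [fin_visits_eq0]. *)
Lemma pgf_le_quad t : 0 <= t <= 1 ->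
  pgf mu t <= t * (1 - (1 - mu 1%N) * (1 - t)).
Proof.
move=> t01; have [t0 t1] := andP t01.
have H := cvg_seriesD (cvg_seriesMl (c := t ^+ 2) cvg_offspring)
  (cvg_series_at1 (c := mu 1%N * (t - t ^+ 2))).
rewrite (_ : t * _ = t ^+ 2 * 1 + mu 1%N * (t - t ^+ 2)); last by ring.
apply: cvg_series_le (cvg_pgf t01) H => -[|[|k]] /=.
- by rewrite mu0 !mul0r !mulr0 addr0.
- rewrite expr1; lra.
- rewrite mulr0 addr0 mulrC ler_wpM2r // -addn2 exprD ler_piMl ?exprn_ge0 //.
  by rewrite exprn_ile1.
Qed.

Lemma offspring_le1 k : mu k <= 1.
Proof.
apply: le_trans (offspring_sum_le1 k.+1).
by rewrite big_nat_recr //= lerDr sumr_ge0.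
Qed.

Lemma pgf_le_id t : 0 <= t <= 1 -> pgf mu t <= t.
Proof.
move=> t01; apply: le_trans (pgf_le_quad t01) _; have [t0 t1] := andP t01.
have := offspring_le1 1 => h.
by rewrite ler_piMr // gerBl mulr_ge0 ?subr_ge0.
Qed.

(** For k >= 2 the linear bound [k t] on [1 - (1 - t) ^+ k] has slack at least [t ^+ 2]. The maximum
    principle in [fin_visits_at] lives on this slack. *)
Lemma pgf_compl_le t : 0 <= t <= 1 ->
  1 - pgf mu (1 - t) <= real_mean * t - (1 - mu 1%N) * t ^+ 2.
Proof.
move=> /andP[t0 t1].
have G := @cvg_pgf (1 - t) ltac:(lra).
have H1 := cvg_seriesD cvg_offspring (cvg_seriesMl (c := -1) G).
have H2 := cvg_seriesD (cvg_seriesD (cvg_seriesMl (c := t) cvg_offspring_mean)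
  (cvg_seriesMl (c := - t ^+ 2) cvg_offspring)) (cvg_series_at1 (c := mu 1%N * t ^+ 2)).
rewrite -[X in 1 - X]mul1r -mulNr.
rewrite (_ : _ * t - _ = t * real_mean + - t ^+ 2 * 1 + mu 1%N * t ^+ 2); last by ring.
apply: cvg_series_le H1 H2 => -[|[|k]] /=.
- by rewrite mu0 !(mul0r, mulr0) !addr0.
- rewrite expr1; lra.
- rewrite mulr0 addr0.
  suff : 1 - (1 - t) ^+ k.+2 <= k.+2%:R * t - t ^+ 2.
    move=> /(ler_wpM2l (mu_ge0 k.+2)); lra.
  elim: k => [|k IH]; first by rewrite expr2; lra.
  have X1 : (1 - t) ^+ k.+2 <= 1 by rewrite exprn_ile1; lra.
  have h : 0 <= t * (1 - (1 - t) ^+ k.+2) by rewrite mulr_ge0 // subr_ge0.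
  rewrite exprS -[k.+3%:R]natr1; lra.
Qed.

(** Truncation at [N] avoids the second moment, which may be infinite: only the terms with k <= N
    are kept, and each of them is bounded to second order. *)
Lemma pgf_compl_ge (N : nat) t : 0 <= t <= 1 ->
  t * (\sum_(0 <= k < N.+1) k%:R * mu k) - N%:R ^+ 2 * t ^+ 2 <= 1 - pgf mu (1 - t).
Proof.
move=> /andP[t0 t1].
have G := @cvg_pgf (1 - t) ltac:(lra).
have H1 := cvg_seriesD cvg_offspring (cvg_seriesMl (c := -1) G).
have -> : 1 - pgf mu (1 - t) = 1 + -1 * pgf mu (1 - t) by rewrite mulN1r.
(* Bernoulli's inequality is carried along because the induction step of the second-order bound uses
   it. *)
have K (k : nat) : 1 - k%:R * t <= (1 - t) ^+ k /\
    k%:R * t - k%:R ^+ 2 * t ^+ 2 <= 1 - (1 - t) ^+ k.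
  elim: k => [|k [IH1 IH2]]; first by rewrite !expr0 !mul0r; split; lra.
  have k0 : 0 <= k%:R :> R by [].
  rewrite exprS -[k.+1%:R]natr1; move: ((1 - t) ^+ k) (k%:R) IH1 IH2 k0 => X a *.
  have h1 : 0 <= (1 - t) * (X - (1 - a * t)) by rewrite mulr_ge0; lra.
  have h2 : 0 <= t * (X - (1 - a * t)) by rewrite mulr_ge0; lra.
  have h3 : 0 <= a * t ^+ 2 by rewrite mulr_ge0 // exprn_ge0.
  have h4 := sqr_ge0 t.
  split; nra.
apply: (@le_trans _ _ (\sum_(0 <= k < N.+1) (mu k + - 1 * (mu k * (1 - t) ^+ k)))).
  apply: (@le_trans _ _ (\sum_(0 <= k < N.+1) mu k * (k%:R * t - N%:R ^+ 2 * t ^+ 2))).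
    rewrite mulr_sumr -subr_ge0.
    rewrite (_ : _ - _ = (1 - \sum_(0 <= k < N.+1) mu k) * (N%:R ^+ 2 * t ^+ 2)).
      by rewrite mulr_ge0 ?subr_ge0 ?offspring_sum_le1 // mulr_ge0 ?exprn_ge0.
    have -> : \sum_(0 <= k < N.+1) mu k * (k%:R * t - N%:R ^+ 2 * t ^+ 2) =
      \sum_(0 <= k < N.+1) t * (k%:R * mu k) -
      (\sum_(0 <= k < N.+1) mu k) * (N%:R ^+ 2 * t ^+ 2).
      by rewrite mulr_suml -sumrB; apply: eq_bigr => k _; ring.
    by ring.
  apply: ler_sum_nat => k /andP[_ kN].
  have [_ K2] := K k.
  have : k%:R * t - N%:R ^+ 2 * t ^+ 2 <= 1 - (1 - t) ^+ k.
    apply: le_trans K2; rewrite lerD2l lerN2 ler_wpM2r ?exprn_ge0 //.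
    by rewrite lerXn2r ?nnegrE // ler_nat.
  move/(ler_wpM2l (mu_ge0 k)); lra.
rewrite -(cvg_lim _ H1) //.
apply: (@nondecreasing_cvgn_le _ (series _)); last by apply: cvgP; exact: H1.
apply: nondecreasing_series => k _ _ /=.
have : (1 - t) ^+ k <= 1 by rewrite exprn_ile1; lra.
move/(ler_wpM2l (mu_ge0 k)); lra.
Qed.

(** The mass off 1 contributes at most [N] times itself to the truncated mean. Hence a truncated
    mean above 1 bounds [1 - mu 1] from below, uniformly over such laws. *)
Lemma offspring1_le (N : nat) (m0 : R) : m0 < \sum_(0 <= k < N.+1) k%:R * mu k ->
  m0 - 1 < N%:R * (1 - mu 1%N).
Proof.
move=> m0lt; suff : \sum_(0 <= k < N.+1) k%:R * mu k <= N%:R * (1 - mu 1%N) + 1 by lra.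
case: N m0lt => [|N] _; first by rewrite big_nat1 !mul0r; lra.
have h : \sum_(0 <= k < N.+2) k%:R * mu k <=
    \sum_(0 <= k < N.+2) (N.+1%:R * mu k - (if k == 1%N then N%:R * mu 1%N else 0)).
  apply: ler_sum_nat => k /andP[_ kN]; have [->|k1] := eqVneq k 1%N.
    by rewrite -natr1; lra.
  by rewrite subr0 ler_wpM2r // ler_nat.
apply: le_trans h _; rewrite sumrB -mulr_sumr.
rewrite [X in _ - X]big_ltn // [X in _ - (_ + X)]big_ltn // /=.
rewrite [X in _ - (_ + (_ + X))]big_nat_cond.
rewrite [X in _ - (_ + (_ + X))]big1; last by move=> k /andP[/andP[k2 _] _]; rewrite gtn_eqF.
rewrite add0r addr0 -natr1.
have h1 := offspring_sum_le1 N.+2; have h2 := offspring_le1 1.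
have h3 : 0 <= N%:R :> R by [].
by nra.
Qed.

End pgf.

(** * The branching operator *)

Lemma esum_seq_cons (R : realType) (T : choiceType) (F : seq T -> \bar R) :
  (forall c, 0 <= F c)%E -> F [::] = 0%E ->
  (\esum_(c in [set: seq T]) F c =
   \esum_(y in [set: T]) \esum_(c in [set: seq T]) F (y :: c))%E.
Proof.
move=> F0 Fnil; rewrite esum_esum //.
rewrite (esumID [set [::]]) // setTI esum_set1 // Fnil add0e setTI.
apply: (reindex_esum _ _ (fun p : T * seq T => p.1 :: p.2)); split => /=.
- by move=> [y c].
- by move=> [y c] [y' c'] _ _ /= [-> ->].
- by move=> [|y c] //= _; exists (y, c).
Qed.

Lemma esum_interchange (R : realType) (T U : choiceType) (F : T -> U -> \bar R) :
  (forall x y, 0 <= F x y)%E ->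
  (\esum_(x in [set: T]) \esum_(y in [set: U]) F x y =
   \esum_(y in [set: U]) \esum_(x in [set: T]) F x y)%E.
Proof.
move=> F0; rewrite !esum_esum //.
apply: (reindex_esum _ _ (fun p : U * T => (p.2, p.1))); split => //=.
- by move=> [a b] [a' b'] _ _ /= [-> ->].
- by move=> [a b] _; exists (b, a).
Qed.

Lemma esumZl (R : realType) (T : choiceType) (D : set T) (a : R) (F : T -> \bar R) :
  0 <= a -> (forall i, 0 <= F i)%E ->
  (\esum_(i in D) (a%:E * F i) = a%:E * \esum_(i in D) F i)%E.
Proof.
move=> a0 F0; rewrite /esum -ereal_supZl //; last first.
  by apply/set0P; exists (\sum_(x \in set0) F x)%E; exists set0 => //; exact: fsets_set0.
congr ereal_sup; apply/seteqP; split => [_ [X XD <-]|_ [_ [X XD <-] <-]] /=.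
  by exists (\sum_(x \in X) F x)%E; rewrite ?ge0_mule_fsumr //; exists X.
by exists X => //; rewrite ge0_mule_fsumr.
Qed.

Lemma esum_nat_lt (R : realType) (n : nat) (f : nat -> \bar R) :
  (forall k, 0 <= f k)%E -> (forall k, (n <= k)%N -> f k = 0%E) ->
  (\esum_(k in [set: nat]) f k = \sum_(k < n) f k)%E.
Proof.
move=> f0 fn; rewrite -nneseries_esumT //; apply: cvg_lim => //.
apply: cvg_near_cst; exists n => // m /= nm.
rewrite -(big_mkord xpredT f) (@big_cat_nat _ _ _ n) //= [X in (_ + X)%E]big_nat_cond.
by rewrite [X in (_ + X)%E]big1 ?adde0 // => k /andP[/andP[nk _] _]; exact: fn.
Qed.

Section operators.
Variables (R : realType) (d : nat) (S : stepset d).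
Implicit Types (e : env R S) (phi : site d -> R) (x : site d) (c : seq (site d)).

Definition avg e phi x : R :=
  \sum_(s <- (S : {fset site d})) val (e x).1 s * phi (x + s).

Definition branch e phi x : R := pgf (offspring e x) (avg e phi x).

Lemma step_lawP e x : step_laws S (val (e x).1).
Proof. by have := valP (e x).1; rewrite inE. Qed.

Lemma offspring_lawP e x : offspring_laws (offspring e x).
Proof. by have := valP (e x).2; rewrite inE. Qed.

Lemma step_ge0 e x s : 0 <= val (e x).1 s.
Proof. by have [] := step_lawP e x. Qed.

Lemma avgD e phi psi x : avg e (fun y => phi y + psi y) x = avg e phi x + avg e psi x.
Proof. by rewrite -big_split; apply: eq_bigr => s _; rewrite mulrDr. Qed.

Lemma avgZ e (a : R) phi x : avg e (fun y => a * phi y) x = a * avg e phi x.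
Proof. by rewrite mulr_sumr; apply: eq_bigr => s _; rewrite mulrCA. Qed.

Lemma avg_cst e (a : R) x : avg e (fun=> a) x = a.
Proof.
rewrite /avg -mulr_suml; have [_ _ ->] := step_lawP e x; by rewrite mul1r.
Qed.

Lemma avgB e phi psi x : avg e (fun y => phi y - psi y) x = avg e phi x - avg e psi x.
Proof. by rewrite -sumrB; apply: eq_bigr => s _; rewrite mulrBr. Qed.

Lemma avg_compl e phi x : avg e (fun y => 1 - phi y) x = 1 - avg e phi x.
Proof. by rewrite avgB avg_cst. Qed.

Lemma avg_le e phi psi x : (forall s, s \in (S : {fset site d}) -> phi (x + s) <= psi (x + s)) ->
  avg e phi x <= avg e psi x.
Proof.
move=> h; rewrite /avg big_seq [leRHS]big_seq; apply: ler_sum => s sS.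
by rewrite ler_wpM2l ?step_ge0 // h.
Qed.

Lemma avg_ge0 e phi x : (forall y, 0 <= phi y) -> 0 <= avg e phi x.
Proof. by move=> h; apply: sumr_ge0 => s _; rewrite mulr_ge0 ?step_ge0. Qed.

Lemma avg_01 e phi x : (forall y, 0 <= phi y <= 1) -> 0 <= avg e phi x <= 1.
Proof.
move=> h; rewrite avg_ge0 => [|y]; last by case/andP: (h y).
rewrite -[X in _ <= X](avg_cst e 1 x); apply: avg_le => s _.
by case/andP: (h (x + s)).
Qed.

Lemma branch_01 e phi x : (forall y, 0 <= phi y <= 1) -> 0 <= branch e phi x <= 1.
Proof.
move=> h; have a01 := avg_01 e x h; have L := offspring_lawP e x.
rewrite /branch pgf_ge0 //= (le_trans (pgf_le_id L a01)) //.
by case/andP: a01.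
Qed.

Lemma branch_le e phi psi x : (forall y, 0 <= phi y) -> (forall y, phi y <= psi y) ->
  (forall y, psi y <= 1) -> branch e phi x <= branch e psi x.
Proof.
move=> h0 h h1; apply: pgf_mono; first exact: offspring_lawP.
- exact: avg_ge0.
- by apply: avg_le => s _.
- by rewrite -[leRHS](avg_cst e 1 x); apply: avg_le => s _.
Qed.

Lemma esum_transition e phi x : (forall y, 0 <= phi y) ->
  (\esum_(y in [set: site d]) (transition e x y * phi y)%:E = (avg e phi x)%:E)%E.
Proof.
move=> phi0; rewrite (@reindex_esum _ _ _ setT setT (fun s => x + s)); last first.
  split => //= [s t _ _ /addrI //|y _]; exists (y - x) => //.
pose f s := (val (e x).1 s * phi (x + s))%:E : \bar R.
rewrite (eq_esum (b := f)); last by move=> s _; rewrite /f /transition addrAC subrr add0r.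
have -> : (\esum_(s in [set: site d]) f s =
    \esum_(s in [set` (S : {fset site d})]) f s)%E.
  rewrite [RHS]esum_mkcond; apply: eq_esum => s _.
  case: ifPn => //; rewrite notin_setE /= => /negP sS.
  by have [_ h _] := step_lawP e x; rewrite /f h // mul0r.
rewrite esum_fset //; last first.
  by move=> s _; rewrite lee_fin mulr_ge0 ?step_ge0.
by rewrite fsbig_finite //= set_fsetK sumEFin.
Qed.

Lemma generation_ge0 e c c' : 0 <= generation e c c'.
Proof.
elim: c c' => [|x c IH] c' /=; first by rewrite ler0n.
apply: sumr_ge0 => k _; rewrite mulr_ge0 // mulr_ge0 //.
  by have [] := offspring_lawP e x.
by apply: prodr_ge0 => y _; exact: step_ge0.
Qed.

(* A family of independent particles sees a multiplicative functional as a product. *)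
Lemma esum_generation e phi c : (forall y, 0 <= phi y <= 1) ->
  (\esum_(c' in [set: seq (site d)]) (generation e c c' * \prod_(y <- c') phi y)%:E =
   (\prod_(x <- c) branch e phi x)%:E)%E.
Proof.
move=> phi01; have phi0 y : 0 <= phi y by case/andP: (phi01 y).
have prod0 c' : 0 <= \prod_(y <- c') phi y by apply: prodr_ge0.
elim: c => [|x c IH] /=.
  rewrite big_nil (esumID [set [::]]) //; last first.
    by move=> c' _; rewrite lee_fin mulr_ge0.
  rewrite !setTI esum_set1 ?lee_fin ?mulr_ge0 //.
  rewrite eqxx big_nil mulr1 esum1 ?adde0 // => c' /= /eqP/negbTE ->.
  by rewrite mul0r.
(* The indicator extends the sum over k, whose range depends on [c'], to all of [nat], so that the
   two sums can be interchanged. For fixed k, the first child is then peeled off by induction. *)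
pose a k (c' : seq (site d)) := (k <= size c')%:R *
  (\prod_(y <- take k c') transition e x y) * generation e c (drop k c') *
  \prod_(y <- c') phi y.
have a0 k c' : 0 <= a k c'.
  rewrite /a !mulr_ge0 ?ler0n ?generation_ge0 //.
  by apply: prodr_ge0 => y _; exact: step_ge0.
have mu0 k : 0 <= offspring e x k by have [] := offspring_lawP e x.
have aE k : (\esum_(c' in [set: seq (site d)]) (a k c')%:E =
    (avg e phi x ^+ k * \prod_(x <- c) branch e phi x)%:E)%E.
  elim: k => [|k IHk].
    rewrite expr0 mul1r -IH; apply: eq_esum => c' _.
    by rewrite /a take0 drop0 big_nil !mul1r.
  rewrite esum_seq_cons; last 2 first.
  - by move=> c'; rewrite lee_fin.
  - by rewrite /a !mul0r.
  rewrite (eq_esum (b := fun y => ((transition e x y * phi y)%:E *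
    (avg e phi x ^+ k * \prod_(x <- c) branch e phi x)%:E)%E)); last first.
    move=> y _; rewrite -IHk -esumZl //; last 2 first.
    - by rewrite mulr_ge0 ?step_ge0.
    - by move=> c'; rewrite lee_fin.
    apply: eq_esum => c' _; rewrite -EFinM /a /= !big_cons ltnS; congr _%:E; ring.
  under eq_esum do rewrite muleC.
  rewrite esumZl.
  - by rewrite esum_transition // -EFinM; congr _%:E; rewrite exprS; ring.
  - rewrite mulr_ge0 ?exprn_ge0 ?avg_ge0 //; apply: prodr_ge0 => y _.
    by case/andP: (branch_01 e y phi01).
  - by move=> y; rewrite lee_fin mulr_ge0 ?step_ge0.
rewrite (eq_esum (b := fun c' => \esum_(k in [set: nat])
    (offspring e x k * a k c')%:E)); last first.
  move=> c' _; rewrite (@esum_nat_lt _ (size c').+1).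
  - rewrite sumEFin mulr_suml; congr _%:E; apply: eq_bigr => k _.
    by rewrite /a -ltnS ltn_ord mul1r -!mulrA.
  - by move=> k; rewrite lee_fin mulr_ge0.
  - by move=> k kc; rewrite /a leqNgt kc /= !(mul0r, mulr0).
rewrite esum_interchange; last by move=> *; rewrite lee_fin mulr_ge0.
rewrite (eq_esum (b := fun k => ((\prod_(x <- c) branch e phi x)%:E *
    (offspring e x k * avg e phi x ^+ k)%:E)%E)); last first.
  move=> k _; rewrite (eq_esum (b := fun c' => ((offspring e x k)%:E * (a k c')%:E)%E)) //.
  rewrite esumZl //; last by move=> c'; rewrite lee_fin.
  by rewrite aE -!EFinM; congr _%:E; ring.
rewrite esumZl //; last 2 first.
- by apply: prodr_ge0 => y _; case/andP: (branch_01 e y phi01).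
- by move=> k; rewrite lee_fin mulr_ge0 // exprn_ge0 // avg_ge0.
rewrite -nneseries_esumT; last first.
  by move=> k; rewrite lee_fin mulr_ge0 // exprn_ge0 // avg_ge0.
rewrite big_cons mulrC EFinM; congr (_ * _)%E.
apply: cvg_lim => //; apply: (@cvg_trans _ (EFin \o series
  (fun k => offspring e x k * avg e phi x ^+ k) @ \oo)).
  by apply: near_eq_cvg; apply: nearW => n /=; rewrite -sumEFin.
apply: cvg_EFin; first exact: nearW.
have H := cvg_pgf (offspring_lawP e x) (avg_01 e x phi01).
exact: H.
Qed.

End operators.

(** * Avoidance probabilities *)

Lemma countable_bigcup_measurable dp (T : sigmaRingType dp) (U : countType)
    (D : set U) (F : U -> set T) :
  (forall u, D u -> measurable (F u)) -> measurable (\bigcup_(u in D) F u).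
Proof.
move=> mF; rewrite bigcup_mkcond; apply: countable_bigcupT_measurable => [|u].
  exact: countableP.
by case: ifPn => [|_]; [rewrite inE; exact: mF|exact: measurable0].
Qed.

Lemma measure_countable_bigcup dp (T : measurableType dp) (R : realType)
    (mu : {measure set T -> \bar R}) (U : countType) (F : U -> set T) :
  (forall u, measurable (F u)) -> trivIset [set: U] F ->
  (mu (\bigcup_(u in [set: U]) F u) = \esum_(u in [set: U]) mu (F u))%E.
Proof.
move=> mF tF; pose D := (@choice.pickle U) @` setT.
pose G n := if choice.unpickle n is Some u then F u else set0.
have GE u : G (choice.pickle u) = F u by rewrite /G choice.pickleK.
have -> : \bigcup_(u in [set: U]) F u = \bigcup_(n in D) G n.
  apply/seteqP; split => [t [u _ Ft]|t [_ [u _ <-]]].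
    by exists (choice.pickle u); [exists u|rewrite GE].
  by rewrite GE => Ft; exists u.
rewrite measure_bigcup; last 2 first.
- by move=> _ [u _ <-]; rewrite GE.
- move=> _ _ [u _ <-] [u' _ <-]; rewrite !GE => /tF; rewrite /= => h.
  by rewrite h.
rewrite nneseries_esum // set_mem_set (@esum_image _ _ _ setT choice.pickle).
  by apply: eq_esum => u _; rewrite GE.
by move=> u u' _ _ /(pcan_inj choice.pickleK).
Qed.

Section trajectories.
Variables (R : realType) (d : nat) (S : stepset d).
Variables (e : env R S) (x : site d) (P : probability (trajectory_space d) R).
Hypothesis P_bmc : is_bmc_law e x P.
Implicit Types (c : seq (site d)) (o : site d).

Lemma measurable_at n (A : set (seq (site d))) :
  measurable [set X : trajectory_space d | A (X n)].
Proof.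
rewrite (_ : [set X | _] = \bigcup_(c in A) [set X : trajectory_space d | X n = c]).
  by apply: countable_bigcup_measurable => c _; apply: sub_gen_smallest; exists n, c.
by apply/seteqP; split => [X AX|X [c Ac /= ->]] //; exists (X n).
Qed.

Lemma measurable_forall_le n (A : nat -> set (seq (site d))) :
  measurable [set X : trajectory_space d | forall k, (k <= n)%N -> A k (X k)].
Proof.
rewrite (_ : [set X | _] = \bigcap_(k in [set k | (k <= n)%N])
    [set X : trajectory_space d | A k (X k)]); last by [].
by apply: bigcap_measurable => [|k _]; [exists 0%N|exact: measurable_at].
Qed.

(* Probability, started from one particle at the argument, that no particle is at [o] at
   any time i.+1 for which the i-th entry of [bs] is true. *)
Fixpoint avoid o (bs : seq bool) : site d -> R :=
  if bs is b :: bs' then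
    branch e (fun y => if b && (y == o) then 0 else avoid o bs' y)
  else fun=> 1.

Lemma avoid_01 o bs y : 0 <= avoid o bs y <= 1.
Proof.
elim: bs y => [|b bs IH] y /=; first by rewrite ler01 lexx.
by apply: branch_01 => z; case: ifP => // _; rewrite lexx ler01.
Qed.

(** The past up to time [n] is kept in the statement so that the induction on [bs] can extend it by
    one generation. Summing over the countably many values of that generation, [esum_generation]
    collapses the product into one more [branch]. *)
Lemma prob_avoid o bs n (c : nat -> seq (site d)) :
  P [set X : trajectory_space d | (forall k, (k <= n)%N -> X k = c k) /\
      (forall i, (i < size bs)%N -> nth false bs i -> o \notin X (n.+1 + i)%N)] =
  ((c 0%N == [:: x])%:R * (\prod_(k < n) generation e (c k) (c k.+1)) *
   \prod_(y <- c n) avoid o bs y)%:E.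
Proof.
elim: bs n c => [|b bs IH] n c.
  rewrite (_ : [set X | _] = [set X : trajectory_space d |
      forall k, (k <= n)%N -> X k = c k]).
    by rewrite P_bmc [\prod_(y <- c n) _]big1 ?mulr1.
  by apply/seteqP; split => [X []|X XE] //; split.
pose cc c' k := if k == n.+1 then c' else c k.
(* A forbidden generation contributes the empty event, matching the factor 0 at [o] in [avoid]. *)
pose F c' := if b ==> (o \notin c') then [set X : trajectory_space d |
  (forall k, (k <= n.+1)%N -> X k = cc c' k) /\
  (forall i, (i < size bs)%N -> nth false bs i -> o \notin X (n.+2 + i)%N)] else set0.
rewrite (_ : [set X | _] = \bigcup_(c' in [set: seq (site d)]) F c'); last first.
  apply/seteqP; split => [X [XE Xo]|X [c' _]].
    exists (X n.+1); first by []. rewrite /F.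
    have /= := Xo 0%N isT; rewrite addn0 => h0; case: ifPn => [_|]; last first.
      by case: (b) h0 => // /(_ isT) ->.
    split => [k|i ib nb].
      by rewrite /cc leq_eqVlt; case: eqP => [->|_] //= ; exact: XE.
    by have := Xo i.+1; rewrite /= ltnS addnS addSn; apply.
  rewrite /F; case: ifPn => // h0 [XE Xo]; split => [k kn|[|i]].
  - rewrite XE ?(leq_trans kn) // /cc; case: eqP => // kE.
    by rewrite kE ltnn in kn.
  - by move=> _ /= bT; move: h0; rewrite bT addn0 XE // /cc eqxx.
  - by rewrite /= ltnS addnS -addSn; exact: Xo.
rewrite measure_countable_bigcup; last 2 first.
- move=> c'; rewrite /F; case: ifP => // _; apply: measurableI.
    exact: (measurable_forall_le n.+1 (fun k (a : seq (site d)) => a = cc c' k)).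
  rewrite [X in measurable X](_ : _ = \bigcap_(i in [set i | (i < size bs)%N && nth false bs i])
     [set X : trajectory_space d | (fun a : seq (site d) => o \notin a) (X (n.+2 + i)%N)]).
    by apply: bigcap_measurableType => i _; exact: (measurable_at _ (fun a : seq (site d) => o \notin a)).
  by apply/seteqP; split => X h i /=; [move=> /andP[]|move=> ? ?]; apply: h => //=; apply/andP.
- move=> c' c'' _ _ [X []]; rewrite /F; case: ifP => // _ [h1 _].
  case: ifP => // _ [h2 _].
  by have := h1 n.+1 (leqnn _); rewrite h2 // /cc eqxx.
set C := (_ == _)%:R * _.
rewrite (eq_esum (b := fun c' => (C%:E * (generation e (c n) c' *
    \prod_(y <- c') (if b && (y == o) then 0 else avoid o bs y))%:E)%E)).
  rewrite esumZl.
  - rewrite esum_generation ?EFinM //.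
    by move=> y; case: ifP => _; [rewrite lexx ler01|exact: avoid_01].
  - by rewrite /C mulr_ge0 ?ler0n // prodr_ge0 // => k _; exact: generation_ge0.
  - move=> c'; rewrite lee_fin mulr_ge0 ?generation_ge0 // prodr_ge0 // => y _.
    by case: ifP => // _; case/andP: (avoid_01 o bs y).
move=> c' _; rewrite /F; case: ifPn => h0.
  apply: etrans; first exact: IH n.+1 (cc c').
  have ccE k : (k <= n)%N -> cc c' k = c k by move=> kn; rewrite /cc ltn_eqF.
  have ccn : cc c' n.+1 = c' by rewrite /cc eqxx.
  rewrite big_ord_recr /= ccn ccE // ccE // -EFinM /C !mulrA; congr (_%:E).
  rewrite (eq_bigr (fun k : 'I_n => generation e (c k) (c k.+1))); last first.
    by move=> k _; rewrite !ccE // ltnW.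
  congr (_ * _).
  apply: eq_big_seq => y yc; case: (b) h0 => //= oc'.
  by case: eqP => // yo; rewrite yo (negbTE oc') in yc.
rewrite measure0 -EFinM; move: h0; rewrite negb_imply negbK => /andP[-> oc'] /=.
rewrite [X in _ * X](_ : _ = 0) ?mulr0 //.
apply/eqP; rewrite mulf_eq0 prodf_seq_eq0; apply/orP; right; apply/hasP.
by exists o => //=; rewrite eqxx.
Qed.

End trajectories.

Section branch_limits.
Variables (R : realType) (d : nat) (S : stepset d) (e : env R S).
Implicit Types (phi : site d -> R) (x y o : site d).

Lemma branch_lipschitz phi psi x : (forall y, 0 <= phi y <= 1) ->
  (forall y, 0 <= psi y <= 1) ->
  `|branch e phi x - branch e psi x| <=
    real_mean (offspring e x) * `|avg e phi x - avg e psi x|.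
Proof.
move=> h h'; have /andP[p0 p1] := avg_01 e x h; have /andP[q0 q1] := avg_01 e x h'.
have L := offspring_lawP e x.
have K s t : 0 <= s -> s <= t -> t <= 1 ->
    `|pgf (offspring e x) t - pgf (offspring e x) s| <= real_mean (offspring e x) * `|t - s|.
  move=> s0 st t1; rewrite !ger0_norm ?subr_ge0 ?pgf_mono //; exact: pgf_lipschitz.
have [le|/ltW le] := leP (avg e psi x) (avg e phi x); first exact: K.
by rewrite distrC [X in _ <= _ * X]distrC; exact: K.
Qed.

Lemma cvg_avg (phi_ : nat -> site d -> R) phi x :
  (forall y, phi_ ^~ y @ \oo --> phi y) ->
  (fun n => avg e (phi_ n) x) @ \oo --> avg e phi x.
Proof.
move=> h; apply: cvg_big => [|s _]; first exact: add_continuous.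
exact: cvgMr.
Qed.

(** Pointwise convergence suffices: [avg] sees finitely many steps and [pgf] is Lipschitz. *)
Lemma cvg_branch (phi_ : nat -> site d -> R) phi x :
  (forall n y, 0 <= phi_ n y <= 1) -> (forall y, 0 <= phi y <= 1) ->
  (forall y, phi_ ^~ y @ \oo --> phi y) ->
  (fun n => branch e (phi_ n) x) @ \oo --> branch e phi x.
Proof.
move=> h h' H; apply/subr_cvg0.
suff G : `|branch e (phi_ n) x - branch e phi x| @[n --> \oo] --> (0 : R).
  exact: norm_cvg0 G.
have G0 : real_mean (offspring e x) * `|avg e (phi_ n) x - avg e phi x|
    @[n --> \oo] --> (0 : R).
  rewrite -[X in _ --> X](mulr0 (real_mean (offspring e x))).
  apply: cvgMr; rewrite -(normr0 R); apply: cvg_norm; apply/subr_cvg0.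
  exact: cvg_avg.
apply: (squeeze_cvgr _ (cvg_cst 0) G0).
by apply: nearW => n; rewrite normr_ge0 branch_lipschitz.
Qed.

(* [noret o N y], [never o y] and [fin_visits o y] are the probabilities, started from one
   particle at [y], that [o] is not visited at times 0, ..., N, that it is never visited,
   and that it is visited at finitely many times. *)
Fixpoint noret o N : site d -> R :=
  if N is N'.+1 then fun y => if y == o then 0 else branch e (noret o N') y
  else fun y => (y != o)%:R.

Lemma noret_01 o N y : 0 <= noret o N y <= 1.
Proof.
elim: N y => [|N IH] y /=; first by case: eqP; rewrite /= ?lexx ?ler01.
by case: eqP => _; [rewrite lexx ler01|exact: branch_01].
Qed.

Lemma noret_at o N : noret o N o = 0.
Proof. by case: N => [|N] /=; rewrite eqxx. Qed.

Lemma noret_decr o N y : noret o N.+1 y <= noret o N y.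
Proof.
have [->|yo] := eqVneq y o; first by rewrite !noret_at.
elim: N y yo => [|N IH] y yo.
  rewrite /= (negbTE yo) /=.
  by have /andP[] := branch_01 e y (noret_01 o 0).
rewrite -[leRHS]/(if y == o then 0 else branch e (noret o N) y).
rewrite -[leLHS]/(if y == o then 0 else branch e (noret o N.+1) y) (negbTE yo).
apply: branch_le => z; [by case/andP: (noret_01 o N.+1 z)| |by case/andP: (noret_01 o N z)].
have [->|zo] := eqVneq z o; first by rewrite !noret_at.
exact: IH.
Qed.

Lemma avoid_noret o n N :
  avoid e o (nseq n false ++ nseq N.+1 true) = iter n.+1 (branch e) (noret o N).
Proof.
have H M : noret o M = fun y => if y == o then 0 else avoid e o (nseq M true) y.
  elim: M => [|M IH] /=; apply/funext => y; first by case: eqP.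
  by case: eqP => // _; rewrite IH.
elim: n => [|n IH]; first by rewrite /= H.
rewrite [RHS]iterS -IH /=; by congr branch; apply/funext.
Qed.

Definition never o y : R := limn (fun N => noret o N y).

Lemma cvg_noret o y : noret o ^~ y @ \oo --> never o y.
Proof.
have ni : nonincreasing_seq (noret o ^~ y).
  by apply/nonincreasing_seqP => N; exact: noret_decr.
apply: nonincreasing_is_cvgn => //; exists 0 => _ [N _ <-].
by case/andP: (noret_01 o N y).
Qed.

Lemma lim_01 (u : nat -> R) (l : R) : (forall n, 0 <= u n <= 1) ->
  u @ \oo --> l -> 0 <= l <= 1.
Proof.
move=> u01 ul; apply/andP; split.
  by apply: (ler_cvg_to (cvg_cst 0) ul); apply: nearW => n; case/andP: (u01 n).
by apply: (ler_cvg_to ul (cvg_cst (1 : R))); apply: nearW => n; case/andP: (u01 n).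
Qed.

Lemma never_01 o y : 0 <= never o y <= 1.
Proof. exact: (lim_01 (fun N => noret_01 o N y) (@cvg_noret o y)). Qed.

Lemma never_at o : never o o = 0.
Proof.
apply: cvg_lim => //; rewrite (_ : (fun=> _) = cst 0); first exact: cvg_cst.
by apply/funext => N; exact: noret_at.
Qed.

Lemma neverE o y : y != o -> never o y = branch e (never o) y.
Proof.
move=> yo; have h1 : (fun N => noret o N.+1 y) @ \oo --> never o y.
  have := @cvg_noret o y; by rewrite -cvg_shiftS.
have h2 : (fun N => noret o N.+1 y) @ \oo --> branch e (never o) y.
  rewrite (_ : (fun N => _) = (fun N => branch e (noret o N) y)).
    by apply: cvg_branch => [N z|z|z]; [exact: noret_01|exact: never_01|exact: cvg_noret].
  by apply/funext => N /=; rewrite (negbTE yo).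
exact: cvg_unique h1 h2.
Qed.

Lemma iter_never_01 o n y : 0 <= iter n (branch e) (never o) y <= 1.
Proof. by elim: n y => [|n IH] y /=; [exact: never_01|exact: branch_01]. Qed.

Lemma iter_never_incr o n y :
  iter n (branch e) (never o) y <= iter n.+1 (branch e) (never o) y.
Proof.
elim: n y => [|n IH] y /=.
  have [->|yo] := eqVneq y o; last by rewrite -neverE.
  by rewrite never_at; case/andP: (branch_01 e o (never_01 o)).
apply: branch_le => // z; first by case/andP: (iter_never_01 o n z).
by case/andP: (iter_never_01 o n.+1 z).
Qed.

Definition fin_visits o y : R := limn (fun n => iter n (branch e) (never o) y).

Lemma cvg_fin_visits o y :
  (fun n => iter n (branch e) (never o) y) @ \oo --> fin_visits o y.
Proof.
have ni : nondecreasing_seq (fun n => iter n (branch e) (never o) y).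
  by apply/nondecreasing_seqP => n; exact: iter_never_incr.
apply: nondecreasing_is_cvgn => //; exists 1 => _ [N _ <-].
by case/andP: (iter_never_01 o N y).
Qed.

Lemma fin_visits_01 o y : 0 <= fin_visits o y <= 1.
Proof. exact: (lim_01 (fun n => iter_never_01 o n y) (@cvg_fin_visits o y)). Qed.

Lemma fin_visitsE o y : fin_visits o y = branch e (fin_visits o) y.
Proof.
have h1 : (fun n => iter n.+1 (branch e) (never o) y) @ \oo --> fin_visits o y.
  have := @cvg_fin_visits o y; by rewrite -cvg_shiftS.
have h2 : (fun n => iter n.+1 (branch e) (never o) y) @ \oo -->
    branch e (fin_visits o) y.
  apply: cvg_branch => [n z|z|z]; [exact: iter_never_01|exact: fin_visits_01|].
  exact: cvg_fin_visits.
exact: cvg_unique h1 h2.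
Qed.

Lemma iter_noret_01 o n N y : 0 <= iter n (branch e) (noret o N) y <= 1.
Proof. by elim: n y => [|n IH] y /=; [exact: noret_01|exact: branch_01]. Qed.

Lemma cvg_iter_noret o n y :
  (fun N => iter n (branch e) (noret o N) y) @ \oo --> iter n (branch e) (never o) y.
Proof.
elim: n y => [|n IH] y; first exact: cvg_noret.
by apply: cvg_branch => [N z|z|//]; [exact: iter_noret_01|exact: iter_never_01].
Qed.

End branch_limits.

(** Every generation is a finite list, so an infinite number of visiting particles forces infinitely
    many visiting times. Conversely each such time adds at least 1. *)
Lemma visits_infty (R : realType) d (x : site d) (X : trajectory d) :
  visits R x X = +oo%E <-> forall n, exists k, x \in X (n.+1 + k)%N.
Proof.
pose f n : R := \sum_(i < size (X n)) (nth 0 (X n) i == x)%:R.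
have f0 n : 0 <= f n by apply: sumr_ge0 => i _; rewrite ler0n.
have fz n : x \notin X n -> f n = 0.
  move=> xX; apply: big1 => i _; case: eqP => // E.
  by move: xX; rewrite -E mem_nth.
have f1 n : x \in X n -> 1 <= f n.
  move=> xX; have ix : (index x (X n) < size (X n))%N by rewrite index_mem.
  by rewrite /f (bigD1 (Ordinal ix)) //= nth_index // eqxx lerDl sumr_ge0.
have fE0 n : (1 <= n)%N -> true -> (0 <= (f n)%:E)%E by move=> *; rewrite lee_fin.
rewrite /visits; split => [vE n|H].
  apply: contrapT => /forallNP h.
  have : (\sum_(1 <= k <oo) (f k)%:E < +oo)%E.
    rewrite (@nneseries_split _ _ 1 n); last by move=> k _; rewrite lee_fin.
    rewrite [X in (_ + X)%E]eseries0 ?adde0 ?sumEFin ?ltry //.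
    move=> k nk _; rewrite fz //; apply/negP => xX.
    by apply: (h (k - n.+1)%N); rewrite subnKC.
  by rewrite -/f vE.
apply/eqyP => A A0.
have H2 (M : nat) : exists n, M%:R <= \sum_(1 <= k < n) f k.
  elim: M => [|M [n IH]]; first by exists 0%N; apply: sumr_ge0.
  have [k xX] := H n; exists (n.+1 + k).+1.
  rewrite big_nat_recr //= -natr1 lerD ?f1 // (le_trans IH) //.
  case: n {xX} IH => [|n] IH; first by rewrite [leLHS]big_geq //; apply: sumr_ge0.
  rewrite [leRHS](@big_cat_nat _ _ _ n.+1) //=; last by lia.
  by rewrite lerDl sumr_ge0.
have [n h] := H2 (Num.truncn A).+1.
apply: le_trans (nneseries_lim_ge n fE0).
rewrite sumEFin lee_fin (le_trans _ h) // ltW // truncnS_gt //.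
Qed.

Section alpha.
Variables (R : realType) (d : nat) (S : stepset d) (e : env R S).

(** The complement is the increasing union over [n] of the events of no visit after time [n], each a
    decreasing limit over the horizon [N]. Continuity of the measure matches these with the two
    limits defining [never] and [fin_visits]. *)
Lemma prob_visits_infty (x : site d) (P : probability (trajectory_space d) R) o :
  is_bmc_law e x P ->
  P [set X | visits R o X = +oo%E] = (1 - fin_visits e o x)%:E.
Proof.
move=> HP.
pose E n N := [set X : trajectory_space d | forall i, (i < N.+1)%N -> o \notin X (n.+1 + i)%N].
have mE n N : measurable (E n N).
  rewrite (_ : E n N = \bigcap_(i in [set i | (i < N.+1)%N])
     [set X : trajectory_space d | (fun a : seq (site d) => o \notin a) (X (n.+1 + i)%N)]) //.
  by apply: bigcap_measurableType => i _; exact: (measurable_at _ (fun a : seq (site d) => o \notin a)).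
have PE n N : P (E n N) = (iter n.+1 (branch e) (noret e o N) x)%:E.
  pose bs := nseq n false ++ nseq N.+1 true.
  pose c (_ : nat) := [:: x].
  have E0 : P [set X : trajectory_space d | X 0%N = [:: x]] = 1%E.
    have := HP 0%N c; rewrite eqxx big_ord0 mulr1 => <-; congr (P _).
    by apply/seteqP; split => X /= h; [move=> k; rewrite leqn0 => /eqP ->|exact: h].
  have m0 := measurable_at 0 (fun a : seq (site d) => a = [:: x]).
  have E1 := prob_avoid HP o bs 0 c.
  rewrite eqxx big_ord0 !mul1r big_seq1 /bs avoid_noret in E1; rewrite -E1.
  have -> : [set X : trajectory_space d | (forall k, (k <= 0)%N -> X k = c k) /\
      (forall i, (i < size bs)%N -> nth false bs i -> o \notin X (1 + i)%N)] =
      E n N `&` [set X : trajectory_space d | X 0%N = [:: x]].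
    apply/seteqP; split => X /=.
      move=> [h1 h2]; split; last exact: h1.
      move=> i iN; apply: (h2 (n + i)%N).
        by rewrite size_cat !size_nseq ltn_add2l.
      by rewrite nth_cat size_nseq ifF ?addKn ?nth_nseq ?iN // ltnNge leq_addr.
    move=> [h1 h2]; split; first by move=> k; rewrite leqn0 => /eqP ->.
    move=> i; rewrite size_cat !size_nseq nth_cat size_nseq.
    case: (ltnP i n) => [ni _|ni iN _]; first by rewrite nth_nseq ni.
    by have := h1 (i - n)%N; rewrite addSn subnKC //; apply; rewrite ltn_subLR.
  apply/eqP; rewrite eq_le; apply/andP; split; last first.
    by apply: le_measure; rewrite ?inE //; exact: measurableI.
  (* [prob_avoid] computes the event together with the start [[:: x]]; dropping the start adds only
     a null set. *)
  pose B := [set X : trajectory_space d | X 0%N = [:: x]].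
  apply: (@le_trans _ _ (P ((E n N `&` B) `|` ~` B))).
    apply: le_measure; rewrite ?inE //.
      by apply: measurableU; [exact: measurableI|exact: measurableC].
    by move=> X EX; case: (pselect (B X)) => BX; [left|right].
  apply: le_trans (measureU2 _ _ _) _; [exact: measurableI|exact: measurableC|].
  have PB : P (~` B) = 0%E by rewrite probability_setC // E0 subee.
  by rewrite [X in (_ + X <= _)%E](_ : _ = 0%E) ?adde0 //; exact: PB.
have mI n : measurable (\bigcap_N E n N) by apply: bigcap_measurableType.
have PI n : P (\bigcap_N E n N) = (iter n.+1 (branch e) (never e o) x)%:E.
  have P0 : (P (E n 0%N) < +oo)%E by rewrite PE ltry.
  have ni : nonincreasing_seq (E n).
    apply/nonincreasing_seqP => N; apply/subsetPset => X h i iN; apply: h.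
    exact: leq_trans iN _.
  have /cvg_lim <- // := @nonincreasing_cvg_mu _ _ _ P _ P0 (mE n) (mI n) ni.
  apply/cvg_lim => //; rewrite (_ : P \o E n = EFin \o
    (fun N => iter n.+1 (branch e) (noret e o N) x)); last by apply/funext => N; exact: PE.
  apply: cvg_EFin; first exact: nearW.
  have H := @cvg_iter_noret _ _ _ e o n.+1 x; exact: H.
have mU : measurable (\bigcup_n \bigcap_N E n N) by apply: bigcupT_measurable.
have PU : P (\bigcup_n \bigcap_N E n N) = (fin_visits e o x)%:E.
  have ni : nondecreasing_seq (fun n => \bigcap_N E n N).
    apply/nondecreasing_seqP => n; apply/subsetPset => X h N _ i iN.
    by rewrite addSnnS; apply: (h N.+1).
  have /cvg_lim <- // := @nondecreasing_cvg_mu _ _ _ P _ mI mU ni.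
  apply/cvg_lim => //; rewrite (_ : _ \o _ = EFin \o
    (fun n => iter n.+1 (branch e) (never e o) x)); last by apply/funext => n; exact: PI.
  apply: cvg_EFin; first exact: nearW.
  have := @cvg_fin_visits _ _ _ e o x; rewrite -cvg_shiftS => H; exact: H.
rewrite (_ : [set X | _] = ~` (\bigcup_n \bigcap_N E n N)).
  by rewrite probability_setC // PU EFinB.
apply/seteqP; split => X /=.
  move=> /visits_infty h [n _ hn]; have [k xX] := h n.
  by have := hn k I k (ltnSn k); rewrite xX.
move=> h; apply/visits_infty => n; apply: contrapT => /forallNP hn; apply: h.
by exists n => // N _ i _; apply/negP; exact: hn.
Qed.

End alpha.

(** * Transience from a supersolution *)

Lemma generates_ind d (A : {fset site d}) (Q : site d -> Prop) (o : site d) :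
  generates A -> (forall y s, s \in A -> Q y -> Q (y + s)) -> Q o -> forall y, Q y.
Proof.
move=> gA step Qo y; have [l [_ lA] yE] := gA (y - o).
rewrite -(subrKC o y) yE {yE}; elim: l o Qo lA => [|s l IH] o Qo lA.
  by rewrite big_nil addr0.
rewrite big_cons addrA; apply: IH => [|z zl]; last by apply: lA; rewrite inE zl orbT.
by apply: step => //; apply: lA; rewrite mem_head.
Qed.

(** A generating set of the semigroup may fail to be symmetric, so induction along paths towards [o]
    is stated separately from induction along paths leaving [o]. *)
Lemma generates_ind_rev d (A : {fset site d}) (Q : site d -> Prop) (o : site d) :
  generates A -> (forall y s, s \in A -> Q (y + s) -> Q y) -> Q o -> forall y, Q y.
Proof.
move=> gA step Qo y; have [l [_ lA] yE] := gA (o - y).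
rewrite -(subrKC y o) yE in Qo; elim: l y Qo lA {yE} => [|s l IH] y Qo lA.
  by rewrite big_nil addr0 in Qo.
apply: (step y s); first by apply: lA; rewrite mem_head.
apply: IH => [|z zl]; last by apply: lA; rewrite inE zl orbT.
by rewrite big_cons addrA in Qo.
Qed.

Section comparison.
Variables (R : realType) (d : nat) (S : stepset d) (e : env R S).
Implicit Types (phi : site d -> R) (x y o : site d).

Local Notation m x := (real_mean (offspring e x)).

Lemma step_mem x s : 0 < val (e x).1 s -> s \in (S : {fset site d}).
Proof.
move=> p0; apply: contraT => sS; have [_ h _] := step_lawP e x.
by rewrite h // ltxx in p0.
Qed.

Lemma avg_ge_term phi x s :
  (forall t, t \in (S : {fset site d}) -> 0 <= phi (x + t)) ->
  val (e x).1 s * phi (x + s) <= avg e phi x.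
Proof.
move=> phi0.
have t0 t : t \in (S : {fset site d}) -> 0 <= val (e x).1 t * phi (x + t).
  by move=> tS; rewrite mulr_ge0 ?step_ge0 ?phi0.
have [sS|sS] := boolP (s \in (S : {fset site d})); last first.
  have [_ h _] := step_lawP e x; rewrite h // mul0r /avg big_seq.
  by apply: sumr_ge0 => t; exact: t0.
rewrite /avg (big_fsetD1 s) //= lerDl big_seq; apply: sumr_ge0 => t.
by rewrite !inE => /andP[_]; exact: t0.
Qed.

Lemma real_mean_ge1 x : 1 <= m x.
Proof.
have L := offspring_lawP e x.
apply: cvg_series_le (cvg_offspring L) (cvg_offspring_mean L) => -[|k].
  by have [-> _ _ _] := L; rewrite mulr0.
by have [_ h _ _] := L; rewrite ler_peMl // ler1n.
Qed.

Lemma branch_compl_le phi x : (forall y, 0 <= phi y <= 1) ->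
  1 - branch e phi x <= m x * avg e (fun y => 1 - phi y) x -
    (1 - offspring e x 1%N) * avg e (fun y => 1 - phi y) x ^+ 2.
Proof.
move=> h; have h' y : 0 <= 1 - phi y <= 1 by have := h y; lra.
rewrite -[X in 1 - X <= _]/(pgf _ _).
rewrite (_ : avg e phi x = 1 - avg e (fun y => 1 - phi y) x); last first.
  by rewrite avg_compl; ring.
apply: (pgf_compl_le (offspring_lawP e x)); exact: avg_01.
Qed.

Lemma branch_compl_le1 phi x : (forall y, 0 <= phi y <= 1) ->
  1 - branch e phi x <= m x * avg e (fun y => 1 - phi y) x.
Proof.
move=> h; apply: le_trans (branch_compl_le x h) _.
by rewrite gerBl mulr_ge0 ?sqr_ge0 // subr_ge0 (offspring_le1 (offspring_lawP e x)).
Qed.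

Variable S' : {fset site d}.
Hypothesis S'_gen : generates S'.
Hypothesis e_pos : forall x s, s \in S' -> 0 < val (e x).1 s.

(** Every particle has a child, so [pgf_le_id] makes a visit at least as likely as for a single
    walk, which follows a path of positive steps to [o]. *)
Lemma never_lt1 o y : never e o y < 1.
Proof.
apply: (generates_ind_rev (Q := fun y => never e o y < 1) (o := o) S'_gen); last first.
  by rewrite never_at.
move=> {}y s sS' ns; have [->|yo] := eqVneq y o; first by rewrite never_at.
rewrite neverE //; have a01 := avg_01 e y (never_01 e o).
apply: le_lt_trans (pgf_le_id (offspring_lawP e y) a01) _.
rewrite -subr_gt0 -avg_compl.
apply: lt_le_trans (avg_ge_term s _); last first.
  by move=> t _; have := never_01 e o (y + t); lra.
by rewrite mulr_gt0 ?e_pos // subr_gt0.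
Qed.

Variable f : site d -> R.
Hypothesis f_gt0 : forall x, 0 < f x.
Hypothesis f_super : forall x, m x * avg e f x <= f x.

Section hitting.
Variable o : site d.
Hypothesis f_o : f o = 1.

Let m0 x : 0 <= m x. Proof. exact: le_trans ler01 (real_mean_ge1 x). Qed.

(* Expected number of particles that are the first of their line to hit [o], within N steps. *)
Fixpoint hit N : site d -> R :=
  if N is N'.+1 then fun y => if y == o then 1 else m y * avg e (hit N') y
  else fun y => (y == o)%:R.

Lemma hit_at N : hit N o = 1.
Proof. by case: N => [|N] /=; rewrite eqxx. Qed.

Lemma hitS N y : y != o -> hit N.+1 y = m y * avg e (hit N) y.
Proof. by move=> /negbTE /= ->. Qed.

Lemma hit_ge0 N y : 0 <= hit N y.
Proof.
elim: N y => [|N IH] y; first by rewrite ler0n.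
have [->|yo] := eqVneq y o; first by rewrite hit_at.
by rewrite hitS // mulr_ge0 // avg_ge0.
Qed.

Lemma hit_incr N y : hit N y <= hit N.+1 y.
Proof.
have [->|] := eqVneq y o; first by rewrite !hit_at.
elim: N y => [|N IH] y yo.
  by rewrite [hit 0 y]/= (negbTE yo) hit_ge0.
rewrite !hitS // ler_wpM2l //; apply: avg_le => s _.
by have [->|] := eqVneq (y + s) o; [rewrite !hit_at|exact: IH].
Qed.

Lemma hit_le N y : hit N y <= f y.
Proof.
have [->|] := eqVneq y o; first by rewrite hit_at f_o.
elim: N y => [|N IH] y yo; first by rewrite /= (negbTE yo) ltW.
rewrite hitS //; apply: le_trans (f_super y); rewrite ler_wpM2l //.
apply: avg_le => s _; have [->|] := eqVneq (y + s) o; last exact: IH.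
by rewrite hit_at f_o.
Qed.

Definition hitting y : R := limn (fun N => hit N y).

Lemma cvg_hit y : hit ^~ y @ \oo --> hitting y.
Proof.
have ni : nondecreasing_seq (hit ^~ y) by apply/nondecreasing_seqP => N; exact: hit_incr.
by apply: nondecreasing_is_cvgn => //; exists (f y) => _ [N _ <-]; exact: hit_le.
Qed.

Lemma hit_le_hitting N y : hit N y <= hitting y.
Proof.
apply: (nondecreasing_cvgn_le (u_ := hit ^~ y)); last by apply: cvgP; exact: (@cvg_hit y).
by apply/nondecreasing_seqP => k; exact: hit_incr.
Qed.

Lemma hitting_at : hitting o = 1.
Proof.
apply: cvg_lim => //; rewrite (_ : (fun=> _) = cst 1); first exact: cvg_cst.
by apply/funext => N; exact: hit_at.
Qed.

Lemma hittingE y : y != o -> hitting y = m y * avg e hitting y.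
Proof.
move=> yo; have h1 : (fun N => hit N.+1 y) @ \oo --> hitting y.
  have := @cvg_hit y; by rewrite -cvg_shiftS.
have h2 : (fun N => hit N.+1 y) @ \oo --> m y * avg e hitting y.
  rewrite (_ : (fun N => _) = (fun N => m y * avg e (hit N) y)).
    by apply: cvgMr; apply: cvg_avg => z; exact: cvg_hit.
  by apply/funext => N; rewrite hitS.
exact: cvg_unique h1 h2.
Qed.

(** Off [o] this is an equality. At [o] it is inherited from [f], which dominates [hitting] and
    agrees with it there. *)
Lemma hitting_super y : m y * avg e hitting y <= hitting y.
Proof.
have [->|yo] := eqVneq y o; last by rewrite -hittingE.
rewrite hitting_at -f_o; apply: le_trans (f_super o); rewrite ler_wpM2l //.
apply: avg_le => s _; apply: (ler_cvg_to (@cvg_hit (o + s)) (cvg_cst (f (o + s)))).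
by apply: nearW => N; exact: hit_le.
Qed.

(** Markov's inequality for the number of first hits, at each finite horizon and then in the
    limit. *)
Lemma compl_never_le y : 1 - never e o y <= hitting y.
Proof.
have H N z : 1 - noret e o N z <= hit N z.
  elim: N z => [|N IH] z; first by rewrite /=; case: eqP => _; rewrite /=; lra.
  have [->|zo] := eqVneq z o; first by rewrite noret_at hit_at subr0.
  rewrite hitS // [noret _ _ _ _]/= (negbTE zo).
  apply: le_trans (branch_compl_le1 z (noret_01 e o N)) _; rewrite ler_wpM2l //.
  by apply: avg_le => s _.
have L : (fun N => 1 - noret e o N y) @ \oo --> 1 - never e o y.
  by apply: cvgB; [exact: cvg_cst|exact: cvg_noret].
by apply: (ler_cvg_to L (@cvg_hit y)); apply: nearW => N.
Qed.

(** The probability of a visit to [o] at some time >= n; it decreases to that of infinitely many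
    visits. *)
Let a n y := 1 - iter n (branch e) (never e o) y.

Let a_01 n y : 0 <= a n y <= 1.
Proof. by rewrite /a; have := iter_never_01 e o n y; lra. Qed.

Let a_decr n k y : a (n + k)%N y <= a n y.
Proof.
elim: k => [|k IH]; first by rewrite addn0.
apply: le_trans IH; rewrite /a addnS lerD2l lerN2; exact: iter_never_incr.
Qed.

Let a_sub n y : a n.+1 y <= m y * avg e (a n) y.
Proof. exact: branch_compl_le1 (iter_never_01 e o n). Qed.

(** A visit after time [N + k] descends from a first hit of [o]. If that hit comes within k steps,
    more than [N] time units remain after it; the last summand is the expected number of first hits
    coming later. *)
Let a_le N k y : a (N + k.+1)%N y <= a N o * hitting y + (hitting y - hit k y).
Proof.
elim: k y => [|k IH] y.
  have [->|yo] := eqVneq y o.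
    by rewrite hitting_at hit_at subrr addr0 mulr1; exact: a_decr.
  rewrite [hit 0 y]/= (negbTE yo) subr0; apply: (@le_trans _ _ (hitting y)).
    by apply: le_trans (compl_never_le y); exact: (a_decr 0 (N + 1)).
  rewrite lerDr mulr_ge0 //; first by case/andP: (a_01 N o).
  exact: le_trans (hit_ge0 0 y) (hit_le_hitting 0 y).
have [->|yo] := eqVneq y o.
  by rewrite hitting_at hit_at subrr addr0 mulr1; exact: a_decr.
rewrite addnS; apply: le_trans (a_sub _ y) _.
rewrite hitS // [in leRHS]hittingE //.
have -> : a N o * (m y * avg e hitting y) + (m y * avg e hitting y - m y * avg e (hit k) y)
   = m y * avg e (fun z => a N o * hitting z + (hitting z - hit k z)) y.
  by rewrite avgD avgZ avgB; ring.
by rewrite ler_wpM2l //; apply: avg_le => s _.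
Qed.

Let u y := 1 - fin_visits e o y.

Lemma compl_fin_visits_le y : u y <= u o * hitting y.
Proof.
have cu z : a ^~ z @ \oo --> u z.
  by apply: cvgB; [exact: cvg_cst|exact: cvg_fin_visits].
(* The limit in k is taken first, which removes the late first hits; the limit in [N] follows. *)
have H N : u y <= a N o * hitting y.
  have L : (fun k => a (N + k.+1)%N y) @ \oo --> u y.
    rewrite (_ : (fun k => _) = (fun k => a (k + N.+1)%N y)).
      by have := cu y; rewrite -(cvg_shiftn N.+1).
    by apply/funext => k; congr a; lia.
  have L2 : (fun k => a N o * hitting y + (hitting y - hit k y)) @ \oo --> a N o * hitting y.
    rewrite -[X in _ --> X]addr0 -[X in _ + X](subrr (hitting y)).
    apply: cvgD; first exact: cvg_cst.
    by apply: cvgB; [exact: cvg_cst|exact: cvg_hit].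
  by apply: (ler_cvg_to L L2); apply: nearW => k; exact: a_le.
have L : (fun N => a N o * hitting y) @ \oo --> u o * hitting y.
  by apply: cvgMl; exact: cu.
by apply: (ler_cvg_to (cvg_cst (u y)) L); apply: nearW => N; exact: H.
Qed.

(* Strong maximum principle for the ratio [u / hitting], which is maximal at [o]. *)
Lemma fin_visits_at x1 : offspring e x1 1%N < 1 -> fin_visits e o o = 1.
Proof.
move=> mu1; apply: contrapT => v1.
have vo := fin_visits_01 e o.
have u0 y : 0 <= u y by rewrite /u; have := vo y; lra.
have uo : 0 < u o by rewrite lt_neqAle u0 andbT eq_sym subr_eq0 eq_sym; apply/eqP.
(* With h for [hitting], the chain u <= m Pu - (1 - mu 1)(Pu)^2 <= m u(o) Ph <= u(o) h has equal
   ends at such a site, so every link is tight. As m >= 1, tightness of the middle link gives Pu =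
   u(o) Ph. *)
have key y : u y = u o * hitting y ->
    (1 - offspring e y 1%N) * avg e u y ^+ 2 = 0 /\
    avg e u y = u o * avg e hitting y.
  move=> uy.
  have b : u y <= m y * avg e u y - (1 - offspring e y 1%N) * avg e u y ^+ 2.
    by rewrite {1}/u fin_visitsE; exact: branch_compl_le y vo.
  have a1 : avg e u y <= u o * avg e hitting y.
    by rewrite -avgZ; apply: avg_le => s _; exact: compl_fin_visits_le.
  have mu0 := offspring_le1 (offspring_lawP e y) 1.
  have sq : 0 <= (1 - offspring e y 1%N) * avg e u y ^+ 2.
    by rewrite mulr_ge0 ?sqr_ge0 // subr_ge0.
  have hs := hitting_super y; have m1 := real_mean_ge1 y.
  have h1 : u o * (m y * avg e hitting y) <= u o * hitting y by rewrite ler_wpM2l.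
  have h2 : 1 * (u o * avg e hitting y - avg e u y) <=
      m y * (u o * avg e hitting y - avg e u y) by rewrite ler_wpM2r // subr_ge0.
  by split; apply/eqP; rewrite eq_le; apply/andP; split=> //; lra.
have all_eq y : u y = u o * hitting y.
  apply: (generates_ind (Q := fun y => u y = u o * hitting y) (o := o) S'_gen).
    move=> {}y s sS' /key[_ E]; apply/eqP; rewrite eq_le compl_fin_visits_le /=.
    have ge0 z : 0 <= u o * hitting z - u z by rewrite subr_ge0 compl_fin_visits_le.
    have := @avg_ge_term (fun z => u o * hitting z - u z) y s (fun t _ => ge0 (y + t)).
    rewrite avgB avgZ -E subrr.
    by rewrite pmulr_rle0 ?e_pos // subr_le0.
  by rewrite hitting_at mulr1.
have [sq0 E] := key x1 (all_eq x1).
have [s sS'] : exists s, s \in S'.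
  by have [[|s l] [// _ lS'] _] := S'_gen 0; exists s; apply: lS'; rewrite mem_head.
have hp y : 0 < hitting y.
  by apply: lt_le_trans (compl_never_le y); rewrite subr_gt0 never_lt1.
have : 0 < avg e hitting x1.
  apply: lt_le_trans (avg_ge_term s _); first by rewrite mulr_gt0 ?e_pos.
  by move=> t _; exact: ltW.
move/(mulr_gt0 uo); rewrite -E => au.
by move: sq0; apply/eqP; rewrite gt_eqF // mulr_gt0 ?exprn_gt0 // subr_gt0.
Qed.

End hitting.

End comparison.

Lemma supersolution_fin_visits (R : realType) d (S : stepset d) (e : env R S)
    (S' : {fset site d}) (f : site d -> R) (o x1 : site d) :
  generates S' -> (forall x s, s \in S' -> 0 < val (e x).1 s) ->
  (forall x, 0 < f x) ->
  (forall x, real_mean (offspring e x) * avg e f x <= f x) ->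
  offspring e x1 1%N < 1 -> fin_visits e o o = 1.
Proof.
move=> gS' ep f0 fs; pose g y := (f o)^-1 * f y.
apply: (@fin_visits_at _ _ _ _ S' gS' ep g).
- by move=> x; rewrite mulr_gt0 ?invr_gt0.
- by move=> x; rewrite /g avgZ mulrCA ler_wpM2l // invr_ge0 ltW.
- by rewrite /g mulVf // gt_eqF.
Qed.

(** * Recurrence from subsolutions on finite patterns *)

Lemma bernoulli_ge (R : realDomainType) (a : R) n : 0 <= a -> 1 + n%:R * a <= (1 + a) ^+ n.
Proof.
move=> a0; elim: n => [|n IH]; first by rewrite mul0r addr0 expr0.
rewrite exprS; apply: (@le_trans _ _ ((1 + a) * (1 + n%:R * a))).
  rewrite -natr1; have : 0 <= n%:R * a * a by rewrite !mulr_ge0.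
  lra.
by rewrite ler_wpM2l //; lra.
Qed.

Lemma expr_unbounded (R : realType) (a b c : R) : 1 < a -> 0 < c ->
  exists n, b <= a ^+ n * c.
Proof.
move=> a1 c0; pose n := (Num.truncn (b / (c * (a - 1)))).+1; exists n.
have ac : 0 < c * (a - 1) by rewrite mulr_gt0 // subr_gt0.
have h : b <= n%:R * (c * (a - 1)).
  by rewrite -ler_pdivrMr // ltW // truncnS_gt.
have a0 : 0 <= a - 1 by lra.
have := bernoulli_ge n a0; rewrite subrKC => /(ler_wpM2r (ltW c0)).
lra.
Qed.

Lemma expr_decay (R : realType) (q b : R) : 0 <= q -> q < 1 -> 0 <= b ->
  (forall n, b <= q ^+ n) -> b = 0.
Proof.
move=> q0 q1 b0 H; apply/eqP; rewrite eq_le b0 andbT.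
have C : (fun n => q ^+ n) @ \oo --> (0 : R) by apply: cvg_expr; rewrite ger0_norm.
by apply: (ler_cvg_to (cvg_cst b) C); apply: nearW.
Qed.

Section subsolution.
Variables (R : realType) (d : nat) (S : stepset d) (e : env R S).
Variable S' : {fset site d}.
Hypothesis S'_gen : generates S'.
Hypothesis e_pos : forall x s, s \in S' -> 0 < val (e x).1 s.

Variables (psi : site d -> R) (B : seq (site d)).
Variables (N : nat) (m0 m1 lam Psi s0 : R).
Hypothesis psi_ge0 : forall y, 0 <= psi y.
Hypothesis psi_le : forall y, psi y <= Psi.
Hypothesis psi_supp : forall y, 0 < psi y -> y \in B.
Hypothesis psi_sub : forall y, 0 < psi y -> lam * psi y <= avg e psi y.
Hypothesis psi_mean : forall y, 0 < psi y ->
  m0 <= \sum_(0 <= k < N.+1) k%:R * offspring e y k.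
Hypothesis m1_ge0 : 0 <= m1.
Hypothesis rho_gt1 : 1 < m1 * lam.
Hypothesis s0_gt0 : 0 < s0.
Hypothesis s0_Psi : s0 * Psi <= 1.
Hypothesis s0_small : N%:R ^+ 2 * (s0 * Psi) <= m0 - m1.

(** The quadratic error in [pgf_compl_ge] is at most [N%:R ^+ 2 * (s0 * Psi)] times the linear
    variable, and the slack [m0 - m1] pays for it. The amplitude s is thereby multiplied by
    [m1 * lam]. *)
Lemma branch_subsolution s y : 0 <= s -> s <= s0 ->
  branch e (fun z => 1 - s * psi z) y <= 1 - (m1 * lam) * s * psi y.
Proof.
move=> s_ge0 ss0.
have sp z : 0 <= s * psi z <= s0 * Psi.
  by rewrite mulr_ge0 // ler_pM.
have sp1 z : 0 <= 1 - s * psi z <= 1 by have := sp z; have := s0_Psi; lra.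
have [psi0|psi0] := leP (psi y) 0.
  have -> : psi y = 0 by apply/eqP; rewrite eq_le psi0 psi_ge0.
  by rewrite mulr0 subr0; case/andP: (branch_01 e y sp1).
rewrite /branch avg_compl avgZ; set t := s * avg e psi y.
have t01 : 0 <= t <= s0 * Psi.
  rewrite /t -avgZ avg_ge0 /=; last by move=> z; case/andP: (sp z).
  rewrite -[leRHS](avg_cst e (s0 * Psi) y).
  by apply: avg_le => z _; case/andP: (sp (y + z)).
have t1 : 0 <= t <= 1 by case/andP: t01 => -> /= /le_trans; exact.
have K := @pgf_compl_ge _ _ (offspring_lawP e y) N t t1.
have M := psi_mean psi0; have E := psi_sub psi0.
set mN := \sum_(0 <= k < N.+1) _ in K M.
have h1 : N%:R ^+ 2 * t <= N%:R ^+ 2 * (s0 * Psi).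
  by rewrite ler_wpM2l ?sqr_ge0 //; case/andP: t01.
have h2 : t * m1 <= t * (mN - N%:R ^+ 2 * t).
  by rewrite ler_wpM2l //; [case/andP: t01|have := s0_small; lra].
have h3 : m1 * (s * (lam * psi y)) <= m1 * t.
  by rewrite ler_wpM2l // ler_wpM2l.
lra.
Qed.

Lemma rho_s s : 0 <= s -> s <= (m1 * lam) * s.
Proof. by move=> s_ge0; rewrite ler_peMl // ltW. Qed.

(* A fixed point below [1 - s psi] for one, possibly tiny, s is below [1 - s0 psi]: the
   bound is uniform over all translates of the pattern and all visited sites. *)
Lemma fixpoint_boost (v : site d -> R) s : (forall y, 0 <= v y <= 1) ->
  (forall y, v y = branch e v y) -> 0 < s -> s <= s0 ->
  (forall y, v y <= 1 - s * psi y) -> forall y, v y <= 1 - s0 * psi y.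
Proof.
move=> v01 vfix s_gt0 ss0 vs y.
have s_ge0 := ltW s_gt0.
(* The amplitude is capped at [s0], the range in which [branch_subsolution] applies. *)
have H n z : v z <= 1 - Num.min ((m1 * lam) ^+ n * s) s0 * psi z.
  elim: n z => [|n IH] z; first by rewrite expr0 mul1r min_l.
  set r := Num.min _ s0 in IH.
  have rs0 : r <= s0 by rewrite /r ge_min lexx orbT.
  have r_ge0 : 0 <= r.
    by rewrite /r le_min (ltW s0_gt0) andbT mulr_ge0 // exprn_ge0 //; have := rho_gt1; lra.
  rewrite vfix; apply: (@le_trans _ _ (branch e (fun z => 1 - r * psi z) z)).
    apply: branch_le => // z'; first by case/andP: (v01 z').
    by have := mulr_ge0 r_ge0 (psi_ge0 z'); lra.
  apply: le_trans (branch_subsolution z r_ge0 rs0) _.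
  rewrite lerD2l lerN2 ler_wpM2r // exprS -mulrA /r.
  have : 0 <= (m1 * lam) ^+ n * s by rewrite mulr_ge0 // exprn_ge0 //; have := rho_gt1; lra.
  move: (_ ^+ n * s) => q q0; rewrite ge_min; case: (leP q s0) => qs.
    by rewrite lexx.
  by rewrite (rho_s (ltW s0_gt0)) orbT.
have [n hn] : exists n, s0 <= (m1 * lam) ^+ n * s.
  exact: expr_unbounded.
by have := H n y; rewrite min_r.
Qed.

(** Since [psi] lives on a finite set where [never < 1], some s works for [never]. The bound
    survives iteration and the limit, and [fixpoint_boost] then replaces s by [s0]. *)
Lemma fin_visits_subsolution o y : fin_visits e o y <= 1 - s0 * psi y.
Proof.
have Psi0 : 0 <= Psi := le_trans (psi_ge0 0) (psi_le 0).
have [s [s_gt0 ss0 hs]] : exists s, [/\ 0 < s, s <= s0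
    & forall y, never e o y <= 1 - s * psi y].
  have [s [s_gt0 ss0 hs]] : exists s, [/\ 0 < s, s <= s0
    & forall y, y \in B -> never e o y <= 1 - s * psi y].
    elim: B => [|z B' [s [s_gt0 ss0 hs]]]; first by exists s0; split.
    (* Chosen so that [t * psi z <= 1 - never e o z]; the added 1 keeps the denominator positive. *)
    pose t := (1 - never e o z) / (1 + Psi).
    have t_gt0 : 0 < t.
      by rewrite divr_gt0 ?subr_gt0 ?(never_lt1 S'_gen e_pos) //; lra.
    exists (Num.min s t); split.
    - by rewrite lt_min s_gt0.
    - by rewrite ge_min ss0.
    - move=> z'; rewrite inE => /orP[/eqP ->|/hs h].
        have : Num.min s t * psi z <= t * (1 + Psi).
          apply: ler_pM => //; first by rewrite le_min !ltW.
            by rewrite ge_min lexx orbT.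
          by apply: le_trans (psi_le z) _; lra.
        rewrite /t divfK ?gt_eqF //; first lra.
        by apply: lt_le_trans ltr01 _; lra.
      have : Num.min s t * psi z' <= s * psi z'.
        by rewrite ler_wpM2r // ge_min lexx.
      lra.
  exists s; split => // z; have [|psi0] := ltP 0 (psi z).
    by move/psi_supp; exact: hs.
  have -> : psi z = 0 by apply/eqP; rewrite eq_le psi0 psi_ge0.
  by rewrite mulr0 subr0; case/andP: (never_01 e o z).
apply: (@fixpoint_boost _ s) => //; [exact: fin_visits_01|exact: fin_visitsE|].
move=> z; have L := @cvg_fin_visits _ _ _ e o z.
apply: (ler_cvg_to L (cvg_cst (1 - s * psi z))); apply: nearW => n.
elim: n z {L} => [|n IH] z; first exact: hs.
rewrite iterS; apply: (@le_trans _ _ (branch e (fun z => 1 - s * psi z) z)).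
  apply: branch_le => // z'; first by case/andP: (iter_never_01 e o n z').
  by have := mulr_ge0 (ltW s_gt0) (psi_ge0 z'); lra.
apply: le_trans (branch_subsolution z (ltW s_gt0) ss0) _.
by rewrite lerD2l lerN2 ler_wpM2r // rho_s // ltW.
Qed.
End subsolution.

Section recurrence.
Variables (R : realType) (d : nat) (S : stepset d) (e : env R S).
Implicit Types (D : site d -> Prop) (phi : site d -> R).

(* Says that the random walk hits [D] almost surely, in terms of bounded subharmonic
   functions. *)
Definition unavoidable D : Prop := forall phi, (forall y, 0 <= phi y <= 1) ->
  (forall y, D y -> phi y = 0) -> (forall y, phi y <= avg e phi y) ->
  forall y, phi y = 0.

(** The positive part of the subharmonic function [v - kap] is again subharmonic and vanishes on
    [D]. *)
Lemma unavoidable_max D (v : site d -> R) kap : unavoidable D ->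
  (forall y, 0 <= v y <= 1) -> (forall y, v y <= avg e v y) -> 0 <= kap ->
  (forall y, D y -> v y <= kap) -> forall y, v y <= kap.
Proof.
move=> UD v01 vsub kap0 vD y; pose phi z := Num.max 0 (v z - kap).
have phi_ge z : v z - kap <= phi z by rewrite /phi le_max lexx orbT.
have phi0 z : 0 <= phi z by rewrite /phi le_max lexx.
suff : phi y = 0 by have := phi_ge y; lra.
apply: (UD phi) => z.
- by rewrite phi0 /= /phi ge_max ler01 /=; have := v01 z; lra.
- by move=> /vD h; rewrite /phi max_l // subr_le0.
- rewrite {1}/phi ge_max avg_ge0 //=; apply: (@le_trans _ _ (avg e (fun y => v y - kap) z)).
    by rewrite avgB avg_cst lerD2r.
  by apply: avg_le.
Qed.

(** A bound valid everywhere improves by the factor [1 - eta * c] on [D], by [pgf_le_quad], and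
    [unavoidable_max] spreads the better bound to all sites. Repeating this forces 0. *)
Lemma fin_visits_eq0 D (c eta : R) o : unavoidable D ->
  0 < c <= 1 -> 0 < eta <= 1 ->
  (forall y, D y -> fin_visits e o y <= 1 - c) ->
  (forall y, D y -> offspring e y 1%N <= 1 - eta) ->
  forall y, fin_visits e o y = 0.
Proof.
move=> UD c01 eta01 vD muD y; set v := fin_visits e o.
have v01 := fin_visits_01 e o.
have vsub z : v z <= avg e v z.
  rewrite /v fin_visitsE; apply: pgf_le_id; first exact: offspring_lawP.
  exact: avg_01.
have ec : 0 < eta * c <= 1 by rewrite mulr_gt0 ?mulr_ile1; lra.
have H n : forall z, v z <= (1 - eta * c) ^+ n * (1 - c).
  elim: n => [|n IH].
    rewrite expr0 mul1r; apply: (unavoidable_max UD v01 vsub _ vD); lra.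
  have q0 : 0 <= (1 - eta * c) ^+ n by rewrite exprn_ge0 //; lra.
  have q1 : (1 - eta * c) ^+ n <= 1 by rewrite exprn_ile1 //; lra.
  set q := (1 - eta * c) ^+ n in IH q0 q1.
  have c0 : 0 <= 1 - c by lra.
  have k0 : 0 <= q * (1 - c) by rewrite mulr_ge0.
  have k1 : q * (1 - c) <= 1 - c by rewrite ler_piMl.
  apply: (unavoidable_max UD v01 vsub).
    by rewrite exprS -mulrA mulr_ge0 //; lra.
  move=> z Dz; rewrite /v fin_visitsE -/v exprS -mulrA -/q.
  have kap01 : 0 <= q * (1 - c) <= 1 by lra.
  apply: (@le_trans _ _ (branch e (fun=> q * (1 - c)) z)).
    by apply: branch_le => // z'; [case/andP: (v01 z')|case/andP: kap01].
  rewrite /branch avg_cst; apply: le_trans (pgf_le_quad (offspring_lawP e z) kap01) _.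
  rewrite mulrC ler_wpM2r // lerD2l lerN2.
  by apply: ler_pM; [lra|lra|have := muD z Dz; lra|lra].
have [v0 v1] := andP (v01 y).
apply: (@expr_decay _ (1 - eta * c)) => //; [lra|lra|].
move=> n; apply: le_trans (H n y) _; rewrite ler_piMr ?exprn_ge0 //; lra.
Qed.

Variables (S' : {fset site d}) (gam : R).
Hypothesis gam_gt0 : 0 < gam.
Hypothesis gam_le1 : gam <= 1.
Hypothesis e_gam : forall x s, s \in S' -> gam <= val (e x).1 s.

(** [L i] is the set of sites from which the walk, until it meets [D], stays in the region for [i]
    more steps. Following the path [l] has probability at least [gam ^+ size l] and ends where [phi]
    vanishes; any deviation leaves a site where [phi <= M]. *)
Lemma path_escape D phi (L : nat -> site d -> Prop) (M : R) n :
  (forall y, 0 <= phi y) -> (forall y, D y -> phi y = 0) ->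
  (forall y, phi y <= avg e phi y) ->
  (forall i y s, L i.+1 y -> ~ D y -> s \in (S : {fset site d}) -> L i (y + s)) ->
  (forall i y, L i.+1 y -> L i y) ->
  0 <= M -> (forall y, L n y -> phi y <= M) ->
  forall (l : seq (site d)) x, {subset l <= S'} -> D (x + \sum_(s <- l) s) ->
  L (size l + n)%N x -> phi x <= (1 - gam ^+ size l) * M.
Proof.
move=> phi0 phiD sub Lstep Lnest M0 LM; elim=> [|s l IH] x lS'.
  by rewrite big_nil addr0 => Dx _; rewrite phiD // subrr mul0r.
rewrite big_cons addrA => Dx Lx.
have [Dx0|Dx0] := pselect (D x).
  by rewrite phiD // mulr_ge0 // subr_ge0 exprn_ile1 // ltW.
have sS' : s \in S' by apply: lS'; rewrite mem_head.
have lS'' : {subset l <= S'} by move=> z zl; apply: lS'; rewrite inE zl orbT.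
have sS : s \in (S : {fset site d}).
  by apply: (@step_mem _ _ _ e x); apply: lt_le_trans gam_gt0 (e_gam x sS').
have Ln k y : L (k + n)%N y -> L n y by elim: k => // k IHk /Lnest.
have LxS t : t \in (S : {fset site d}) -> L (size l + n)%N (x + t) by exact: Lstep.
have IHs := IH (x + s) lS'' Dx (LxS s sS).
have h : forall t, t \in (S : {fset site d}) -> 0 <= M - phi (x + t).
  by move=> t tS; rewrite subr_ge0; apply: LM; apply: Ln (LxS t tS).
have K := @avg_ge_term _ _ _ e (fun y => M - phi y) x s h.
rewrite avgB avg_cst in K; have subx := sub x.
have g : gam * (gam ^+ size l * M) <= val (e x).1 s * (M - phi (x + s)).
  apply: ler_pM; [exact: ltW| |exact: e_gam|].
    by rewrite mulr_ge0 // exprn_ge0 // ltW.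
  lra.
rewrite exprS; lra.
Qed.

(** Up to [j] attempts of at most [T] steps each; the budget [j * T] keeps the walk inside [L 0] at
    the start of each attempt. *)
Lemma escape D phi (L : nat -> site d -> Prop) (T : nat) :
  (forall y, 0 <= phi y <= 1) -> (forall y, D y -> phi y = 0) ->
  (forall y, phi y <= avg e phi y) ->
  (forall i y s, L i.+1 y -> ~ D y -> s \in (S : {fset site d}) -> L i (y + s)) ->
  (forall i y, L i.+1 y -> L i y) ->
  (forall y, L 0%N y -> exists l : seq (site d), [/\ (size l <= T)%N, {subset l <= S'}
     & D (y + \sum_(s <- l) s)]) ->
  forall j x, L (j * T)%N x -> phi x <= (1 - gam ^+ T) ^+ j.
Proof.
move=> phi01 phiD sub Lstep Lnest Lpath; elim=> [|j IH] x Lx.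
  by rewrite expr0; case/andP: (phi01 x).
have Lk k i y : L (k + i)%N y -> L i y by elim: k => // k IHk /Lnest.
have gT : gam ^+ T <= 1 by rewrite exprn_ile1 // ltW.
have M0 : 0 <= (1 - gam ^+ T) ^+ j by rewrite exprn_ge0 // subr_ge0.
have [l [lT lS' Dl]] := Lpath x (Lk (j.+1 * T)%N 0%N x ltac:(by rewrite addn0)).
have Lx' : L (size l + j * T)%N x.
  apply: (Lk (T - size l)%N); rewrite addnA subnK //.
apply: le_trans (path_escape _ phiD sub Lstep Lnest M0 IH lS' Dl Lx') _.
  by move=> y; case/andP: (phi01 y).
rewrite exprS ler_wpM2r // lerD2l lerN2.
by rewrite ler_wiXn2l // ltW.
Qed.

End recurrence.

(** * Lattice paths and sets met by the random walk *)

Definition supn d (z : site d) : nat := \max_i `|z 0%R i|%N.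

Lemma supn_ge d (z : site d) i : (`|z 0%R i| <= supn z)%N.
Proof. exact: (leq_bigmax (F := fun i => `|z 0%R i|%N)). Qed.

Lemma supn_le d (z : site d) n : (forall i, `|z 0%R i| <= n)%N -> (supn z <= n)%N.
Proof. by move=> h; apply/bigmax_leqP. Qed.

Lemma supnD d (y z : site d) : (supn (y + z)%R <= supn y + supn z)%N.
Proof.
apply: supn_le => i; rewrite mxE; have := supn_ge y i; have := supn_ge z i.
move: (y 0 i) (z 0 i) (supn y) (supn z) => a b m n; lia.
Qed.

Lemma supnN d (z : site d) : supn (- z) = supn z.
Proof. by apply: eq_bigr => i _; rewrite mxE abszN. Qed.

Section paths.
Variables (d : nat) (A : {fset site d}).
Hypothesis A_gen : generates A.

Definition walks (z : site d) (n : nat) : Prop :=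
  exists l : seq (site d), [/\ (size l <= n)%N, {subset l <= A} & \sum_(s <- l) s = z].

Lemma walks0 : walks 0 0.
Proof. by exists [::]; split => //; rewrite big_nil. Qed.

Lemma walksD y z m n : walks y m -> walks z n -> walks (y + z) (m + n).
Proof.
move=> [l [lm lA ly]] [k [kn kA kz]]; exists (l ++ k); split.
- by rewrite size_cat leq_add.
- by move=> s; rewrite mem_cat => /orP[/lA|/kA].
- by rewrite big_cat /= ly kz.
Qed.

Lemma walks_le z m n : (m <= n)%N -> walks z m -> walks z n.
Proof. by move=> mn [l [lm lA lz]]; exists l; split => //; exact: leq_trans mn. Qed.

Lemma walks_natmul z n k : walks z n -> walks (z *+ k) (n * k).
Proof.
move=> w; elim: k => [|k IH]; first by rewrite mulr0n muln0; exact: walks0.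
by rewrite mulrS mulnS; exact: walksD.
Qed.

(** Each of the finitely many unit vectors and their negatives costs a bounded number of steps, and
    a site is a combination of them with coefficients at most [supn z]. *)
Lemma walks_bound : exists2 C : nat, (0 < C)%N & forall z, walks z (C * supn z).
Proof.
have W z : exists n, walks z n.
  by have [l [_ lA] lz] := A_gen z; exists (size l), l; split.
have [C1 HC1] : exists C1 : nat, forall i : 'I_d,
    walks (delta_mx 0 i) C1 /\ walks (- delta_mx 0 i) C1.
  have [f Hf] := choice (fun i : 'I_d => W (delta_mx 0 i)).
  have [g Hg] := choice (fun i : 'I_d => W (- delta_mx 0 i)).
  exists (\max_i (f i) + \max_i (g i))%N => i; split.
    apply: walks_le (Hf i); apply: leq_trans (leq_addr _ _).
    exact: (leq_bigmax (F := f)).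
  apply: walks_le (Hg i); apply: leq_trans (leq_addl _ _).
  exact: (leq_bigmax (F := g)).
exists (d * C1).+1 => // z; rewrite [z]row_sum_delta.
have h1 i : walks (z 0 i *: delta_mx 0 i) (C1 * supn z).
  apply: (@walks_le _ (C1 * `|z 0%R i|)%N); first by rewrite leq_mul2l supn_ge orbT.
  case: (z 0 i) => k.
    by rewrite absz_nat -natz scaler_nat; apply: walks_natmul; case: (HC1 i).
  rewrite NegzE abszN absz_nat scaleNr -natz scaler_nat -mulNrn.
  by apply: walks_natmul; case: (HC1 i).
have h2 : walks (\sum_(i < d) z 0 i *: delta_mx 0 i) (\sum_(i < d) C1 * supn z).
  elim/big_rec2 : _ => [|i y1 y2 _ w]; [exact: walks0|exact: walksD].
rewrite -row_sum_delta; rewrite -row_sum_delta sum_nat_const card_ord in h2.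
by apply: walks_le h2; rewrite mulSn mulnA leq_addl.
Qed.
End paths.

Lemma stepset_bound d (S : stepset d) :
  exists2 r : nat, (0 < r)%N & forall s, s \in (S : {fset site d}) -> (supn s <= r)%N.
Proof.
exists (\max_(s <- (S : {fset site d})) supn s).+1 => // s sS.
by apply: leqW; apply: (leq_bigmax_seq (F := @supn d)).
Qed.

(** Room [L] for the starting point, on top of the displacement [a ^ L]. *)
Lemma expn_succ_ge a L : (0 < a)%N -> (L + a ^ L <= a.+1 ^ L)%N.
Proof.
move=> a0; elim: L => // k; rewrite !expnS.
have u1 : (0 < a ^ k)%N by rewrite expn_gt0 a0.
move: (a ^ k)%N (a.+1 ^ k)%N u1 => u w u1 IH.
have : (a * u <= a * w)%N by rewrite leq_mul2l (leq_trans _ IH) ?leq_addl ?orbT.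
by rewrite mulSn; lia.
Qed.

Lemma expn_scale_ge K B L : (0 < B)%N ->
  ((2 * K) ^ L * (L * B) <= (4 * K * B) ^ L)%N.
Proof.
move=> B0; rewrite (_ : 4 * K * B = 2 * K * (2 * B))%N; last by ring.
rewrite (expnMn (2 * K) (2 * B)) leq_mul2l; apply/orP; right.
case: L => [|k]; first by rewrite mul0n.
rewrite expnMn leq_mul //; first by rewrite ltnW // ltn_expl.
by rewrite expnS leq_pmulr // expn_gt0 B0.
Qed.

Section unavoidable.
Variables (R : realType) (d : nat) (S : stepset d) (e : env R S).
Variables (S' : {fset site d}) (gam : R) (D : site d -> Prop).
Hypothesis S'_gen : generates S'.
Hypothesis gam_gt0 : 0 < gam.
Hypothesis gam_le1 : gam <= 1.
Hypothesis e_gam : forall x s, s \in S' -> gam <= val (e x).1 s.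

Lemma walks_path y z n C : (forall z, walks S' z (C * supn z)) -> D z ->
  (C * supn (z - y)%R <= n)%N ->
  exists l : seq (site d), [/\ (size l <= n)%N, {subset l <= S'} & D (y + \sum_(s <- l) s)].
Proof.
move=> W Dz le; have [l [lC lS' lE]] := W (z - y); exists l; split => //.
  exact: leq_trans le.
by rewrite lE subrKC.
Qed.

(* A line needs time of order A^L to leave the box of radius A^L, and from every point of
   the box it meets D within C L steps with probability at least gam^(C L), which is much
   larger than A^(- L) for A large. *)
Lemma unavoidable_scales (r : nat) : (0 < r)%N ->
  (forall A L0, exists2 L, (L0 <= L)%N & forall y, (supn y <= A ^ L)%N ->
     exists2 z, D z & (supn (z - y)%R <= r * L)%N) ->
  unavoidable e D.
Proof.
move=> r0 H phi phi01 phiD sub x0.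
have [C C0 W] := walks_bound S'_gen.
have [R0 R00 HR0] := stepset_bound S.
have [K] : exists K : nat, 1 <= K%:R * gam ^+ (C * r).
  have g0 : 0 < gam ^+ (C * r) by rewrite exprn_gt0.
  exists (Num.truncn (gam ^+ (C * r))^-1).+1.
  by rewrite -ler_pdivrMr // mul1r ltW // truncnS_gt.
move=> K1; have K0 : (0 < K)%N by case: K K1 => //; rewrite mul0r ler10.
(* With this base, [a ^ L] exceeds the displacement in [(2 * K) ^ L] attempts of [C * r * L] steps
   of norm at most [R0]. The expected number of successes is at least [2 ^ L]. *)
pose a := (4 * K * (C * r * R0))%N.
have a0 : (0 < a)%N by rewrite !muln_gt0 K0 C0 r0.
have P L : (supn x0 <= L)%N ->
    (forall y, (supn y <= a.+1 ^ L)%N -> exists2 z, D z & (supn (z - y)%R <= r * L)%N) ->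
    phi x0 * (1 + L%:R) <= 1.
  move=> xL HL; pose T := (C * (r * L))%N; pose j := ((2 * K) ^ L)%N.
  pose La i (y : site d) := (supn y + i * R0 <= a.+1 ^ L)%N.
  have E : phi x0 <= (1 - gam ^+ T) ^+ j.
    apply: (escape gam_gt0 gam_le1 e_gam (L := La) phi01 phiD sub).
    - move=> i y s; rewrite /La mulSn => h _ /HR0 hs.
      by apply: leq_trans h; rewrite addnA leq_add2r (leq_trans (supnD _ _)) // leq_add2l.
    - by move=> i y; rewrite /La => /(leq_trans _); apply; rewrite leq_add2l leq_mul2r leqnSn orbT.
    - move=> y; rewrite /La mul0n addn0 => /HL [z Dz zy].
      by apply: (walks_path W Dz); rewrite /T leq_mul2l zy orbT.
    - rewrite /La; apply: leq_trans (expn_succ_ge L a0); apply: leq_add => //.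
      rewrite /a /j /T (_ : _ * _ * R0 = (2 * K) ^ L * (L * (C * r * R0)))%N; last by ring.
      by apply: expn_scale_ge; rewrite !muln_gt0 C0 r0.
  have g0 : 0 <= gam ^+ T by rewrite exprn_ge0 // ltW.
  have g1 : gam ^+ T <= 1 by rewrite exprn_ile1 // ltW.
  have jg : L%:R <= j%:R * gam ^+ T.
    rewrite /j /T mulnA exprM natrX -exprMn natrM -mulrA.
    apply: (@le_trans _ _ (2 ^+ L)).
      by rewrite -natrX ler_nat ltnW // ltn_expl.
    have h : 2 <= 2 * (K%:R * gam ^+ (C * r)) by lra.
    by rewrite lerXn2r // nnegrE ?(le_trans _ h).
  have B := bernoulli_ge j g0.
  (* Since this product is at most 1, Bernoulli's lower bound on its second factor becomes an upper
     bound on the first. *)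
  apply: (@le_trans _ _ ((1 - gam ^+ T) ^+ j * (1 + gam ^+ T) ^+ j)).
    apply: ler_pM => //; [by case/andP: (phi01 x0)|].
    by apply: le_trans B; rewrite lerD2l.
  rewrite -exprMn -subr_sqr expr1n exprn_ile1 ?lerBlDr ?lerDl ?sqr_ge0 //.
  by rewrite subr_ge0 expr_le1.
apply/eqP; rewrite eq_le; have [phi0 _] := andP (phi01 x0); rewrite phi0 andbT leNgt.
apply/negP => phi_gt0.
have [L L0 HL] := H a.+1 (maxn (supn x0) (Num.truncn (phi x0)^-1).+1).
rewrite geq_max in L0; case/andP: L0 => L1 L2.
have := P L L1 HL; apply/negP; rewrite -ltNge.
have : (phi x0)^-1 < L%:R by apply: lt_le_trans (truncnS_gt _) _; rewrite ler_nat.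
rewrite -(ltr_pM2l phi_gt0) divff ?gt_eqF // => h.
by rewrite mulrDr mulr1 ltr_wpDl.
Qed.

End unavoidable.

(** A block of [r] consecutive sites of [D] cannot be jumped over, so the walk stays between two
    such blocks until it meets [D]. The region [La] therefore does not shrink with [i], and the
    number of attempts is unlimited. *)
Lemma unavoidable_line (R : realType) (S : stepset 1) (e : env R S)
    (S' : {fset site 1}) (gam : R) (D : site 1 -> Prop) (r : nat) : (0 < r)%N ->
  generates S' -> 0 < gam -> gam <= 1 ->
  (forall x s, s \in S' -> gam <= val (e x).1 s) ->
  (forall s, s \in (S : {fset site 1}) -> (supn s <= r)%N) ->
  (forall n : nat, exists a b : int, [/\ n%:Z < a, b < - n%:Z,
     forall y : site 1, a <= y 0 0 < a + r%:Z -> D y &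
     forall y : site 1, b - r%:Z < y 0 0 <= b -> D y]) ->
  unavoidable e D.
Proof.
move=> r0 S'_gen gam_gt0 gam_le1 e_gam Sr H phi phi01 phiD sub x0.
have [C C0 W] := walks_bound S'_gen.
have [a [b [xa bx Da Db]]] := H (supn x0 + r)%N.
pose La (i : nat) (y : site 1) := b - r%:Z < y 0 0 < a + r%:Z.
pose width : int := a - b + 2 * r%:Z.
pose T := (C * absz width)%N.
have x0E := supn_ge x0 0.
have E j : phi x0 <= (1 - gam ^+ T) ^+ j.
  apply: (escape gam_gt0 gam_le1 e_gam (L := La) phi01 phiD sub) => //.
  - move=> i y s; rewrite /La mxE => hy nD sS; have := Sr s sS; have := supn_ge s 0.
    have ya : ~ (a <= y 0 0 < a + r%:Z) by move/Da.
    have yb : ~ (b - r%:Z < y 0 0 <= b) by move/Db.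
    move: hy ya yb; move: (y 0 0) (s 0 0) (supn s) => yy ss n; lia.
  - move=> y; rewrite /La => hy.
    apply: (walks_path (z := const_mx a) W).
      by apply: Da; rewrite mxE lexx /=; lia.
    rewrite /T leq_mul2l; apply/orP; right; apply: supn_le => i; rewrite ord1 !mxE.
    by rewrite /width; move: hy xa bx; move: (y 0 0) => yy; lia.
  - by rewrite /La; move: x0E xa bx; move: (x0 0 0) (supn x0) => xx n; lia.
have [phi0 _] := andP (phi01 x0).
have g0 : 0 < gam ^+ T by rewrite exprn_gt0.
have g1 : gam ^+ T <= 1 by rewrite exprn_ile1 // ltW.
by apply: expr_decay E => //; lra.
Qed.

(** * Exponential moments *)

Section pairing.
Variables (R : realType) (d : nat).
Implicit Types (theta eta : 'rV[R]_d) (s t : site d).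

Lemma pairingDr theta s t : pairing theta (s + t) = pairing theta s + pairing theta t.
Proof. by rewrite -big_split; apply: eq_bigr => i _; rewrite mxE intrD mulrDr. Qed.

Lemma pairing0r theta : pairing theta 0 = 0.
Proof. by apply: big1 => i _; rewrite mxE mulr0. Qed.

Lemma pairingNr theta s : pairing theta (- s) = - pairing theta s.
Proof. by rewrite -sumrN; apply: eq_bigr => i _; rewrite mxE mulrNz mulrN. Qed.

Lemma pairing_sumr theta (l : seq (site d)) :
  pairing theta (\sum_(s <- l) s) = \sum_(s <- l) pairing theta s.
Proof. by apply: big_morph; [exact: pairingDr|exact: pairing0r]. Qed.

Lemma pairingDl theta eta s : pairing (theta + eta) s = pairing theta s + pairing eta s.
Proof. by rewrite -big_split; apply: eq_bigr => i _; rewrite mxE mulrDl. Qed.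

Lemma pairingZl (a : R) theta s : pairing (a *: theta) s = a * pairing theta s.
Proof. by rewrite mulr_sumr; apply: eq_bigr => i _; rewrite mxE mulrA. Qed.

Lemma pairing0l s : pairing (0 : 'rV[R]_d) s = 0.
Proof. by apply: big1 => i _; rewrite mxE mul0r. Qed.

Lemma pairing_delta theta i : pairing theta (delta_mx 0 i) = theta 0 i.
Proof.
rewrite /pairing (bigD1 i) //= mxE !eqxx mulr1 big1 ?addr0 // => j ji.
by rewrite mxE (negbTE ji) andbF mulr0.
Qed.

Lemma pairing_continuous s : continuous (fun theta => pairing theta s).
Proof.
apply: continuous_big => [|i _]; first exact: add_continuous.
by move=> theta; apply: continuousM; [exact: coord_continuous|exact: cst_continuous].
Qed.

(** Some signed unit vector has pairing minus the modulus of [theta 0 i] and is a sum of at most [C]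
    elements of [A], so one summand carries at least a share 1/C of this value. *)
Lemma pairing_neg_step (A : {fset site d}) (C : nat) theta i :
  (forall z, walks A z (C * supn z)) -> theta 0 i != 0 ->
  exists2 s, s \in A & C%:R * pairing theta s <= - `|theta 0 i|.
Proof.
move=> W th0; move ME: `|theta 0 i| => M; have M0 : 0 < M by rewrite -ME normr_gt0.
have [l [lC lA lE]] : exists l : seq (site d), [/\ (size l <= C)%N, {subset l <= A}
    & pairing theta (\sum_(s <- l) s) = - M].
  have sd : (supn (delta_mx ord0 i : site d) <= 1)%N.
    by apply: supn_le => j; rewrite mxE; case: (_ && _).
  have [th|th] := leP 0 (theta 0 i).
    have [l [lC lA lE]] := W (- delta_mx 0 i); exists l; split => //.
      by apply: leq_trans lC _; rewrite supnN -[leqRHS]muln1 leq_mul2l sd orbT.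
    by rewrite lE pairingNr pairing_delta -ME ger0_norm.
  have [l [lC lA lE]] := W (delta_mx 0 i); exists l; split => //.
    by apply: leq_trans lC _; rewrite -[leqRHS]muln1 leq_mul2l sd orbT.
  by rewrite lE pairing_delta -ME ltr0_norm // opprK.
apply: contrapT => h.
have H s : s \in A -> - M < C%:R * pairing theta s.
  by move=> sA; rewrite ltNge; apply/negP => le; apply: h; exists s.
have C0 : (0 < C)%N.
  rewrite lt0n; apply/eqP => C0; move: lC; rewrite C0 leqn0 size_eq0 => /eqP l0.
  by move: lE; rewrite l0 big_nil pairing0r; lra.
have l0 : l != [::] by apply/eqP => l0; move: lE; rewrite l0 big_nil pairing0r; lra.
have : - M * (size l)%:R < C%:R * pairing theta (\sum_(s <- l) s).
  rewrite pairing_sumr; case: l l0 lA {lC lE} => // s l _; elim: l s => [|t l IH] s lA.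
    by rewrite big_seq1 mulr1; apply: H; apply: lA; rewrite mem_head.
  have -> : (size [:: s, t & l])%:R = 1 + (size (t :: l))%:R :> R by rewrite nat1r.
  rewrite big_cons !mulrDr mulr1.
  apply: ltrD; first by apply: H; apply: lA; rewrite mem_head.
  by apply: IH => z zl; apply: lA; rewrite inE zl orbT.
have : M * (size l)%:R <= M * C%:R by rewrite ler_wpM2l ?ler_nat // ltW.
rewrite lE; lra.
Qed.

End pairing.

Section exp_moment.
Variables (R : realType) (d : nat) (S : stepset d).
Implicit Types (theta eta : 'rV[R]_d) (p : site d -> R).

Lemma exp_moment_continuous p : continuous (exp_moment S p).
Proof.
apply: continuous_big => [|s _]; first exact: add_continuous.
move=> theta; apply: (@continuousM _ _ (fun th => expR (pairing th s)) (cst (p s)));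
  last exact: cst_continuous.
apply: (@continuous_comp _ _ _ (fun th => pairing th s) expR).
  exact: pairing_continuous.
exact: continuous_expR.
Qed.

(* Both [e^a] and [e^b] lie above the tangent of the exponential at the barycenter. *)
Lemma exp_moment_convex p theta eta t : (forall s, 0 <= p s) -> 0 <= t <= 1 ->
  exp_moment S p ((1 - t) *: theta + t *: eta) <=
  (1 - t) * exp_moment S p theta + t * exp_moment S p eta.
Proof.
move=> p0 t01; rewrite /exp_moment !mulr_sumr -big_split /=; apply: ler_sum => s _.
rewrite pairingDl !pairingZl !mulrA -mulrDl ler_wpM2r //.
move: (pairing theta s) (pairing eta s) => a b.
set c := (1 - t) * a + t * b; have e0 := expR_ge0 c.
have tangent u : expR c * (1 + (u - c)) <= expR u.
  have -> : expR u = expR c * expR (u - c) by rewrite -expRD subrKC.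
  by rewrite ler_wpM2l // expR_ge1Dx.
have ha : (1 - t) * (expR c * (1 + (a - c))) <= (1 - t) * expR a.
  by rewrite ler_wpM2l //; lra.
have hb : t * (expR c * (1 + (b - c))) <= t * expR b by rewrite ler_wpM2l //; lra.
apply: le_trans (lerD ha hb); rewrite le_eqVlt; apply/orP; left; apply/eqP.
rewrite /c; ring.
Qed.

Definition theta_box (M : R) : set 'rV[R]_d := [set theta | forall i, `|theta 0 i| <= M].

Lemma theta_box_compact M : compact (theta_box M).
Proof.
rewrite (_ : theta_box M = [set v : 'rV[R]_d | forall i, `[- M, M]%classic (v ord0 i)]).
  by apply: (@rV_compact R d (fun=> `[- M, M]%classic)) => i; exact: segment_compact.
apply/seteqP; split => v /= h i; have := h i; rewrite /= in_itv /= ler_norml.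
  by move=> ->.
by [].
Qed.

Variables (S' : {fset site d}) (C : nat) (gam : R).
Hypothesis S'S : (S' `<=` S)%fset.
Hypothesis S'_walks : forall z, walks S' z (C * supn z).
Hypothesis gam_gt0 : 0 < gam.

Definition admissible p := (forall s, 0 <= p s) /\ (forall s, s \in S' -> gam <= p s).

Lemma exp_moment_ge_term p theta s : admissible p -> s \in S' ->
  gam * expR (pairing theta s) <= exp_moment S p theta.
Proof.
move=> [p0 pg] sS'; rewrite /exp_moment (big_fsetD1 s) /=; last exact: (fsubsetP S'S).
rewrite -[leLHS]addr0 mulrC lerD //; first by rewrite ler_wpM2l ?expR_ge0 ?pg.
by apply: sumr_ge0 => t _; rewrite mulr_ge0 ?expR_ge0.
Qed.

(** A large coordinate forces a large pairing with some step of [S'], and this single term has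
    weight at least [gam]. The resulting box is the same for all admissible [p]. *)
Lemma exp_moment_coercive p theta c : admissible p -> exp_moment S p theta <= c ->
  theta_box (C%:R * (c / gam)) theta.
Proof.
move=> pA pc i; have c0 : 0 <= c.
  apply: le_trans pc; apply: sumr_ge0 => s _; rewrite mulr_ge0 ?expR_ge0 //.
  by case: pA.
have [->|th0] := eqVneq (theta 0 i) 0.
  by rewrite normr0 !mulr_ge0 // invr_ge0 ltW.
have th0' : (- theta) 0 i != 0 by rewrite mxE oppr_eq0.
have [s sS'] := pairing_neg_step S'_walks th0'.
rewrite mxE normrN -scaleN1r pairingZl mulN1r mulrN lerN2 => h; apply: le_trans h _.
rewrite ler_wpM2l // ler_pdivlMr // mulrC.
apply: le_trans pc; apply: le_trans (exp_moment_ge_term theta pA sS').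
have e1 := expR_ge1Dx (pairing theta s).
by apply: ler_wpM2l; [exact: ltW|lra].
Qed.

Lemma exp_moment_min p : admissible p ->
  exists theta0, forall theta, exp_moment S p theta0 <= exp_moment S p theta.
Proof.
move=> pA; pose c := exp_moment S p 0.
have B0 : theta_box (C%:R * (c / gam)) 0 by apply: (exp_moment_coercive pA).
have [|theta0 _ h] := @compact_EVT_min _ _ (exp_moment S p) _ (ex_intro _ _ B0)
    (@theta_box_compact _).
  exact/continuous_subspaceT/exp_moment_continuous.
exists theta0 => theta; have [le|/ltW le] := leP (exp_moment S p theta) c.
  by apply: h; apply/mem_set; exact: (exp_moment_coercive pA le).
by apply: le_trans le; apply: h; apply/mem_set; exact: B0.
Qed.

End exp_moment.

Definition box d n : seq (site d) :=
  [seq \row_i ((f i)%:Z - n%:Z) | f : {ffun 'I_d -> 'I_(n.*2.+1)}].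

Lemma mem_box d n (z : site d) : (supn z <= n)%N -> z \in box d n.
Proof.
move=> zn; apply/mapP; exists [ffun i => inord (absz (z 0 i + n%:Z)%R)].
  by rewrite mem_enum.
apply/rowP => i; rewrite mxE ffunE; have zi := leq_trans (supn_ge z i) zn.
move: (z 0 i) zi => x xn; rewrite inordK; lia.
Qed.

Lemma size_box d n : size (box d n) = (n.*2.+1 ^ d)%N.
Proof. by rewrite size_map -cardE card_ffun !card_ord. Qed.

(** * The driftless tilt and subsolutions on balls *)

Section gradient.
Variables (R : realType) (d : nat) (S : stepset d).
Implicit Types (theta eta : 'rV[R]_d) (p : site d -> R).

Lemma expR_le_quad (u : R) : `|u| <= 2^-1 -> expR u <= 1 + u + 2 * u ^+ 2.
Proof.
rewrite ler_norml => u1; have h := expR_ge1Dx (- u).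
have e0 := expR_gt0 u.
have h1 : expR u * (1 - u) <= 1.
  apply: (@le_trans _ _ (expR u * expR (- u))); last by rewrite -expRD subrr expR0.
  by rewrite ler_wpM2l ?expR_ge0.
have h2 : 0 <= u ^+ 2 * (1 - 2 * u) by rewrite mulr_ge0 ?sqr_ge0 //; lra.
have u0 : 0 < 1 - u by lra.
rewrite -(ler_pM2r u0); apply: le_trans h1 _; lra.
Qed.

Lemma linear_coef_eq0 (G H tau : R) : 0 < tau -> 0 <= H ->
  (forall t, `|t| <= tau -> 0 <= t * G + t ^+ 2 * H) -> G = 0.
Proof.
move=> tau0 H0 h; apply: contrapT => /eqP G0.
have nG : 0 < `|G| by rewrite normr_gt0.
pose eps := Num.min (tau / `|G|) (2 * (H + 1))^-1.
have H1 : 0 < 2 * (H + 1) by lra.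
have e0 : 0 < eps by rewrite lt_min divr_gt0 //= invr_gt0.
have e1 : eps * `|G| <= tau by rewrite -ler_pdivlMr // /eps ge_min lexx.
have e2 : eps * (2 * (H + 1)) <= 1 by rewrite -ler_pdivlMr // mul1r /eps ge_min lexx orbT.
have := h (- (eps * G)); rewrite normrN normrM (ger0_norm (ltW e0)) => /(_ e1).
have -> : - (eps * G) * G + (- (eps * G)) ^+ 2 * H = (eps * G ^+ 2) * (eps * H - 1) by ring.
have : 0 < eps * G ^+ 2 by rewrite mulr_gt0 // exprn_even_gt0.
move=> /pmulr_rge0 ->; lra.
Qed.

(** The sum is the derivative at the minimizer in direction [eta], i.e. the drift of the tilted
    walk. A quadratic upper bound on the exponential replaces differentiation. *)
Lemma exp_moment_critical p theta0 eta : (forall s, 0 <= p s) ->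
  (forall theta, exp_moment S p theta0 <= exp_moment S p theta) ->
  \sum_(s <- (S : {fset site d})) expR (pairing theta0 s) * p s * pairing eta s = 0.
Proof.
move=> p0 pmin; pose a s := expR (pairing theta0 s) * p s.
have a0 s : 0 <= a s by rewrite mulr_ge0 ?expR_ge0.
pose Y := 1 + \sum_(s <- (S : {fset site d})) `|pairing eta s|.
have Y0 : 0 < Y by rewrite ltr_wpDr // sumr_ge0.
have YS s : s \in (S : {fset site d}) -> `|pairing eta s| <= Y.
  move=> sS; rewrite /Y (big_fsetD1 s) //= addrCA lerDl addr_ge0 // sumr_ge0 //.
pose H := 2 * \sum_(s <- (S : {fset site d})) a s * pairing eta s ^+ 2.
apply: (@linear_coef_eq0 _ H (2 * Y)^-1).
- by rewrite invr_gt0 mulr_gt0.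
- by rewrite mulr_ge0 // sumr_ge0 // => s _; rewrite mulr_ge0 ?sqr_ge0.
move=> t tY; have := pmin (theta0 + t *: eta); rewrite -subr_ge0 => /le_trans; apply.
rewrite /exp_moment -sumrB.
have -> : t * \sum_(s <- (S : {fset site d})) a s * pairing eta s + t ^+ 2 * H =
    \sum_(s <- (S : {fset site d})) a s * (t * pairing eta s + 2 * (t * pairing eta s) ^+ 2).
  rewrite /H mulrA !mulr_sumr -big_split /=; apply: eq_bigr => s _; ring.
rewrite big_seq [leRHS]big_seq; apply: ler_sum => s sS.
rewrite pairingDl pairingZl expRD -/(a s).
have : `|t * pairing eta s| <= 2^-1.
  rewrite normrM; apply: (@le_trans _ _ ((2 * Y)^-1 * Y)).
    by apply: ler_pM => //; exact: YS.
  by rewrite invfM -mulrA mulVf ?mulr1 // gt_eqF.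
move/expR_le_quad/(ler_wpM2l (a0 s)); rewrite /a; lra.
Qed.
End gradient.

Section quadratic.
Variables (R : realType) (d : nat).

Definition toR (x : site d) : 'rV[R]_d := map_mx intr x.

Definition sq (x : site d) : R := pairing (toR x) x.

Lemma sqE x : sq x = \sum_i (x 0 i)%:~R ^+ 2.
Proof. by apply: eq_bigr => i _; rewrite mxE expr2. Qed.

Lemma sqD x s : sq (x + s) = sq x + 2 * pairing (toR x) s + sq s.
Proof.
rewrite /sq /pairing !mulr_sumr -!big_split /=; apply: eq_bigr => i _.
rewrite !mxE intrD; ring.
Qed.

Lemma sq_le x (n : nat) : (supn x <= n)%N -> sq x <= d%:R * n%:R ^+ 2.
Proof.
move=> xn; rewrite sqE; apply: (@le_trans _ _ (\sum_(i < d) (n%:R ^+ 2 : R))).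
  apply: ler_sum => i _; rewrite -[leLHS]real_normK ?num_real // lerXn2r ?nnegrE //.
  rewrite -intr_norm -natr_absz ler_nat; exact: leq_trans (supn_ge x i) xn.
by rewrite sumr_const card_ord mulr_natl.
Qed.

Lemma supn_le_sq x (n : nat) : sq x < n%:R -> (supn x <= n)%N.
Proof.
move=> xn; apply: supn_le => i; rewrite -(ler_nat R) natr_absz intr_norm.
have h : ((x 0 i)%:~R : R) ^+ 2 <= sq x.
  by rewrite sqE (bigD1 i) //= lerDl sumr_ge0 // => j _; exact: sqr_ge0.
case: (eqVneq (x 0 i) 0) => [->|x0]; first by rewrite normr0.
have : 1 <= `|(x 0 i)%:~R : R| by rewrite -intr_norm -[1]/(1%:~R) ler_int; move: x0; lia.
move=> /(ler_wpM2l (normr_ge0 ((x 0 i)%:~R : R))); rewrite mulr1 -expr2 real_normK ?num_real //.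
lra.
Qed.

End quadratic.

Section subsolution_existence.
Variables (R : realType) (d : nat) (S : stepset d).
Variables (S' : {fset site d}) (C : nat) (gam : R).
Hypothesis S'S : (S' `<=` S)%fset.
Hypothesis S'_walks : forall z, walks S' z (C * supn z).
Hypothesis gam_gt0 : 0 < gam.

(* After tilting by the minimizer [theta0] the walk has no drift, so M - |x|^2 decreases by a
   bounded amount on average; close to the boundary of the ball, where this is not
   negligible, the steps pointing inwards alone suffice. *)
Lemma ball_subsolution p (lam lam1 : R) (r : nat) : admissible S' gam p ->
  0 < lam -> lam < lam1 -> (forall theta, lam1 <= exp_moment S p theta) ->
  exists psi : site d -> R, exists n : nat,
    [/\ forall y, 0 <= psi y, forall y, 0 < psi y -> (supn y <= n)%N,
        forall y, (supn y <= r)%N -> 0 < psi y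
      & forall y, 0 < psi y ->
          lam * psi y <= \sum_(s <- (S : {fset site d})) p s * psi (y + s)].
Proof.
move=> pA lam0 lam01 hlam; have p0 : forall s, 0 <= p s by case: pA.
have [theta0 pmin] := exp_moment_min S'S S'_walks gam_gt0 pA.
pose a s := expR (pairing theta0 s) * p s.
have a0 s : 0 <= a s by rewrite mulr_ge0 ?expR_ge0.
pose L := \sum_(s <- (S : {fset site d})) a s.
have L1 : lam1 <= L := hlam theta0.
have [r0 r00 Sr0] := stepset_bound S.
pose Hs : R := d%:R * r0%:R ^+ 2.
have Hs0 : 0 <= Hs by rewrite mulr_ge0 // exprn_ge0.
have sqS s : s \in (S : {fset site d}) -> sq R s <= Hs by move=> /Sr0; exact: sq_le.
have min_pos (l : seq (site d)) : (forall s, s \in l -> 0 < a s) ->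
    exists2 al : R, 0 < al & forall s, s \in l -> al <= a s.
  elim: l => [|s l IH] h; first by exists 1 => // s; rewrite in_nil.
  have [|al al0 Hal] := IH; first by move=> t tl; apply: h; rewrite inE tl orbT.
  exists (Num.min al (a s)); first by rewrite lt_min al0 h ?mem_head.
  by move=> t; rewrite inE => /orP[/eqP ->|/Hal]; rewrite ge_min ?lexx ?orbT // => ->.
have [al al0 Hal] : exists2 al : R, 0 < al & forall s, s \in S' -> al <= a s.
  apply: min_pos => s sS'; rewrite mulr_gt0 ?expR_gt0 // (lt_le_trans gam_gt0) //.
  by case: pA => _; apply.
have [lam_ge0 al_ge0] := (ltW lam0, ltW al0).
(* Where [chi] is at least [K0], the margin [lam1 - lam] pays for the average decrease, which is at
   most [L * Hs]. *)
pose K0 := L * Hs / (lam1 - lam).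
have K00 : 0 <= K0.
  by rewrite divr_ge0 ?mulr_ge0 //; [apply: sumr_ge0 => s _; exact: a0|lra].
(* If a coordinate of x exceeds [Y] in modulus, some step of [S'], of tilted weight at least [al],
   raises [chi] to at least [lam * K0 / al]. *)
pose Y := C%:R * (lam * K0 / al + Hs).
have lK : 0 <= lam * K0 / al by apply: divr_ge0 => //; exact: mulr_ge0.
have Y0 : 0 <= Y by apply: mulr_ge0 => //; exact: addr_ge0.
(* The ball contains all sites of norm at most [r], and its points with [chi < K0] have a coordinate
   beyond [Y]. *)
pose M := 1 + d%:R * r%:R ^+ 2 + K0 + d%:R * Y ^+ 2.
have q1 : 0 <= d%:R * r%:R ^+ 2 :> R by rewrite mulr_ge0 // exprn_ge0.
have q2 : 0 <= d%:R * Y ^+ 2 by rewrite mulr_ge0 // exprn_ge0.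
have M0 : 0 < M by rewrite /M; lra.
pose chi (x : site d) : R := Num.max 0 (M - sq R x).
have chi0 x : 0 <= chi x by rewrite le_max lexx.
have chi_ge x : M - sq R x <= chi x by rewrite le_max lexx orbT.
have chiE x : 0 < chi x -> chi x = M - sq R x.
  by rewrite /chi; have [h|h] := leP 0 (M - sq R x) => //; rewrite ltxx.
pose psi (x : site d) := expR (pairing theta0 x) * chi x.
have psi_gt0 x : (0 < psi x) = (0 < chi x) by rewrite pmulr_rgt0 // expR_gt0.
exists psi, (Num.truncn M).+1; split.
- by move=> y; rewrite mulr_ge0 // expR_ge0.
- move=> y; rewrite psi_gt0 => c0; apply: (@supn_le_sq R).
  by have := truncnS_gt M; have := chiE y c0; lra.
- move=> y /(sq_le R) h; rewrite psi_gt0; apply: lt_le_trans (chi_ge y).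
  rewrite /M; lra.
move=> x; rewrite psi_gt0 => c0; have cx := chiE x c0.
have -> : \sum_(s <- (S : {fset site d})) p s * psi (x + s) =
    expR (pairing theta0 x) * \sum_(s <- (S : {fset site d})) a s * chi (x + s).
  rewrite mulr_sumr; apply: eq_bigr => s _; rewrite /psi pairingDr expRD /a; ring.
rewrite /psi mulrCA ler_wpM2l ?expR_ge0 //.
have [big_k|small_k] := leP K0 (chi x).
  apply: (@le_trans _ _ (\sum_(s <- (S : {fset site d})) a s * (M - sq R (x + s)))); last first.
    by apply: ler_sum => s _; rewrite ler_wpM2l.
  have crit := exp_moment_critical (toR R x) p0 pmin.
  have -> : \sum_(s <- (S : {fset site d})) a s * (M - sq R (x + s)) =
      chi x * L - 2 * \sum_(s <- (S : {fset site d})) a s * pairing (toR R x) s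
      - \sum_(s <- (S : {fset site d})) a s * sq R s.
    rewrite /L !mulr_sumr -!sumrB; apply: eq_bigr => s _; rewrite sqD cx; ring.
  rewrite crit mulr0 subr0.
  have h1 : \sum_(s <- (S : {fset site d})) a s * sq R s <= L * Hs.
    rewrite mulr_suml big_seq [leRHS]big_seq; apply: ler_sum => s sS.
    by rewrite ler_wpM2l // sqS.
  have : K0 * (lam1 - lam) <= chi x * (lam1 - lam) by rewrite ler_wpM2r //; lra.
  rewrite /K0 divfK; last by rewrite gt_eqF // subr_gt0.
  have : chi x * lam1 <= chi x * L by rewrite ler_wpM2l.
  lra.
have [i hi] : exists i, Y < `|(x 0 i)%:~R : R|.
  apply: contrapT => /forallNP h.
  have : sq R x <= d%:R * Y ^+ 2.
    rewrite sqE; apply: (@le_trans _ _ (\sum_(i < d) Y ^+ 2)).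
      apply: ler_sum => i _; rewrite -[leLHS]real_normK ?num_real //.
      by rewrite lerXn2r ?nnegrE // leNgt; apply/negP.
    by rewrite sumr_const card_ord mulr_natl.
  rewrite cx /M in small_k; lra.
have th0 : (toR R x) 0 i != 0.
  by rewrite mxE -normr_gt0 (le_lt_trans Y0).
have [s sS' hs] := pairing_neg_step S'_walks th0; rewrite mxE in hs.
have C0 : 0 < C%:R :> R.
  rewrite ltr0n lt0n; apply/eqP => C0; move: hs; rewrite C0 mul0r.
  by have := le_lt_trans Y0 hi; lra.
have sS := fsubsetP S'S s sS'.
apply: (@le_trans _ _ (a s * chi (x + s))); last first.
  by rewrite (big_fsetD1 s) //= lerDl sumr_ge0 // => t _; rewrite mulr_ge0.
have h1 : lam * K0 / al + Hs <= - pairing (toR R x) s.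
  by rewrite -(ler_pM2l C0); rewrite /Y in hi; lra.
have h2 : lam * K0 / al <= chi (x + s).
  by apply: le_trans (chi_ge _); rewrite sqD; have := sqS s sS; lra.
apply: (@le_trans _ _ (al * (lam * K0 / al))).
  by rewrite [leRHS]mulrC divfK ?gt_eqF // ler_wpM2l // ltW.
apply: ler_pM => //; exact: Hal.
Qed.

End subsolution_existence.

(** * Minimax over the convex hull *)

Lemma pos_part_sq (R : realDomainType) (x z t : R) : 0 <= t ->
  Num.max 0 (x + t * z) ^+ 2 <=
  Num.max 0 x ^+ 2 + 2 * t * (Num.max 0 x * z) + t ^+ 2 * z ^+ 2.
Proof.
move=> t0; have [x0|x0] := leP 0 x.
  have -> : x ^+ 2 + 2 * t * (x * z) + t ^+ 2 * z ^+ 2 = (x + t * z) ^+ 2 by ring.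
  have [h|h] := leP 0 (x + t * z) => //; by rewrite expr0n sqr_ge0.
have -> : 0 ^+ 2 + 2 * t * (0 * z) + t ^+ 2 * z ^+ 2 = (t * z) ^+ 2 by ring.
have [h|h] := leP 0 (x + t * z); last by rewrite expr0n sqr_ge0.
by rewrite lerXn2r ?nnegrE //; lra.
Qed.

Section minimax.
Variables (R : realType) (d : nat) (S : stepset d).
Variables (S' : {fset site d}) (C : nat) (gam : R).
Hypothesis S'S : (S' `<=` S)%fset.
Hypothesis S'_walks : forall z, walks S' z (C * supn z).
Hypothesis gam_gt0 : 0 < gam.

Lemma exp_moment_sum n (w : 'I_n -> R) (q : 'I_n -> site d -> R) theta :
  exp_moment S (fun z => \sum_i w i * q i z) theta = \sum_i w i * exp_moment S (q i) theta.
Proof.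
rewrite /exp_moment; under eq_bigr do rewrite mulr_sumr.
rewrite exchange_big; apply: eq_bigr => i _; rewrite mulr_sumr.
by apply: eq_bigr => s _; rewrite mulrCA.
Qed.

Lemma admissible_hull (K : set (site d -> R)) p :
  (forall q, K q -> admissible S' gam q) -> convex_hull K p -> admissible S' gam p.
Proof.
move=> KA [n [w [q [w0 w1 Kq pE]]]]; split => s => [|sS']; rewrite pE.
  by apply: sumr_ge0 => i _; rewrite mulr_ge0 //; case: (KA _ (Kq i)).
rewrite -[gam]mul1r -w1 mulr_suml; apply: ler_sum => i _; rewrite ler_wpM2l //.
by case: (KA _ (Kq i)) => _; apply.
Qed.

Variables (K : set (site d -> R)) (r : R).
Hypothesis K_adm : forall q, K q -> admissible S' gam q.
Hypothesis K_inf : forall p, convex_hull K p -> forall eps, 0 < eps ->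
  exists theta, exp_moment S p theta < r + eps.

(** By coercivity this box contains every [theta] at which some mixture has moment at most [r + 1],
    so near-minimizers can be compared with minimizers over a compact set. *)
Let Bd := C%:R * ((`|r| + 1) / gam).

Let in_box p theta : admissible S' gam p -> exp_moment S p theta <= r + 1 ->
  theta_box Bd theta.
Proof.
move=> pA h; have := exp_moment_coercive S'S S'_walks gam_gt0 pA h.
move=> hb i; apply: le_trans (hb i) _; apply: ler_wpM2l => //; apply: ler_wpM2r.
  by rewrite invr_ge0 ltW.
by have := ler_norm r; lra.
Qed.

Let box0 : @theta_box R d Bd 0.
Proof.
move=> i; rewrite mxE normr0 /Bd mulr_ge0 // divr_ge0 ?addr_ge0 //; exact: ltW.
Qed.

(* The weights of the mixture are the excesses over [r] at the minimizer of the sum of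
   their squares. *)
Lemma finite_minimax n (q : 'I_n -> site d -> R) : (forall i, K (q i)) ->
  exists2 theta, theta_box Bd theta & forall i, exp_moment S (q i) theta <= r.
Proof.
move=> Kq; pose x theta i := exp_moment S (q i) theta - r.
pose J theta := \sum_i Num.max 0 (x theta i) ^+ 2.
have [|theta0 /set_mem th0B J0] := @compact_EVT_min _ _ J _ (ex_intro _ _ box0)
    (@theta_box_compact _ _ _).
  apply: continuous_subspaceT; apply: continuous_big => [|i _]; first exact: add_continuous.
  rewrite (_ : (fun theta => _) =
      (fun theta => ((exp_moment S (q i) theta - r + `|exp_moment S (q i) theta - r|) / 2) ^+ 2)).
    move=> theta; have c1 : {for theta, continuous (fun theta => exp_moment S (q i) theta - r)}.
      by apply: continuousB; [exact: exp_moment_continuous|exact: cst_continuous].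
    apply: (@continuous_comp _ _ _ (fun theta => (exp_moment S (q i) theta - r +
      `|exp_moment S (q i) theta - r|) / 2) (fun y => y ^+ 2)); last exact: exprn_continuous.
    apply: continuousM; last exact: cst_continuous.
    apply: continuousD => //.
    apply: (@continuous_comp _ _ _ (fun theta => exp_moment S (q i) theta - r) Num.norm) => //.
    exact: norm_continuous.
  apply/funext => theta; congr (_ ^+ 2); rewrite -/(x theta i).
  by have [h|h] := leP 0 (x theta i); [rewrite ger0_norm //|rewrite ltr0_norm //]; lra.
exists theta0 => // j; rewrite leNgt; apply/negP => xj.
pose X i := Num.max 0 (x theta0 i).
have X0 i : 0 <= X i by rewrite le_max lexx.
have Xj : 0 < X j by rewrite lt_max subr_gt0 xj orbT.
pose W := \sum_i X i.
have W0 : 0 < W by rewrite /W (bigD1 j) //= ltr_pwDl // sumr_ge0.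
have SX0 : 0 < \sum_i X i ^+ 2.
  by rewrite (bigD1 j) //= ltr_pwDl ?exprn_gt0 // sumr_ge0 // => i _; exact: sqr_ge0.
(* First-order condition for the minimum of [J] on the segment from [theta0] to [theta]: convexity
   bounds the excesses linearly in t, [pos_part_sq] expands their squares, and a small t isolates
   the linear term. *)
have var theta : theta_box Bd theta -> \sum_i X i ^+ 2 <= \sum_i X i * x theta i.
  move=> thB; pose z i := x theta i - x theta0 i.
  pose G := \sum_i X i * z i; pose H := \sum_i z i ^+ 2.
  have H0 : 0 <= H by apply: sumr_ge0 => i _; exact: sqr_ge0.
  have key t : 0 <= t <= 1 -> 0 <= 2 * t * G + t ^+ 2 * H.
    move=> t01; have [t0 t1] := andP t01.
    pose thetat := (1 - t) *: theta0 + t *: theta.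
    have tB : theta_box Bd thetat.
      move=> i; rewrite !mxE; apply: le_trans (ler_normD _ _) _; rewrite !normrM.
      rewrite (ger0_norm t0) ger0_norm ?subr_ge0 //.
      have -> : Bd = (1 - t) * Bd + t * Bd by ring.
      by rewrite lerD // ler_wpM2l ?subr_ge0.
    have := J0 thetat (mem_set tB); rewrite -subr_ge0 => /le_trans; apply.
    rewrite lerBlDl.
    have -> : J theta0 + (2 * t * G + t ^+ 2 * H) =
        \sum_i (X i ^+ 2 + 2 * t * (X i * z i) + t ^+ 2 * z i ^+ 2).
      by rewrite !big_split /= -!mulr_sumr addrA.
    apply: ler_sum => i _; apply: le_trans (pos_part_sq (x theta0 i) (z i) t0).
    have [q0 _] := K_adm (Kq i).
    have m : x thetat i <= x theta0 i + t * z i.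
      rewrite /z /x; have := exp_moment_convex S theta0 theta q0 t01; rewrite -/thetat; lra.
    have m' : Num.max 0 (x thetat i) <= Num.max 0 (x theta0 i + t * z i).
      by rewrite ge_max le_max lexx /= le_max m orbT.
    by rewrite lerXn2r // nnegrE le_max lexx.
  have G0 : 0 <= G.
    rewrite leNgt; apply/negP => G0.
    pose t := Num.min 1 (- G / (H + 1)).
    have H1 : 0 < H + 1 by lra.
    have t0 : 0 < t by rewrite lt_min ltr01 divr_gt0 // oppr_gt0.
    have t1 : t <= 1 by rewrite /t ge_min lexx.
    have t2 : t * (H + 1) <= - G by rewrite -ler_pdivlMr // /t ge_min lexx orbT.
    have /key : 0 <= t <= 1 by rewrite ltW.
    have -> : 2 * t * G + t ^+ 2 * H = t * (2 * G + t * H) by ring.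
    by rewrite pmulr_rge0 //; lra.
  have : G = \sum_i X i * x theta i - \sum_i X i ^+ 2.
    rewrite -sumrB; apply: eq_bigr => i _; rewrite /z /X.
    by have [h|h] := leP 0 (x theta0 i); ring.
  lra.
pose w i := X i / W; pose p (y : site d) := \sum_i w i * q i y.
have hp : convex_hull K p.
  exists n, w, q; split => //; first by move=> i; rewrite divr_ge0 // ltW.
  by rewrite -mulr_suml mulfV // gt_eqF.
(* By [var], the mixture exceeds [r] by at least the second entry throughout the box; the cap 1
   keeps the near-minimizer inside the box. *)
pose eps := Num.min 1 ((\sum_i X i ^+ 2) / W).
have e0 : 0 < eps by rewrite lt_min ltr01 divr_gt0.
have [theta th] := K_inf hp e0.
have thB : theta_box Bd theta.
  apply: (in_box (admissible_hull K_adm hp)); apply: le_trans (ltW th) _.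
  by rewrite lerD2l /eps ge_min lexx.
have := var theta thB; apply/negP; rewrite -ltNge.
have -> : \sum_i X i * x theta i = W * (exp_moment S p theta - r).
  have E i : X i * x theta i = W * (w i * exp_moment S (q i) theta) - X i * r.
    by rewrite /w /x; field; rewrite gt_eqF.
  by rewrite (eq_bigr _ (fun i _ => E i)) sumrB -mulr_sumr -mulr_suml -exp_moment_sum mulrBr.
rewrite mulrC -ltr_pdivlMr // ltrBlDl; apply: lt_le_trans th _.
by rewrite lerD2l /eps ge_min lexx orbT.
Qed.

(** The finite intersection property of closed sublevel sets in the compact box carries
    [finite_minimax] over to an infinite [K]. *)
Lemma minimax : exists theta, forall q, K q -> exp_moment S q theta <= r.
Proof.
pose f (q : site d -> R) := @theta_box R d Bd `&` [set theta | exp_moment S q theta <= r].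
have := @theta_box_compact R d Bd; rewrite compact_In0.
move=> /(_ _ K f) [].
- exists (fun q => [set theta | exp_moment S q theta <= r]) => // q _.
  apply: (@closed_comp _ _ (exp_moment S q) [set y | y <= r]); last exact: closed_le.
  by move=> theta _; exact: exp_moment_continuous.
- move=> F FK.
  pose q (i : 'I_#|` F|) := nth (fun=> 0) (enum_fset F) i.
  have [i|theta tB tq] := @finite_minimax _ q.
    by apply/set_mem/FK; rewrite mem_nth.
  exists theta => p /= pF; split => //.
  have ip : (index p (enum_fset F) < #|` F|)%N by rewrite index_mem.
  by have := tq (Ordinal ip); rewrite /q /= nth_index.
- by move=> theta h; exists theta => q /h [].
Qed.

End minimax.

(** * The law of the environment *)

Section lindelof.
Variables (R : realType) (I : countType).

Lemma ptws_cvg (F : set_system {ptws I -> R}) (f : {ptws I -> R}) :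
  Filter F -> (forall i, (fun g : {ptws I -> R} => g i) @ F --> f i) -> {ptws, F --> f}.
Proof.
move=> FF h; apply/cvg_sup => i; apply/cvg_image.
  by rewrite eqEsubset; split=> v // _; exists (cst v).
move=> W; rewrite ?nbhs_simpl => /h Q; exists (@^~ i @^-1` W) => //.
by rewrite eqEsubset; split => [j [? + <-//]|j Wj]; exists (fun _ => j).
Qed.

Definition in_box (b : seq (I * (rat * rat))) (g : I -> R) : Prop :=
  forall j, j \in b -> ratr j.2.1 < g j.1 < ratr j.2.2.

Lemma ptws_box (f : {ptws I -> R}) (W : set {ptws I -> R}) : nbhs f W ->
  exists2 b, in_box b f & forall g, in_box b g -> W g.
Proof.
pose F : set_system {ptws I -> R} :=
  [set W | exists2 b, in_box b f & forall g, in_box b g -> W g].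
have FF : Filter F.
  split; first by exists [::].
    move=> P Q [b bf bP] [c cf cQ]; exists (b ++ c).
      by move=> j; rewrite mem_cat => /orP[/bf|/cf].
    move=> g h; split; [apply: bP|apply: cQ] => j jb; apply: h;
      by rewrite mem_cat jb ?orbT.
  by move=> P Q PQ [b bf bP]; exists b => // g /bP/PQ.
suff : {ptws, F --> f} by apply.
apply: ptws_cvg => i O /nbhs_ballP[eps /= e0 eO].
have [a] := @rat_in_itvoo R (f i - eps) (f i) ltac:(lra).
rewrite in_itv /= => /andP[a1 a2].
have [c] := @rat_in_itvoo R (f i) (f i + eps) ltac:(lra).
rewrite in_itv /= => /andP[c1 c2].
exists [:: (i, (a, c))].
  by move=> j; rewrite inE => /eqP -> /=; rewrite a2.
move=> g /(_ (i, (a, c))); rewrite inE eqxx => /(_ isT) /= /andP[g1 g2].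
by apply: eO; rewrite /ball /= ltr_norml; lra.
Qed.

Variables (T : ptopologicalType) (emb : T -> {ptws I -> R}).
Hypothesis emb_continuous : continuous emb.
Hypothesis emb_open : forall U : set T, open U -> exists2 W : set {ptws I -> R},
  open W & U = emb @^-1` W.
Variable P : probability (borel T) R.

Lemma borel_open (U : set T) : open U -> measurable (U : set (borel T)).
Proof. by move=> oU; exact: sub_gen_smallest. Qed.

Lemma in_box_open b : open [set g : {ptws I -> R} | in_box b g].
Proof.
elim: b => [|j b IH].
  by rewrite (_ : [set _ | _] = setT); [exact: openT|apply/seteqP; split].
rewrite (_ : [set _ | _] = [set g : {ptws I -> R} | ratr j.2.1 < g j.1 < ratr j.2.2] `&`
    [set g | in_box b g]).
  apply: openI => //.
  rewrite (_ : [set _ | _] = (fun g : {ptws I -> R} => g j.1) @^-1`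
      `]ratr j.2.1, ratr j.2.2[%classic).
    apply: open_comp; last exact: interval_open.
    by move=> g _; exact: (@proj_continuous _ (fun=> R) j.1).
  by apply/seteqP; split => g /=; rewrite in_itv.
apply/seteqP; split => g /=.
  move=> h; split; first by apply: h; rewrite mem_head.
  by move=> k kb; apply: h; rewrite inE kb orbT.
by move=> [h1 h2] k; rewrite inE => /orP[/eqP ->//|]; exact: h2.
Qed.

(* The rational boxes form a countable base. *)
Lemma support_null (U : set T) : open U -> (forall w, Defs.support P w -> ~ U w) -> P U = 0%E.
Proof.
move=> oU UK.
pose G (b : seq (I * (rat * rat))) : set T :=
  if P [set w | in_box b (emb w)] == 0%E then [set w | in_box b (emb w)] else set0.
have oG b : open [set w : T | in_box b (emb w)].
  apply: (@open_comp _ _ emb [set g | in_box b g]); last exact: in_box_open.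
  by move=> w _; exact: emb_continuous.
have mG b : measurable (G b : set (borel T)).
  by rewrite /G; case: ifP => _; [exact: borel_open|exact: measurable0].
have UG : U `<=` \bigcup_(b in setT) G b.
  move=> w Uw; have [V [oV Vw PV]] : exists V : set T, [/\ open V, V w & P V = 0%E].
    apply: contrapT => h; apply: (UK w) => // V oV Vw.
    by rewrite lt0e measure_ge0 andbT; apply/eqP => PV; apply: h; exists V.
  have [W oW VE] := emb_open oV.
  have [b bw bW] : exists2 b, in_box b (emb w) & forall g, in_box b g -> W g.
    by apply: ptws_box; apply: open_nbhs_nbhs; split => //; rewrite VE in Vw.
  exists b => //; rewrite /G ifT //.
  rewrite -measure_le0 -PV; apply: le_measure; rewrite ?inE.
  - exact: borel_open.
  - exact: borel_open.
  - by rewrite VE => v /bW.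
pose H n : set (borel T) := if choice.unpickle n is Some b then G b else set0.
have NH n : P.-negligible (H n).
  rewrite /H; case: (choice.unpickle n) => [b|]; last exact: negligible_set0.
  apply/negligibleP; first exact: mG.
  by rewrite /G; case: ifP => [/eqP//|_]; exact: measure0.
have UN : P.-negligible (U : set (borel T)).
  apply: (negligibleS _ (negligible_bigcup NH)) => w /UG[b _ Gw].
  by exists (choice.pickle b) => //; rewrite /H choice.pickleK.
by rewrite (measure_negligible _ UN) //; exact: borel_open.
Qed.
End lindelof.

Section law_spaces.
Variables (R : realType) (d : nat) (S : stepset d).

Lemma step_val_continuous : continuous (fun w : step_law R S => val w : {ptws site d -> R}).
Proof. exact: initial_continuous. Qed.

Lemma step_val_open (U : set (step_law R S)) : open U ->
  exists2 W : set {ptws site d -> R}, open W & U = (fun w : step_law R S => val w) @^-1` W.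
Proof. by move=> [W oW <-]; exists W. Qed.

Lemma offspring_val_continuous : continuous (fun mu : offspring_law R => val mu : {ptws nat -> R}).
Proof. exact: initial_continuous. Qed.

Lemma offspring_val_open (U : set (offspring_law R)) : open U ->
  exists2 W : set {ptws nat -> R}, open W & U = (fun mu : offspring_law R => val mu) @^-1` W.
Proof. by move=> [W oW <-]; exists W. Qed.

(** Good patterns are cut out by strict inequalities between finite linear functionals: such
    conditions are open, hence have positive probability once they hold at a point of the
    support. *)
Lemma open_ptws_sum (I : choiceType) (T : ptopologicalType) (emb : T -> {ptws I -> R})
    (l : seq I) (f : I -> R) (c : R) : continuous emb ->
  open [set w : T | c < \sum_(i <- l) f i * emb w i].
Proof.
move=> ec; pose g (w : T) := \sum_(i <- l) f i * emb w i.
have gc : continuous g.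
  apply: continuous_big => [|i _]; first exact: add_continuous.
  move=> w; apply: (@continuousM _ _ (cst (f i)) (fun w => emb w i)).
    exact: cst_continuous.
  apply: (@continuous_comp _ _ _ emb (fun h : {ptws I -> R} => h i)); first exact: ec.
  exact: (@proj_continuous _ (fun=> R) i).
rewrite (_ : [set _ | _] = g @^-1` `]c, +oo[%classic).
  by apply: open_comp => //; exact: interval_open.
by apply/seteqP; split => w /=; rewrite in_itv /= andbT.
Qed.

Lemma step_open_gt (f : site d -> R) (c : R) :
  open [set w : step_law R S | c < \sum_(s <- (S : {fset site d})) f s * val w s].
Proof. exact: open_ptws_sum step_val_continuous. Qed.

Lemma offspring_open_gt (N : nat) (c : R) :
  open [set mu : offspring_law R | c < \sum_(0 <= k < N) k%:R * val mu k].
Proof. exact: open_ptws_sum offspring_val_continuous. Qed.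

Variables (Q : probability (borel (step_law R S)) R)
  (Qt : probability (borel (offspring_law R)) R).

Lemma step_support_null (U : set (step_law R S)) : open U ->
  (forall w, Defs.support Q w -> ~ U w) -> Q U = 0%E.
Proof. by move=> oU; exact: support_null step_val_continuous step_val_open Q U oU. Qed.

Lemma offspring_support_null (U : set (offspring_law R)) : open U ->
  (forall w, Defs.support Qt w -> ~ U w) -> Qt U = 0%E.
Proof. by move=> oU; exact: support_null offspring_val_continuous offspring_val_open Qt U oU. Qed.

End law_spaces.

Section environment_law.
Variables (R : realType) (d : nat) (S : stepset d).
Variables (Q : probability (borel (step_law R S)) R)
  (Qt : probability (borel (offspring_law R)) R) (Theta : probability (env R S) R).
Hypothesis Theta_product : is_product_law Q Qt Theta.
Implicit Types (e : env R S) (x y z : site d).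

Lemma measurable_at_site x (U : set (borel (step_law R S))) (V : set (borel (offspring_law R))) :
  measurable U -> measurable V ->
  measurable [set e : env R S | U (e x).1 /\ V (e x).2].
Proof. by move=> mU mV; apply: sub_gen_smallest; exists x, U, V. Qed.

Lemma prob_at_site x (U : set (borel (step_law R S))) (V : set (borel (offspring_law R))) :
  measurable U -> measurable V ->
  Theta [set e : env R S | U (e x).1 /\ V (e x).2] = (Q U * Qt V)%E.
Proof.
move=> mU mV; have := Theta_product [fset x]%fset (fun=> mU) (fun=> mV).
rewrite big_seq_fset1 => <-; congr (Theta _); apply/seteqP; split => e /=.
  by move=> h y; rewrite inE => /eqP ->.
by apply; rewrite inE.
Qed.

Lemma ae_forall_countable (T : countType) (P : T -> env R S -> Prop) :
  (forall t, {ae Theta, forall e, P t e}) -> {ae Theta, forall e, forall t, P t e}.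
Proof.
move=> h.
have : {ae Theta, forall e, forall n, if choice.unpickle n is Some t then P t e else True}.
  apply/ae_foralln => n; case: (choice.unpickle n) => [t|]; first exact: h.
  exact: aeW.
by apply: filterS => e H t; have := H (choice.pickle t); rewrite choice.pickleK.
Qed.

Lemma ae_prob1 (A : set (env R S)) : measurable A -> Theta A = 1%E ->
  {ae Theta, forall e, A e}.
Proof.
move=> mA A1; exists (~` A); split; [exact: measurableC| |by []].
by rewrite probability_setC // A1 subee.
Qed.

Lemma ae_all_sites (U : set (borel (step_law R S))) (V : set (borel (offspring_law R))) :
  measurable U -> measurable V -> Q U = 1%E -> Qt V = 1%E ->
  {ae Theta, forall e, forall x, U (e x).1 /\ V (e x).2}.
Proof.
move=> mU mV U1 V1; apply: ae_forall_countable => x.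
apply: (ae_prob1 (measurable_at_site x mU mV)).
by rewrite prob_at_site // U1 V1 mule1.
Qed.

Section pattern.
Variables (B : seq (site d)) (U : site d -> set (borel (step_law R S)))
  (V : set (borel (offspring_law R))).
Hypothesis B_uniq : uniq B.
Hypothesis mU : forall x, measurable (U x).
Hypothesis mV : measurable V.

Definition good z : set (env R S) :=
  [set e | forall x, x \in B -> U x (e (z + x)).1 /\ V (e (z + x)).2].

Definition disjoint_translates (Z : seq (site d)) : Prop :=
  uniq Z /\ forall z z' x x', z \in Z -> z' \in Z -> x \in B -> x' \in B ->
    z + x = z' + x' -> z = z'.

Lemma measurable_good z : measurable (good z).
Proof.
rewrite (_ : good z = \bigcap_(x in [set x | x \in B])
    [set e : env R S | U x (e (z + x)).1 /\ V (e (z + x)).2]) //.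
rewrite -[X in measurable X]setCK setC_bigcap; apply: measurableC.
apply: countable_bigcup_measurable => x _; apply: measurableC.
exact: measurable_at_site.
Qed.

Definition good_prob : R := fine (\big[mule/1]_(x <- B) (Q (U x) * Qt V))%E.

Lemma good_prob01 : 0 <= good_prob <= 1 /\
  (\big[mule/1]_(x <- B) (Q (U x) * Qt V))%E = good_prob%:E.
Proof.
have h (l : seq (site d)) : (0 <= \big[mule/1]_(x <- l) (Q (U x) * Qt V) <= 1)%E.
  elim: l => [|x l /andP[IH0 IH1]]; first by rewrite big_nil lee_fin ler01 lexx.
  rewrite big_cons; have q0 : (0 <= Q (U x) * Qt V)%E by rewrite mule_ge0.
  have q1 : (Q (U x) * Qt V <= 1)%E.
    by rewrite -[leRHS]mule1 lee_pmul ?probability_le1.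
  by rewrite mule_ge0 //= -[leRHS]mule1 lee_pmul.
have /andP[h0 h1] := h B.
have E : (\big[mule/1]_(x <- B) (Q (U x) * Qt V))%E = good_prob%:E.
  by rewrite /good_prob fineK // ge0_fin_numE // (le_lt_trans h1) // ltry.
by split => //; rewrite E !lee_fin in h0 h1; rewrite h0.
Qed.

Lemma prob_all_good Z : disjoint_translates Z ->
  Theta [set e | forall z, z \in Z -> good z e] = (good_prob ^+ size Z)%:E.
Proof.
move=> [uZ sepZ]; have [_ gE] := good_prob01.
pose l := [seq z + x | z <- Z, x <- B].
have ul : uniq l.
  apply: allpairs_uniq => // -[z x] [z' x'] /allpairsP[[z1 x1] /= [z1Z x1B [-> ->]]].
  move=> /allpairsP[[z2 x2] /= [z2Z x2B [-> ->]]] /= E.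
  have zz := sepZ _ _ _ _ z1Z z2Z x1B x2B E.
  by rewrite -zz in E *; move/addrI: E => ->.
pose F : {fset site d} := [fset y in l]%fset.
(* The translate covering y, unique by disjointness. It turns the conditions on all translates into
   one condition per site, as the product formula requires. *)
pose zc y := nth 0 Z (find (fun z => y - z \in B) Z).
have zcE z x : z \in Z -> x \in B -> zc (z + x) = z.
  move=> zZ xB; have hz : has (fun z' => z + x - z' \in B) Z.
    by apply/hasP; exists z => //; rewrite addrC addrA addNr add0r.
  have := nth_find 0 hz; rewrite -/(zc (z + x)) => hB.
  have zcZ : zc (z + x) \in Z by rewrite mem_nth // -has_find.
  apply: (sepZ _ _ _ _ zcZ zZ hB xB); by rewrite addrC subrK.
have := Theta_product F (fun y => mU (y - zc y)) (fun=> mV).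
have -> : [set e : env R S | forall y, y \in F -> U (y - zc y) (e y).1 /\ V (e y).2] =
    [set e | forall z, z \in Z -> good z e].
  apply/seteqP; split => e /= h.
    move=> z zZ x xB; have : z + x \in F.
      by rewrite !inE /=; apply/allpairsP; exists (z, x).
    by move=> /h; rewrite zcE // addrC addKr.
  move=> y; rewrite !inE /= => /allpairsP[[z x] /= [zZ xB ->]].
  by have := h z zZ x xB; rewrite zcE // [z + x - z]addrC addKr.
move=> ->; have pF : perm_eq F l.
  by apply: uniq_perm => // y; rewrite !inE.
rewrite (perm_big _ pF) /= /l big_allpairs_dep /=.
rewrite (eq_big_seq (fun=> good_prob%:E)); last first.
  move=> z zZ; rewrite -gE; apply: eq_big_seq => x xB.
  by rewrite zcE // addrC addKr.
elim: (Z) => [|z Z' IH]; first by rewrite big_nil expr0.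
by rewrite big_cons IH exprS EFinM.
Qed.

(** The product formula handles intersections of good events, so complements are introduced one at a
    time by subtraction. The good list [Z2] is there to absorb the subtracted term in the
    induction. *)
Lemma prob_bad_good (Z1 Z2 : seq (site d)) : disjoint_translates (Z1 ++ Z2) ->
  Theta [set e | (forall z, z \in Z1 -> ~ good z e) /\ (forall z, z \in Z2 -> good z e)] =
  ((1 - good_prob) ^+ size Z1 * good_prob ^+ size Z2)%:E.
Proof.
have mA (A : seq (site d)) : measurable [set e | forall z, z \in A -> good z e].
  rewrite (_ : [set e | _] = \bigcap_(z in [set z | z \in A]) good z) //.
  rewrite -[X in measurable X]setCK setC_bigcap; apply: measurableC.
  apply: countable_bigcup_measurable => x _; apply: measurableC; exact: measurable_good.
have mB (A : seq (site d)) : measurable [set e | forall z, z \in A -> ~ good z e].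
  rewrite (_ : [set e | _] = \bigcap_(z in [set z | z \in A]) ~` good z) //.
  rewrite -[X in measurable X]setCK setC_bigcap; apply: measurableC.
  apply: countable_bigcup_measurable => x _; apply: measurableC; apply: measurableC.
  exact: measurable_good.
elim: Z1 Z2 => [|z Z1 IH] Z2 sepZ.
  rewrite expr0 mul1r -prob_all_good //; congr (Theta _).
  by apply/seteqP; split => e /=; [case|].
have sep2 : disjoint_translates (Z1 ++ z :: Z2).
  have pE : perm_eq (Z1 ++ z :: Z2) (z :: Z1 ++ Z2) by exact: permEl (perm_catCA Z1 [:: z] Z2).
  have [u h] := sepZ; split; first by rewrite (perm_uniq pE).
  by move=> z1 z2 x1 x2; rewrite !(perm_mem pE); exact: h.
have sep1 : disjoint_translates (Z1 ++ Z2).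
  have [/= /andP[_ u] h] := sepZ; split=> //.
  by move=> z1 z2 x1 x2 z1Z z2Z; apply: h; rewrite in_cons ?z1Z ?z2Z orbT.
pose A := [set e : env R S | (forall z, z \in Z1 -> ~ good z e) /\ (forall z, z \in Z2 -> good z e)].
have mAA : measurable A by exact: measurableI (mB Z1) (mA Z2).
rewrite (_ : [set e | _] = A `\` good z); last first.
  apply/seteqP; split => e /=.
    move=> [h1 h2]; split; last by apply: h1; rewrite mem_head.
    by split => // z' z'Z; apply: h1; rewrite inE z'Z orbT.
  by move=> [[h1 h2] h3]; split => // z'; rewrite inE => /orP[/eqP ->//|]; exact: h1.
rewrite measureD //; last 2 first.
- exact: measurable_good.
- by rewrite (le_lt_trans (probability_le1 _ _)) // ltry.
rewrite [X in (X - _)%E](IH Z2 sep1).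
rewrite (_ : A `&` good z = [set e | (forall z, z \in Z1 -> ~ good z e) /\
    (forall z', z' \in z :: Z2 -> good z' e)]); last first.
  apply/seteqP; split => e /=.
    by move=> [[h1 h2] h3]; split => // z'; rewrite inE => /orP[/eqP ->//|]; exact: h2.
  move=> [h1 h2]; split; last by apply: h2; rewrite mem_head.
  by split => // z' z'Z; apply: h2; rewrite inE z'Z orbT.
rewrite [X in (_ - X)%E](IH (z :: Z2) sep2) -EFinB /= !exprS; congr _%:E; ring.
Qed.

Lemma prob_all_bad Z : disjoint_translates Z ->
  Theta [set e | forall z, z \in Z -> ~ good z e] = ((1 - good_prob) ^+ size Z)%:E.
Proof.
move=> sepZ; have := @prob_bad_good Z [::]; rewrite cats0 expr0 mulr1 => <- //.
by congr (Theta _); apply/seteqP; split => e /=; [|case].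
Qed.

End pattern.
End environment_law.

(** * Good translates in almost every environment *)

Lemma expr_small (R : realType) (q eps : R) : 0 <= q -> q < 1 -> 0 < eps ->
  exists n, forall m, (n <= m)%N -> q ^+ m <= eps.
Proof.
move=> q0 q1 e0; have C : (fun n => q ^+ n) @ \oo --> (0 : R).
  by apply: cvg_expr; rewrite ger0_norm.
have /cvgrPdist_le/(_ eps e0)[n _ Hn] := C; exists n => m nm.
by have := Hn m nm; rewrite /= sub0r normrN ger0_norm // exprn_ge0.
Qed.

(** The number of sites is at most b^L for a constant b, while d >= 2 gives q^(L^d) <= (q^L)^L; for
    large L the base b q^L is at most 1/2. *)
Lemma union_bound_small (R : realType) (d A L0 : nat) (q eps : R) : (2 <= d)%N ->
  0 <= q -> q < 1 -> 0 < eps ->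
  exists2 L, (L0 <= L)%N & (((A ^ L).*2.+1 ^ d)%N)%:R * q ^+ (L ^ d) <= eps.
Proof.
move=> d2 q0 q1 e0; pose b := ((3 * A.+1) ^ d)%N.
have b0 : 0 < b%:R :> R by rewrite ltr0n expn_gt0.
have [L1 HL1] : exists n, forall m, (n <= m)%N -> b%:R * q ^+ m <= 2^-1.
  have [|n Hn] := @expr_small R q (2^-1 / b%:R) q0 q1; first by rewrite divr_gt0.
  by exists n => m /Hn h; rewrite mulrC -ler_pdivlMr.
have [L2 HL2] := @expr_small R 2^-1 eps ltac:(lra) ltac:(lra) e0.
pose L := maxn L0 (maxn L1 (maxn L2 1)); exists L; first by rewrite leq_maxl.
have [LL1 LL2 L_gt0] : [/\ (L1 <= L)%N, (L2 <= L)%N & (0 < L)%N] by split; rewrite /L; lia.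
apply: le_trans (HL2 L LL2).
have h1 : (((A ^ L).*2.+1 ^ d)%N)%:R <= b%:R ^+ L :> R.
  rewrite -natrX ler_nat /b -expnM [(d * L)%N]mulnC expnM leq_exp2r ?(leq_trans _ d2) //.
  rewrite expnMn; apply: (@leq_trans (3 * A.+1 ^ L)%N).
    have : (A ^ L <= A.+1 ^ L)%N by rewrite leq_exp2r.
    have : (0 < A.+1 ^ L)%N by rewrite expn_gt0.
    by move: (A ^ L)%N (A.+1 ^ L)%N => u v; lia.
  by rewrite leq_mul2r -{1}(expn1 3) leq_exp2l // L_gt0 orbT.
have h2 : q ^+ (L ^ d) <= (q ^+ L) ^+ L.
  rewrite -exprM ler_wiXn2l // ?ltW // -{1}[(L * L)%N]/(L ^ 2)%N leq_pexp2l //.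
apply: (@le_trans _ _ (b%:R ^+ L * (q ^+ L) ^+ L)).
  by apply: ler_pM => //; rewrite exprn_ge0.
by rewrite -exprMn lerXn2r ?nnegrE ?mulr_ge0 ?exprn_ge0 // ?HL1 //; lra.
Qed.

Section existence.
Variables (R : realType) (d : nat) (S : stepset d).
Variables (Q : probability (borel (step_law R S)) R)
  (Qt : probability (borel (offspring_law R)) R) (Theta : probability (env R S) R).
Hypothesis Theta_product : is_product_law Q Qt Theta.
Variables (B : seq (site d)) (U : site d -> set (borel (step_law R S)))
  (V : set (borel (offspring_law R))) (n : nat).
Hypothesis B_uniq : uniq B.
Hypothesis mU : forall x, measurable (U x).
Hypothesis mV : measurable V.
Hypothesis B_le : forall x, x \in B -> (supn x <= n)%N.

Local Notation good := (@good R d S B U V).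
Local Notation prob := (good_prob Q Qt B U V).
Hypothesis good_gt0 : 0 < prob.

Let q := 1 - prob.
Let q0 : 0 <= q.
Proof. by have [/andP[_ h] _] := good_prob01 Q Qt B mU mV; rewrite subr_ge0. Qed.
Let q1 : q < 1. Proof. by rewrite /q; have := good_gt0; lra. Qed.

Lemma separated_dist Z : uniq Z ->
  (forall z z', z \in Z -> z' \in Z -> z != z' -> (n.*2 < supn (z - z'))%N) ->
  disjoint_translates B Z.
Proof.
move=> uZ h; split => // z z' x x' zZ z'Z xB x'B E; apply/eqP; apply: contraT => zz'.
have := h z z' zZ z'Z zz'; rewrite (_ : z - z' = x' - x); last first.
  by apply/eqP; rewrite subr_eq -(inj_eq (addIr x)) E addrAC subrK addrC.
have := supnD x' (- x); rewrite supnN; have := B_le xB; have := B_le x'B.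
by rewrite -addnn; lia.
Qed.

Lemma measurable_bad (Z : seq (site d)) :
  measurable [set e : env R S | forall z, z \in Z -> ~ good z e].
Proof.
rewrite (_ : [set e | _] = \bigcap_(z in [set z | z \in Z]) ~` good z) //.
rewrite -[X in measurable X]setCK setC_bigcap; apply: measurableC.
apply: countable_bigcup_measurable => x _; apply: measurableC; apply: measurableC.
exact: measurable_good.
Qed.

Lemma ae_good_seq (zs : nat -> site d) :
  (forall i j, i != j -> (n.*2 < supn (zs i - zs j)%R)%N) ->
  {ae Theta, forall e, exists k, good (zs k) e}.
Proof.
move=> h; pose N := \bigcap_L [set e : env R S | forall z, z \in map zs (iota 0 L) -> ~ good z e].
have mN : measurable N by apply: bigcap_measurableType => L _; exact: measurable_bad.
exists N; split => //; last first.
  by move=> e /= /forallNP hn L _ z /mapP[k _ ->]; exact: hn.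
apply/eqP; rewrite -measure_le0; apply/lee_addgt0Pr => eps e0; rewrite add0e.
have [L HL] := expr_small q0 q1 e0.
have sZ : disjoint_translates B (map zs (iota 0 L)).
  have inj : injective zs.
    move=> i j E; apply/eqP; apply: contraT => /h; rewrite E subrr.
    by rewrite ltnNge (leq_trans _ (leq0n _)) // supn_le // => k; rewrite mxE.
  apply: separated_dist; first by rewrite map_inj_uniq // iota_uniq.
  move=> _ _ /mapP[i _ ->] /mapP[j _ ->] zz; apply: h.
  by apply: contraNneq zz => ->.
apply: (@le_trans _ _ (Theta [set e : env R S | forall z, z \in map zs (iota 0 L) -> ~ good z e])).
  apply: le_measure; rewrite ?inE //; first exact: measurable_bad.
  by move=> e /(_ L I).
rewrite (prob_all_bad Theta_product B_uniq mU mV sZ) lee_fin size_map size_iota.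
exact: HL.
Qed.

(** Only one suitable scale beyond [L0] is asked for, so it is enough that the failure probability
    of a single scale can be made arbitrarily small. *)
Lemma ae_good_scales (A L0 : nat) : (2 <= d)%N ->
  {ae Theta, forall e, exists2 L, (L0 <= L)%N & forall y, (supn y <= A ^ L)%N ->
    exists2 z, good z e & (supn (z - y)%R <= n.*2.+1 * L)%N}.
Proof.
move=> d2; pose r := n.*2.+1.
(* The spacing [2 n + 1] separates translates of a pattern of radius n; the grid still lies within
   distance [r * L] of y. *)
pose grid L (y : site d) : seq (site d) :=
  [seq y + \row_i ((g i)%:Z * r%:Z) | g : {ffun 'I_d -> 'I_L}].
have gdist L (g g' : {ffun 'I_d -> 'I_L}) (y : site d) : g != g' ->
    (n.*2 < supn ((y + \row_i ((g i)%:Z * r%:Z)) - (y + \row_i ((g' i)%:Z * r%:Z)))%R)%N.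
  move=> gg; have [i gi] : exists i, g i != g' i.
    by apply/existsP; apply: contraNT gg; rewrite negb_exists => /forallP h;
      apply/eqP/ffunP => i; apply/eqP; have := h i; rewrite negbK.
  apply: leq_trans (supn_ge _ i); rewrite !mxE opprD addrACA subrr add0r -mulrBl abszM absz_nat.
  rewrite -[X in (X <= _)%N]mul1n leq_mul // lt0n absz_eq0 subr_eq0.
  by apply: contraNneq gi => -[] /val_inj ->.
have sepg L y : disjoint_translates B (grid L y).
  apply: separated_dist.
    rewrite map_inj_uniq ?enum_uniq // => g g' E; apply/eqP; apply: contraT => /(gdist L g g' y).
    by rewrite E subrr ltnNge (leq_trans _ (leq0n _)) // supn_le // => k; rewrite mxE.
  by move=> _ _ /mapP[g _ ->] /mapP[g' _ ->] zz; apply: gdist; apply: contraNneq zz => ->.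
have sizeg L y : size (grid L y) = (L ^ d)%N.
  by rewrite size_map -cardE card_ffun !card_ord.
pose bad L (l : seq (site d)) := [set e : env R S |
  exists2 y, y \in l & forall z, z \in grid L y -> ~ good z e].
have badS L y l : bad L (y :: l) =
    [set e : env R S | forall z, z \in grid L y -> ~ good z e] `|` bad L l.
  apply/seteqP; split => e /=.
    by move=> [y']; rewrite inE => /orP[/eqP ->|y'l] h; [left|right; exists y'].
  move=> [h|[y' y'l h]]; first by exists y; rewrite ?mem_head.
  by exists y' => //; rewrite inE y'l orbT.
have bad0 L : bad L [::] = set0 by apply/seteqP; split => e // [].
have mbad L l : measurable (bad L l).
  elim: l => [|y l IH]; first by rewrite bad0.
  by rewrite badS; apply: measurableU => //; exact: measurable_bad.
have Pbad L l : (Theta (bad L l) <= ((size l)%:R * q ^+ (L ^ d))%:E)%E.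
  elim: l => [|y l IH]; first by rewrite bad0 measure0 mul0r.
  rewrite badS; apply: le_trans (measureU2 _ _ _) _ => //; first exact: measurable_bad.
  rewrite /= -nat1r mulrDl mul1r EFinD leeD //.
  have := prob_all_bad Theta_product B_uniq mU mV (sepg L y); rewrite sizeg => E.
  by rewrite le_eqVlt; apply/orP; left; apply/eqP; exact: E.
pose N := \bigcap_(L in [set L | (L0 <= L)%N]) bad L (box d (A ^ L)).
have mN : measurable N by apply: bigcap_measurableType => L _; exact: mbad.
exists N; split => //; last first.
  move=> e /= h L LL; apply: contrapT => hb; apply: h; exists L => // y yA.
  apply: contrapT => hz; apply: hb; exists y; first exact: mem_box.
  move=> z /mapP[g _ ->] gz; apply: hz; exists (y + \row_i ((g i)%:Z * r%:Z)) => //.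
  rewrite addrC addKr; apply: supn_le => i; rewrite mxE abszM !absz_nat mulnC.
  by rewrite leq_mul2l ltnW ?orbT.
apply/eqP; rewrite -measure_le0; apply/lee_addgt0Pr => eps e0; rewrite add0e.
have [L LL HL] := union_bound_small A L0 d2 q0 q1 e0.
apply: (@le_trans _ _ (Theta (bad L (box d (A ^ L))))).
  by apply: le_measure; rewrite ?inE // => e /(_ L LL).
by apply: le_trans (Pbad _ _) _; rewrite lee_fin size_box.
Qed.

End existence.

(** * Conclusion *)

Section ae_pattern.
Variables (R : realType) (d : nat) (S : stepset d).
Variables (Q : probability (borel (step_law R S)) R)
  (Qt : probability (borel (offspring_law R)) R) (Theta : probability (env R S) R).
Hypothesis Theta_product : is_product_law Q Qt Theta.
Variables (B : seq (site d)) (U : site d -> set (borel (step_law R S)))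
  (V : set (borel (offspring_law R))) (n : nat).
Hypothesis B_uniq : uniq B.
Hypothesis mU : forall x, measurable (U x).
Hypothesis mV : measurable V.
Hypothesis B_le : forall x, x \in B -> (supn x <= n)%N.
Hypothesis U_gt0 : forall x, x \in B -> (0 < Q (U x))%E.
Hypothesis V_gt0 : (0 < Qt V)%E.

Lemma good_prob_gt0 : 0 < good_prob Q Qt B U V.
Proof.
have [_ E] := good_prob01 Q Qt B mU mV; rewrite -lte_fin -E big_seq.
by elim/big_ind : _ => [|x y|x xB]; [rewrite lte_fin|exact: mule_gt0|rewrite mule_gt0 ?U_gt0].
Qed.

Lemma ae_good_const (f : nat -> int) : (0 < d)%N ->
  (forall i j, i != j -> (n.*2 < `|(f i - f j)%R|)%N) ->
  {ae Theta, forall e, exists k, good B U V (const_mx (f k)) e}.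
Proof.
move=> d0 h; have [i0 _] : exists i : 'I_d, true by exists (Ordinal d0).
apply: (ae_good_seq Theta_product B_uniq mU mV B_le good_prob_gt0) => i j ij.
by apply: leq_trans (supn_ge _ i0); rewrite !mxE; exact: h.
Qed.

Lemma ae_unavoidable (S' : {fset site d}) (gam : R) (r : nat) : (0 < d)%N ->
  generates S' -> 0 < gam -> gam <= 1 -> (0 < r)%N ->
  (forall s, s \in (S : {fset site d}) -> (supn s <= r)%N) ->
  (forall x, (supn x <= r)%N -> x \in B) ->
  {ae Theta, forall e, (forall x s, s \in S' -> gam <= val (e x).1 s) ->
     unavoidable e (fun y => exists2 z, good B U V z e & y - z \in B)}.
Proof.
move=> d0 S'_gen gam0 gam1 r0 Sr Br.
have D0 : (0 : site d) \in B by apply: Br; apply: supn_le => i; rewrite mxE.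
have [d2|d1] := leqP 2 d.
  have : {ae Theta, forall e, forall AL : nat * nat,
      exists2 L, (AL.2 <= L)%N & forall y, (supn y <= AL.1 ^ L)%N ->
      exists2 z, good B U V z e & (supn (z - y)%R <= n.*2.+1 * L)%N}.
    apply: ae_forall_countable => -[A L0] /=.
    exact: (ae_good_scales Theta_product B_uniq mU mV B_le good_prob_gt0).
  apply: filterS => e H e_gam.
  apply: (unavoidable_scales S'_gen gam0 gam1 e_gam (r := n.*2.+1)) => // A L0.
  have [L LL HL] := H (A, L0); exists L => // y /HL[z gz zy]; exists z => //.
  by exists z => //; rewrite subrr.
have {}d1 : d = 1%N by lia.
(* The candidates beyond [m] on each side are disjoint, so one of them is good. By [Br] it covers an
   interval that no step can jump over. *)
have : {ae Theta, forall e, forall m : nat,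
    (exists k : nat, good B U V (const_mx (m.+1 + k * n.*2.+1)%N%:Z) e) /\
    (exists k : nat, good B U V (const_mx (- (m.+1 + k * n.*2.+1)%N%:Z)) e)}.
  apply: ae_forall_countable => m; apply: filterS2.
  - by move=> e h1 h2; split; [exact: h1|exact: h2].
  - by apply: ae_good_const => // i j ij; nia.
  - by apply: ae_good_const => // i j ij; nia.
apply: filterS => e H e_gam; subst d.
apply: (unavoidable_line r0 S'_gen gam0 gam1 e_gam Sr) => m.
have [[k gk] [k' gk']] := H (m + r)%N.
exists (((m + r)%N.+1 + k * n.*2.+1)%N%:Z), (- (((m + r)%N.+1 + k' * n.*2.+1)%N%:Z)).
split; [lia|lia| |].
  move=> y ya; exists (const_mx ((m + r)%N.+1 + k * n.*2.+1)%N%:Z) => //.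
  apply: Br; apply: supn_le => i; rewrite ord1 !mxE; move: ya; move: (y 0 0) => yy; lia.
move=> y ya; exists (const_mx (- ((m + r)%N.+1 + k' * n.*2.+1)%N%:Z)) => //.
apply: Br; apply: supn_le => i; rewrite ord1 !mxE; move: ya; move: (y 0 0) => yy; lia.
Qed.

End ae_pattern.

Section good_patterns.
Variables (R : realType) (d : nat) (S : stepset d) (e : env R S).
Variables (S' : {fset site d}) (psi : site d -> R) (B : seq (site d)).
Variables (N : nat) (m0 m1 lam : R).
Hypothesis S'_gen : generates S'.
Hypothesis e_pos : forall x s, s \in S' -> 0 < val (e x).1 s.
Hypothesis psi_ge0 : forall y, 0 <= psi y.
Hypothesis psi_B : forall y, (y \in B) = (0 < psi y).
Hypothesis m01 : m1 < m0.
Hypothesis m0_gt1 : 1 < m0.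
Hypothesis m1_ge0 : 0 <= m1.
Hypothesis rho_gt1 : 1 < m1 * lam.

Let U x : set (borel (step_law R S)) :=
  [set w : step_law R S | lam * psi x < \sum_(s <- (S : {fset site d})) psi (x + s) * val w s].
Let V : set (borel (offspring_law R)) :=
  [set mu : offspring_law R | m0 < \sum_(0 <= k < N.+1) k%:R * val mu k].
Let D y := exists2 z, good B U V z e & y - z \in B.

(** All constants below depend on the pattern alone, and the translate enters only through a shift
    of [psi]. So one pair [c], [eta] serves every good translate. *)
Lemma good_patterns_fin_visits o : unavoidable e D -> forall y, fin_visits e o y = 0.
Proof.
move=> UD; have h01 := m01; have h0 := m0_gt1; have h1 := m1_ge0.
pose Psi := \sum_(x <- undup B) psi x.
have psi_le y : psi y <= Psi.
  have [yB|] := boolP (y \in B).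
    rewrite /Psi (bigD1_seq y) ?undup_uniq ?mem_undup //= lerDl sumr_ge0 //.
  rewrite psi_B -leNgt => /le_trans; apply; exact: sumr_ge0.
have Psi0 : 0 <= Psi by exact: sumr_ge0.
have min_pos (l : seq (site d)) : {subset l <= B} ->
    exists2 c : R, 0 < c & forall x, x \in l -> c <= psi x.
  elim: l => [|x l IH] lB; first by exists 1 => // x; rewrite in_nil.
  have [|c c0 hc] := IH; first by move=> y yl; apply: lB; rewrite inE yl orbT.
  exists (Num.min c (psi x)); first by rewrite lt_min c0 -psi_B lB ?mem_head.
  by move=> y; rewrite inE => /orP[/eqP ->|/hc]; rewrite ge_min ?lexx ?orbT // => ->.
have [cm cm0 Hcm] := min_pos B (fun x xB => xB).
pose N2 := N%:R ^+ 2 : R; have N20 : 0 <= N2 by exact: sqr_ge0.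
(* A bound for [s0 * Psi] meeting both smallness conditions of [fin_visits_subsolution]. *)
pose kap := Num.min 1 ((m0 - m1) / (1 + N2)).
have kap0 : 0 < kap by rewrite lt_min ltr01 divr_gt0 //; lra.
have kap1 : kap <= 1 by rewrite ge_min lexx.
have kapN : N2 * kap <= m0 - m1.
  apply: (@le_trans _ _ ((1 + N2) * kap)); first by rewrite ler_wpM2r ?ltW //; lra.
  by rewrite mulrC -ler_pdivlMr ?ge_min ?lexx ?orbT //; lra.
pose s0 := kap / (1 + Psi).
have s00 : 0 < s0 by rewrite divr_gt0 //; lra.
have s0P : s0 * Psi <= kap.
  apply: (@le_trans _ _ (s0 * (1 + Psi))); first by rewrite ler_wpM2l ?ltW //; lra.
  by rewrite /s0 divfK // gt_eqF //; lra.
have fin_le z y : good B U V z e -> fin_visits e o y <= 1 - s0 * psi (y - z).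
  move=> gz; have dec y' : z + (y' - z) = y' by exact: subrKC.
  apply: (fin_visits_subsolution S'_gen e_pos (psi := fun y => psi (y - z))
    (B := map (fun x => z + x) B) (N := N) (m0 := m0) (m1 := m1) (lam := lam) (Psi := Psi)) => //.
  - move=> y'; rewrite -psi_B => h; apply/mapP; by exists (y' - z).
  - move=> y'; rewrite -psi_B => /gz[h _]; rewrite dec in h.
    apply: le_trans (ltW h) _; rewrite le_eqVlt; apply/orP; left; apply/eqP.
    by apply: eq_bigr => s _; rewrite mulrC addrAC.
  - by move=> y'; rewrite -psi_B => /gz[_ h]; rewrite dec in h; exact: ltW.
  - by rewrite (le_trans s0P).
  - by apply: le_trans kapN; rewrite ler_wpM2l.
pose c := Num.min 1 (s0 * cm); pose eta := Num.min 1 ((m0 - 1) / N.+1%:R).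
apply: (@fin_visits_eq0 _ _ _ e D c eta) => //.
- by rewrite lt_min ltr01 mulr_gt0 //= ge_min lexx.
- by rewrite lt_min ltr01 divr_gt0 ?ltr0n ?subr_gt0 //= ge_min lexx.
- move=> y [z gz yz]; apply: le_trans (fin_le z y gz) _; rewrite lerD2l lerN2.
  apply: (@le_trans _ _ (s0 * cm)); first by rewrite ge_min lexx orbT.
  by rewrite ler_wpM2l ?(ltW s00) // Hcm.
- move=> y [z gz yz]; have [_ h] := gz _ yz; rewrite subrKC in h.
  have := offspring1_le (offspring_lawP e y) h; have := offspring_le1 (offspring_lawP e y) 1.
  move: (offspring e y 1%N) => a a1 ha; suff : eta <= 1 - a by lra.
  rewrite /eta ge_min; apply/orP; right; rewrite ler_pdivrMr ?ltr0n //.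
  by rewrite -natr1; lra.
Qed.

End good_patterns.

Section supports.
Variables (R : realType) (d : nat) (S : stepset d).
Variables (Q : probability (borel (step_law R S)) R)
  (Qt : probability (borel (offspring_law R)) R).

Lemma step_support_ne : exists w, Defs.support Q w.
Proof.
apply: contrapT => /forallNP h.
have : Q setT = 0%E by apply: step_support_null => [|w sw _]; [exact: openT|exact: (h w)].
by rewrite probability_setT => /eqP; rewrite onee_eq0.
Qed.

Lemma step_law_le1 (w : step_law R S) s : val w s <= 1.
Proof.
have [w0 wS w1] : step_laws S (val w) by have := valP w; rewrite inE.
have [sS|/wS -> //] := boolP (s \in (S : {fset site d})).
by rewrite -w1 (big_fsetD1 s) //= lerDl; apply: sumr_ge0 => t _; exact: w0.
Qed.

Variables (S' : {fset site d}) (gam : R).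
Hypothesis S'S : (S' `<=` (S : {fset site d}))%fset.
Hypothesis Q_ell : Q [set w : step_law R S | forall s, s \in S' -> gam < val w s] = 1%E.

Lemma open_elliptic :
  open [set w : step_law R S | forall s, s \in S' -> gam < val w s].
Proof.
have H (l : seq (site d)) : {subset l <= (S : {fset site d})} ->
    open [set w : step_law R S | forall s, s \in l -> gam < val w s].
  elim: l => [|s l IH] lS.
    rewrite (_ : [set w | _] = setT); first exact: openT.
    by apply/seteqP; split.
  have sS : s \in (S : {fset site d}) by apply: lS; rewrite mem_head.
  rewrite (_ : [set w | _] = [set w : step_law R S |
      gam < \sum_(t <- (S : {fset site d})) (t == s)%:R * val w t] `&`
      [set w : step_law R S | forall s, s \in l -> gam < val w s]).
    by apply: openI; [exact: step_open_gt|apply: IH => t tl; apply: lS; rewrite inE tl orbT].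
  have E (w : step_law R S) : \sum_(t <- (S : {fset site d})) (t == s)%:R * val w t = val w s.
    rewrite (big_fsetD1 s) //= eqxx mul1r big1_fset ?addr0 // => t.
    by rewrite !inE => /andP[/negbTE -> _]; rewrite mul0r.
  apply/seteqP; split => w /=; rewrite E.
    move=> h; split; first by apply: h; rewrite mem_head.
    by move=> t tl; apply: h; rewrite inE tl orbT.
  by move=> [h1 h2] t; rewrite inE => /orP[/eqP -> //|]; exact: h2.
by apply: H => s /(fsubsetP S'S).
Qed.

(** A weight below [gam] would persist on an open neighbourhood of probability zero. The strict
    inequality of the ellipticity assumption becomes a weak one on the support. *)
Lemma support_admissible q : one_step_support Q q -> admissible S' gam q.
Proof.
move=> [w sw <-]; have [w0 wS w1] : step_laws S (val w) by have := valP w; rewrite inE.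
split => // s sS'; rewrite leNgt; apply/negP => lt.
have sS := fsubsetP S'S s sS'.
pose U := [set w : step_law R S |
  - gam < \sum_(t <- (S : {fset site d})) - (t == s)%:R * val w t].
have E (w' : step_law R S) : \sum_(t <- (S : {fset site d})) - (t == s)%:R * val w' t = - val w' s.
  rewrite (big_fsetD1 s) //= eqxx mulN1r big1_fset ?addr0 // => t.
  by rewrite !inE => /andP[/negbTE -> _]; rewrite oppr0 mul0r.
have oU : open U by exact: step_open_gt.
have Uw : U w by rewrite /U /= E ltrN2.
have := sw U oU Uw; rewrite lt0e => /andP[/eqP + _]; apply.
have mA : measurable ([set w : step_law R S | forall s, s \in S' -> gam < val w s] : set (borel _)).
  by apply: borel_open; exact: open_elliptic.
apply/eqP; rewrite -measure_le0.
apply: (@le_trans _ _ (Q (~` [set w : step_law R S | forall s, s \in S' -> gam < val w s]))).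
  apply: le_measure; rewrite ?inE; [exact: borel_open|exact: measurableC|].
  by move=> w'; rewrite /U /= E ltrN2 => h /(_ s sS'); rewrite ltNge (ltW h).
by rewrite probability_setC // Q_ell subee.
Qed.

End supports.

Section main.
Variables (R : realType) (d : nat) (S : stepset d).
Variables (Q : probability (borel (step_law R S)) R)
  (Qt : probability (borel (offspring_law R)) R) (Theta : probability (env R S) R).
Hypothesis d_gt0 : (0 < d)%N.
Hypothesis Theta_product : is_product_law Q Qt Theta.
Variables (S' : {fset site d}) (gam : R).
Hypothesis gam_gt0 : 0 < gam.
Hypothesis S'S : (S' `<=` (S : {fset site d}))%fset.
Hypothesis S'_gen : generates S'.
Hypothesis Q_ell : Q [set w : step_law R S | forall s, s \in S' -> gam < val w s] = 1%E.

Lemma ae_and (P P' : env R S -> Prop) : {ae Theta, forall e, P e} ->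
  {ae Theta, forall e, P' e} -> {ae Theta, forall e, P e /\ P' e}.
Proof. by apply: filterS2 => e h1 h2; split. Qed.

Lemma S'_neq0 : exists s, s \in S'.
Proof.
by have [[|s l] [// _ lS'] _] := S'_gen 0; exists s; apply: lS'; rewrite mem_head.
Qed.

Lemma gam_le1 : gam <= 1.
Proof.
have [w sw] := step_support_ne Q; have [s sS'] := S'_neq0.
have [_ h] : admissible S' gam (val w) by apply: (support_admissible S'S Q_ell); exists w.
exact: le_trans (h s sS') (step_law_le1 w s).
Qed.

Lemma ae_elliptic :
  {ae Theta, forall e, forall x s, s \in S' -> gam <= val (e x).1 s}.
Proof.
pose A := [set w : step_law R S | forall s, s \in S' -> gam < val w s].
have mA : measurable (A : set (borel _)) by apply: borel_open; exact: open_elliptic.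
have := ae_all_sites Theta_product mA measurableT Q_ell (probability_setT Qt).
by apply: filterS => e h x s sS'; have [hA _] := h x; exact: ltW (hA s sS').
Qed.

(** Some step of [S'] has a nonnegative pairing with [theta]. This keeps the sup-inf positive, which
    excludes an infinite m* in the transient case. *)
Lemma exp_moment_ge_gam p theta : admissible S' gam p -> gam <= exp_moment S p theta.
Proof.
move=> pA; have [C C0 W] := walks_bound S'_gen.
have [s sS' ps] : exists2 s, s \in S' & 0 <= pairing theta s.
  have [th0|/eqP th0] := eqVneq theta 0.
    by have [s sS'] := S'_neq0; exists s => //; rewrite th0 pairing0l.
  have [i thi] : exists i, (- theta) 0 i != 0.
    apply: contrapT => /forallNP h; apply: th0; apply/rowP => i; rewrite mxE.
    by have := h i; rewrite mxE oppr_eq0 => /negP; rewrite negbK => /eqP.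
  have [s sS' hs] := pairing_neg_step W thi; exists s => //.
  rewrite -scaleN1r pairingZl mulN1r mulrN in hs.
  have := normr_ge0 ((-1 *: theta) 0 i) => h0.
  have : 0 <= C%:R * pairing theta s by lra.
  by rewrite pmulr_rge0 // ltr0n.
apply: le_trans (exp_moment_ge_term S'S theta pA sS').
rewrite ler_peMr ?(ltW gam_gt0) //; apply: le_trans (expR_ge1Dx _); by rewrite lerDl.
Qed.

Lemma mean_gt_partial (mu : offspring_law R) (c : R) :
  (c%:E < mean_offspring (val mu))%E -> exists N, c < \sum_(0 <= k < N.+1) k%:R * val mu k.
Proof.
have L : offspring_laws (val mu) by have := valP mu; rewrite inE.
rewrite (mean_offspringE L) lte_fin => cm; apply: contrapT => /forallNP h.
have : real_mean (val mu) <= c.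
  have C := cvg_offspring_mean L; rewrite -cvg_shiftS in C.
  apply: (ler_cvg_to C (cvg_cst c)); apply: nearW => N.
  by rewrite leNgt; apply/negP; exact: h.
lra.
Qed.

Lemma partial_le_mean (mu : offspring_law R) N (M : R) : (mean_offspring (val mu) <= M%:E)%E ->
  \sum_(0 <= k < N) k%:R * val mu k <= M.
Proof.
have L : offspring_laws (val mu) by have := valP mu; rewrite inE.
by rewrite (mean_offspringE L) lee_fin; apply: le_trans; exact: mean_partial_le.
Qed.

Lemma support_partial_gt (c : R) : (c%:E < max_mean_offspring Qt)%E ->
  exists N, exists2 mu : offspring_law R, Defs.support Qt mu &
    c < \sum_(0 <= k < N.+1) k%:R * val mu k.
Proof.
move=> /ereal_sup_gt[_ [mu smu <-] /mean_gt_partial[N hN]].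
by exists N, mu.
Qed.

(** The mean is a supremum of continuous truncations, hence lower semicontinuous. Exceeding [M] is
    thus an open condition that misses the support, so it is null. *)
Lemma ae_mean_le (M : R) : (max_mean_offspring Qt <= M%:E)%E ->
  {ae Theta, forall e, forall x, real_mean (offspring e x) <= M}.
Proof.
move=> hM; pose W := \bigcup_N [set mu : offspring_law R | M < \sum_(0 <= k < N) k%:R * val mu k].
have oW : open W by apply: bigcup_open => N _; exact: offspring_open_gt.
have W0 : Qt W = 0%E.
  apply: offspring_support_null => // mu smu [N _ /=]; apply/negP; rewrite -leNgt.
  apply: partial_le_mean; apply: le_trans hM.
  by apply: ereal_sup_ubound; exists mu.
have mW : measurable (W : set (borel _)) by exact: borel_open.
have W1 : Qt (~` W) = 1%E by rewrite probability_setC // W0 sube0.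
have := ae_all_sites Theta_product measurableT (measurableC mW) (probability_setT Q) W1.
apply: filterS => e h x; have [_ hx] := h x.
apply: (ler_cvg_to (cvg_offspring_mean (offspring_lawP e x)) (cvg_cst M)); apply: nearW => N.
by rewrite leNgt; apply/negP => lt; apply: hx; exists N.
Qed.

(** The one-site pattern [[:: 0]], with no constraint on the steps, provides the site [x1] required
    by the maximum principle. *)
Lemma ae_branching : (1 < max_mean_offspring Qt)%E ->
  {ae Theta, forall e, exists x, offspring e x 1%N < 1}.
Proof.
move=> /support_partial_gt[N [mu smu muN]].
pose V := [set nu : offspring_law R | 1 < \sum_(0 <= k < N.+1) k%:R * val nu k].
have oV : open V by exact: offspring_open_gt.
have mV : measurable (V : set (borel _)) by exact: borel_open.
have V0 : (0 < Qt V)%E by exact: smu.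
have h i j : i != j -> ((0 : nat).*2 < `|((i : nat)%:Z - (j : nat)%:Z)%R|)%N by lia.
have B0 (x : site d) : x \in [:: (0 : site d)] -> (supn x <= 0)%N.
  by rewrite inE => /eqP ->; apply: supn_le => i; rewrite mxE.
have Q0 (x : site d) : x \in [:: (0 : site d)] -> (0 < Q setT)%E by rewrite probability_setT.
have := @ae_good_const _ _ _ Q Qt Theta Theta_product [:: 0] (fun=> setT) V 0 isT
  (fun=> measurableT) mV B0 Q0 V0 Posz d_gt0 h.
apply: filterS => e [k /(_ 0)]; rewrite mem_head => /(_ isT)[_ hV].
exists (const_mx (Posz k) + 0); have := offspring1_le (offspring_lawP e _) hV.
rewrite subrr; have : 0 <= N%:R :> R by [].
rewrite le_eqVlt => /orP[/eqP <-|N0]; first by rewrite mul0r ltxx.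
by rewrite pmulr_rgt0 // subr_gt0.
Qed.

Lemma transient_case (M : R) : 0 < M -> (1 < max_mean_offspring Qt)%E ->
  (max_mean_offspring Qt <= M%:E)%E ->
  (forall p, convex_hull (one_step_support Q) p -> forall eps, 0 < eps ->
     exists theta, exp_moment S p theta < M^-1 + eps) ->
  {ae Theta, forall e, forall o, fin_visits e o o = 1}.
Proof.
move=> M0 m1 mM hinf; have [C _ W] := walks_bound S'_gen.
have [theta hth] := minimax S'S W gam_gt0 (support_admissible S'S Q_ell) hinf.
pose U := [set w : step_law R S | M^-1 <
  \sum_(s <- (S : {fset site d})) expR (pairing theta s) * val w s].
have oU : open U by exact: step_open_gt.
have U0 : Q U = 0%E.
  apply: step_support_null => // w sw; apply/negP; rewrite -leNgt.
  by apply: hth; exists w.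
have mU : measurable (U : set (borel _)) by exact: borel_open.
have U1 : Q (~` U) = 1%E by rewrite probability_setC // U0 sube0.
have H1 := ae_all_sites Theta_product (measurableC mU) measurableT U1 (probability_setT Qt).
have H2 := ae_mean_le mM; have H3 := ae_branching m1.
have H := ae_and (ae_and H1 H3) (ae_and H2 ae_elliptic).
move: H; apply: filterS => e [[hU [x1 hx1]] [hmean hell]] o.
have e_pos x s : s \in S' -> 0 < val (e x).1 s.
  by move=> sS'; exact: lt_le_trans gam_gt0 (hell x s sS').
apply: (@supersolution_fin_visits _ _ _ e S' (fun x => expR (pairing theta x)) o x1) => //.
  by move=> x; exact: expR_gt0.
move=> x; have -> : avg e (fun y => expR (pairing theta y)) x =
    expR (pairing theta x) * exp_moment S (val (e x).1) theta.
  rewrite /exp_moment mulr_sumr; apply: eq_bigr => s _; rewrite pairingDr expRD; ring.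
have [hx _] := hU x.
have le1 : exp_moment S (val (e x).1) theta <= M^-1 by rewrite leNgt; apply/negP.
rewrite mulrCA ler_piMr ?expR_ge0 //.
rewrite -(mulfV (lt0r_neq0 M0)); apply: ler_pM => //.
  exact: le_trans ler01 (real_mean_ge1 e x).
by apply: sumr_ge0 => s _; rewrite mulr_ge0 ?expR_ge0 ?step_ge0.
Qed.

Lemma recurrent_case p (lam1 : R) : convex_hull (one_step_support Q) p ->
  0 < lam1 -> (forall theta, lam1 <= exp_moment S p theta) ->
  ((lam1^-1)%:E < max_mean_offspring Qt)%E ->
  {ae Theta, forall e, forall o y, fin_visits e o y = 0}.
Proof.
move=> hp lam10 hlam1 /support_partial_gt[N [mu smu muN]].
have pA := admissible_hull (support_admissible S'S Q_ell) hp.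
have [C _ W] := walks_bound S'_gen.
(* At [theta = 0] the exponential moment is the total mass. Hence [lam1^-1 >= 1], which makes
   [m0 > 1] below. *)
have lam1_le1 : lam1 <= 1.
  apply: le_trans (hlam1 0) _; have [n [w [q [w0 w1 Kq pE]]]] := hp.
  have -> : p = fun z => \sum_i w i * q i z by exact/funext.
  rewrite exp_moment_sum -w1; apply: ler_sum => i _.
  have [v sv <-] := Kq i; rewrite ler_piMr // /exp_moment.
  have [_ _ v1] : step_laws S (val v) by have := valP v; rewrite inE.
  by rewrite -v1; apply: ler_sum => s _; rewrite pairing0l expR0 mul1r.
pose mN := \sum_(0 <= k < N.+1) k%:R * val mu k.
pose a := lam1^-1; have a1 : 1 <= a by rewrite invf_ge1.
(* Equal spacing a < m1 < m0 < mN: the top gap makes the offspring condition open at [mu], the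
   middle one absorbs the quadratic error, the bottom one gives [1 < m1 * lam1]. *)
pose t := (mN - a) / 3; have t0 : 0 < t by rewrite divr_gt0 // subr_gt0.
have t3 : mN = a + 3 * t by rewrite /t mulrC divfK //; ring.
pose m0 := a + 2 * t; pose m1 := a + t.
have m10 : 0 < m1 by rewrite /m1; lra.
have m1lam1 : 1 < m1 * lam1.
  by rewrite /m1 mulrDl mulVf ?gt_eqF // ltrDl mulr_gt0.
(* The gap between [lam] and [lam1] is spent in [ball_subsolution]; that between [lam2] and [lam]
   yields, at each site, a component satisfying a strict and hence open condition. *)
pose lam2 := (m1^-1 + lam1) / 2; pose lam := (lam2 + lam1) / 2.
have im1 : m1^-1 < lam1 by rewrite -[m1^-1]mul1r ltr_pdivrMr // mulrC.
have im10 : 0 < m1^-1 by rewrite invr_gt0.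
have rho : 1 < m1 * lam2.
  have : m1 * m1^-1 = 1 by rewrite mulfV // gt_eqF.
  rewrite /lam2; lra.
have lam20 : 0 < lam2 by rewrite /lam2; lra.
have lam2lam : lam2 < lam by rewrite /lam /lam2; lra.
have lamlam1 : lam < lam1 by rewrite /lam /lam2; lra.
have [r r0 Sr] := stepset_bound S.
have [psi [n [psi0 psin psir psub]]] :=
  ball_subsolution S'S W gam_gt0 r pA (lt_trans lam20 lam2lam) lamlam1 hlam1.
pose B := [seq y <- undup (box d n) | 0 < psi y].
have Bpsi y : (y \in B) = (0 < psi y).
  rewrite mem_filter mem_undup; case: ltP => //= /psin h; by rewrite mem_box.
pose U x : set (borel (step_law R S)) :=
  [set w : step_law R S | lam2 * psi x < \sum_(s <- (S : {fset site d})) psi (x + s) * val w s].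
pose V : set (borel (offspring_law R)) :=
  [set nu : offspring_law R | m0 < \sum_(0 <= k < N.+1) k%:R * val nu k].
have oU x : open (U x : set (step_law R S)) by exact: step_open_gt.
have oV : open (V : set (offspring_law R)) by exact: offspring_open_gt.
have U0 x : x \in B -> (0 < Q (U x))%E.
  rewrite Bpsi => psix; have [k [w [q [w0 w1 Kq pE]]]] := hp.
  have [w' sw' hw'] : exists2 w' : step_law R S, Defs.support Q w' & U x w'.
    apply: contrapT => h.
    have hq i : \sum_(s <- (S : {fset site d})) psi (x + s) * q i s <= lam2 * psi x.
      have [v sv vq] := Kq i; rewrite leNgt; apply/negP => lt; apply: h; exists v => //.
      by rewrite /U /= vq.
    have : \sum_(s <- (S : {fset site d})) p s * psi (x + s) <= lam2 * psi x.
      have -> : \sum_(s <- (S : {fset site d})) p s * psi (x + s) =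
          \sum_i w i * \sum_(s <- (S : {fset site d})) psi (x + s) * q i s.
        under [RHS]eq_bigr do rewrite mulr_sumr.
        rewrite exchange_big; apply: eq_bigr => s _; rewrite pE mulr_suml.
        by apply: eq_bigr => i _; ring.
      rewrite -[leRHS]mul1r -w1 mulr_suml; apply: ler_sum => i _.
      by rewrite ler_wpM2l.
    have := psub x psix; have : lam2 * psi x < lam * psi x by rewrite ltr_pM2r.
    lra.
  exact: sw' _ (oU x) hw'.
have V0 : (0 < Qt V)%E by apply: smu => //; rewrite /V /= -/mN t3 /m0; lra.
have B_le x : x \in B -> (supn x <= n)%N by rewrite Bpsi; exact: psin.
have Br x : (supn x <= r)%N -> x \in B by rewrite Bpsi; exact: psir.
have B_uniq : uniq B by rewrite filter_uniq // undup_uniq.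
have mU x : measurable (U x) by exact: borel_open.
have mV : measurable V by exact: borel_open.
have := ae_unavoidable Theta_product B_uniq mU mV B_le U0 V0 d_gt0 S'_gen gam_gt0 gam_le1 r0 Sr Br.
move=> H; have H' := ae_and H ae_elliptic.
move: H'; apply: filterS => e [UD hell] o; have {}UD := UD hell.
have e_pos x s : s \in S' -> 0 < val (e x).1 s.
  by move=> sS'; exact: lt_le_trans gam_gt0 (hell x s sS').
have G := @good_patterns_fin_visits _ _ _ e S' psi B N m0 m1 lam2 S'_gen e_pos psi0 Bpsi.
apply: (G _ _ _ rho o UD).
- by rewrite /m0 /m1; lra.
- by rewrite /m0; lra.
- exact: ltW.
Qed.

End main.

Theorem corollary3p6 (R : realType) (d : nat) (d_ge1 : (1 <= d)%N)
    (S : stepset d)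
    (Q : probability (borel (step_law R S)) R)
    (Qt : probability (borel (offspring_law R)) R)
    (Theta : probability (env R S) R)
    (PP : env R S -> site d -> probability (trajectory_space d) R)
    (Theta_product : is_product_law Q Qt Theta)
    (PP_bmc : forall e x, is_bmc_law e x (PP e x))
    (Q_elliptic : elliptic Q)
    (mstar_gt1 : (1 < max_mean_offspring Qt)%E) :
  let sup_inf := ereal_sup
    [set ereal_inf [set (exp_moment S p theta)%:E | theta in [set: 'rV[R]_d]]
    | p in convex_hull (one_step_support Q)] in
  (((max_mean_offspring Qt)^-1 < sup_inf)%E ->
     {ae Theta, forall e, strongly_recurrent PP e}) /\
  (~ ((max_mean_offspring Qt)^-1 < sup_inf)%E ->
     {ae Theta, forall e, transient PP e}).
Proof.
have [gam [S' [gam_gt0 S'S [S'_gen _] Q_ell]]] := Q_elliptic.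
have alphaE e x : alpha PP e x = (1 - fin_visits e x x)%:E.
  exact: prob_visits_infty.
move=> sup_inf; have K_adm := support_admissible S'S Q_ell.
have m_inv_ge0 : (0 <= (max_mean_offspring Qt)^-1)%E.
  by rewrite inve_ge0 (le_trans _ (ltW mstar_gt1)).
split.
  move=> /ereal_sup_gt[_ [p hp <-] hlt].
  pose I := ereal_inf [set (exp_moment S p theta)%:E | theta in [set: 'rV[R]_d]].
  have Ile theta : (I <= (exp_moment S p theta)%:E)%E by apply: ereal_inf_lbound; exists theta.
  have I0 : (0 < I)%E by exact: le_lt_trans hlt.
  have IE : I = (fine I)%:E.
    by rewrite fineK // ge0_fin_numE ?ltW // (le_lt_trans (Ile 0)) // ltry.
  have lam0 : 0 < fine I by rewrite -lte_fin -IE.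
  have hI theta : fine I <= exp_moment S p theta by rewrite -lee_fin -IE.
  have mI : ((fine I)^-1%:E < max_mean_offspring Qt)%E.
    move: hlt mstar_gt1; rewrite -/I IE; case: (max_mean_offspring Qt) => [M| |] //.
      rewrite lte_fin => h M1; move: h; rewrite inver gt_eqF ?(lt_trans ltr01) // !lte_fin.
      have M0 : 0 < M by exact: lt_trans ltr01 M1.
      by move=> h; rewrite -[X in _ < X]invrK ltf_pV2 ?posrE ?invr_gt0.
    by move=> _ _; rewrite ltry.
  have := recurrent_case d_ge1 Theta_product gam_gt0 S'S S'_gen Q_ell hp lam0 hI mI.
  by apply: filterS => e h x; rewrite alphaE h subr0.
move=> /negP; rewrite -leNgt => hle.
have hinf p : convex_hull (one_step_support Q) p ->
    (ereal_inf [set (exp_moment S p theta)%:E | theta in [set: 'rV[R]_d]] <=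
     (max_mean_offspring Qt)^-1)%E.
  by move=> hp; apply: le_trans hle; apply: ereal_sup_ubound; exists p.
have [w sw] := step_support_ne Q.
have hull_w : convex_hull (one_step_support Q) (val w).
  exists 1%N, (fun=> 1), (fun=> val w); split => //.
  - by rewrite big_ord1.
  - by move=> _; exists w.
  - by move=> z; rewrite big_ord1 mul1r.
(* The inverse of an infinite m* is 0, so this positive lower bound makes m* a real number. *)
have gam_inf : (gam%:E <= (max_mean_offspring Qt)^-1)%E.
  apply: le_trans (hinf _ hull_w); apply: le_ereal_inf_tmp => _ [theta _ <-]; rewrite lee_fin.
  apply: (exp_moment_ge_gam gam_gt0 S'S S'_gen); exact: admissible_hull K_adm hull_w.
have [M [M0 ME]] : exists M : R, 0 < M /\ max_mean_offspring Qt = M%:E.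
  move: gam_inf mstar_gt1; case: (max_mean_offspring Qt) => [M| |] //.
    by rewrite lte_fin => _ M1; exists M; split => //; exact: lt_trans ltr01 M1.
  by rewrite invey lee_fin leNgt gam_gt0.
have H : {ae Theta, forall e, forall o, fin_visits e o o = 1}.
  apply: (transient_case d_ge1 Theta_product gam_gt0 S'S S'_gen Q_ell M0) => //.
    by rewrite ME.
  move=> p hp eps e0; have := hinf p hp; rewrite ME inver gt_eqF // => h.
  have /ereal_inf_lt[_ [theta _ <-]] : (ereal_inf [set (exp_moment S p theta)%:E
      | theta in [set: 'rV[R]_d]] < (M^-1 + eps)%:E)%E.
    by apply: le_lt_trans h _; rewrite lte_fin ltrDl.
  by rewrite lte_fin; exists theta.
by move: H; apply: filterS => e h x; rewrite alphaE h subrr.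
Qed.
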